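(* Consider the stochastic Schrödinger equation on the sphere $i\partial_tu(t)=\Delta_{\mathbb S^2}u(t)+\dot L(t)$ with initial value $u_0$ and a (possibly complex-valued) mean-zero $Q$-Lévy process $L$ which is of trace class. Let $u_n^\kappa$ be the fully discrete approximation given by the backward Euler--Maruyama method with time step $\tau>0$. (i) If $u_0\in L^2(\mathbb S^2;\mathbb C)$ and $\mathbb E[\mathcal M_0^\kappa]<\infty$, then $$\mathbb E[\mathcal M_n^\kappa]\le\mathbb E[\mathcal M_0^\kappa]+\frac{\operatorname{Tr}(Q^\kappa)}\tau+t_nv_{0,0}$$ for every discrete time $t_n=n\tau$, $n\ge0$, where $v_{0,0}=\operatorname{Var}(L_{0,0}(1))$. Furthermore, $$\lim_{n\to\infty}\frac{\mathbb E[\mathcal M_n^\kappa]}{t_n}=v_{0,0}.$$ (ii) If $u_0\in H^1(\mathbb S^2;\mathbb C)$ and $\mathbb E[\mathcal E_0^\kappa]<\infty$, then $$\mathbb E[\mathcal E_n^\kappa]\le\mathbb E[\mathcal E_0^\kappa]+\frac{\operatorname{Tr}\left(Q^\kappa(-\Delta^\kappa_{\mathbb S^2})\right)}\tau$$ for every discrete time $t_n=n\tau$, $n\ge0$. Therefore, $$\lim_{n\to\infty}\frac{\mathbb E[\mathcal E_n^\kappa]}{t_n}=0.$$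
   Context: $\mathbb S^2\subset\mathbb R^3$ is the unit sphere with its surface measure. $L^2(\mathbb S^2;\mathbb C)$ carries the Hermitian inner product $\langle f,g\rangle=\int_{\mathbb S^2}f\overline g\,dx$ and norm $\|\cdot\|$. $\Delta_{\mathbb S^2}$ is the Laplace--Beltrami operator and $\nabla_{\mathbb S^2}$ the surface gradient, viewed as $\mathbb C^3$-valued (tangential) vector field. The real spherical harmonics $Y_{\ell,m}$ ($\ell\ge0$, $-\ell\le m\le\ell$) form an orthonormal basis of $L^2(\mathbb S^2;\mathbb C)$ with $-\Delta_{\mathbb S^2}Y_{\ell,m}=\lambda_\ell Y_{\ell,m}$, $\lambda_\ell=\ell(\ell+1)$. $H^1(\mathbb S^2;\mathbb C)=(I-\Delta_{\mathbb S^2})^{-1/2}L^2(\mathbb S^2;\mathbb C)$. On a complete filtered probability space $(\Omega,\mathcal F,(\mathcal F_t)_{t\ge0},\mathbb P)$, $u_0$ is $\mathcal F_0$-measurable (possibly random) and $L$ is a square-integrable $L^2(\mathbb S^2;\mathbb C)$-valued Lévy process with respect to $(\mathcal F_t)$ (adapted, $L(0)=0$, stochastically continuous, stationary increments, $L(t)-L(s)$ independent of $\mathcal F_s$ for $s\le t$), with $\mathbb E[L(t)]=0$ and self-adjoint positive semi-definite covariance operator $Q$: $\mathbb E[\langle L(t),f\rangle\overline{\langle L(t),g\rangle}]=t\langle Qg,f\rangle$. ''Trace class'' means $\operatorname{Tr}(Q)=\sum_{\ell,m}\langle QY_{\ell,m},Y_{\ell,m}\rangle<\infty$. Set $L_{\ell,m}=\langle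 L,Y_{\ell,m}\rangle$; for a complex random variable $\operatorname{Var}(Z)=\mathbb E[|Z-\mathbb E Z|^2]$. For an integer $\kappa>0$, $\mathcal P_\kappa$ is the orthogonal projection of $L^2(\mathbb S^2;\mathbb C)$ onto $H^\kappa=\operatorname{span}\{Y_{\ell,m}:0\le\ell\le\kappa,\,-\ell\le m\le\ell\}$, $\Delta^\kappa_{\mathbb S^2}$ is the restriction of $\Delta_{\mathbb S^2}$ to $H^\kappa$, and $Q^\kappa=\mathcal P_\kappa Q\mathcal P_\kappa$. $\nabla^\kappa_{\mathbb S^2}=\mathcal P_\kappa\nabla_{\mathbb S^2}$ (acting on $H^\kappa$), where on tangential vector fields $\mathcal P_\kappa$ truncates, at degree $\ell\le\kappa$, the expansion in the orthonormal vector spherical harmonics $\mathbf\Phi_{\ell,m}=\lambda_\ell^{-1/2}\nabla_{\mathbb S^2}Y_{\ell,m}$, $\mathbf\Psi_{\ell,m}=\lambda_\ell^{-1/2}\hat{\mathbf r}\times\nabla_{\mathbb S^2}Y_{\ell,m}$ ($\ell\ge1$, $\hat{\mathbf r}$ the outward unit normal). With $t_n=n\tau$ and $\Delta L_n^\kappa=\mathcal P_\kappa(L(t_{n+1})-L(t_n))$, the backward Euler--Maruyama scheme is $u_{n+1}^\kappa=(I+i\tau\Delta^\kappa_{\mathbb S^2})^{-1}(u_n^\kappa-i\Delta L_n^\kappa)$, $u_0^\kappa=\mathcal P_\kappa u_0$. The discrete mass and energy are $\mathcal M_n^\kappa=\|u_n^\kappa\|^2$ and $\mathcal E_n^\kappa=\|\nabla^\kappa_{\mathbb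 S^2}u_n^\kappa\|_{L^2(\mathbb S^2;\mathbb C^3)}^2$. In the limits, $\tau$ and $\kappa$ are fixed. *)

(* Defs.v *)
From HB Require Import structures.
From mathcomp Require Import all_boot all_order all_algebra.
From mathcomp Require Import all_classical all_reals all_analysis.
From mathcomp Require Import measurable_realfun.
From mathcomp Require Export complex.
Set Implicit Arguments.
Unset Strict Implicit.
Unset Printing Implicit Defensive.
Import Order.TTheory GRing.Theory Num.Theory.
Import numFieldNormedType.Exports.
Local Open Scope classical_set_scope.
Local Open Scope ring_scope.

Section sphere.
Variable R : realType.

Record sphere : Type :=
  Sphere { point_of :> 'rV[R]_3 ; _ : (\sum_i point_of 0 i ^+ 2) == 1 }.

HB.instance Definition _ := [isSub for point_of].
HB.instance Definition _ := [Choice of sphere by <:].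

(* [`|x|] on ['rV[R]_3] is the maximum norm in the library, hence this
   Euclidean norm. *)
Definition enorm (x : 'rV[R]_3) : R := Num.sqrt (\sum_i x 0 i ^+ 2).

Fact sph_proof (a : R * R) :
  (\sum_j (\row_(i < 3) [:: sin a.1 * cos a.2; sin a.1 * sin a.2; cos a.1]`_i)
    0 j ^+ 2) == 1.
Proof.
rewrite !big_ord_recl big_ord0 !mxE /= addr0 !exprMn addrA -mulrDr cos2Dsin2.
by rewrite mulr1 addrC cos2Dsin2.
Qed.

(* [sph (theta, phi)]: colatitude [theta], longitude [phi]. *)
Definition sph (a : R * R) : sphere := Sphere (sph_proof a).

HB.instance Definition _ := isPointed.Build sphere (sph (0, 0)).

Definition coords (p : sphere) : R * R * R :=
  (point_of p 0 0, point_of p 0 1, point_of p 0 2%:R).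

(* The sigma-algebra on the sphere is the trace of the Borel sets of R^3. *)
HB.instance Definition _ := Measurable.copy sphere
  (g_sigma_algebra_preimageType coords).

Lemma measurable_sph : measurable_fun [set: R * R] sph.
Proof.
move=> _ _ [B mB <-]; rewrite !setTI.
rewrite [X in measurable X](_ : _ = [set: R * R] `&` (coords \o sph) @^-1` B);
  last by rewrite setTI.
have m1 : measurable_fun [set: R * R] (@fst R R) by exact: measurable_fst.
have m2 : measurable_fun [set: R * R] (@snd R R) by exact: measurable_snd.
have ms : measurable_fun [set: R] (@sin R)
  by apply: continuous_measurable_fun; exact: continuous_sin.
have mc : measurable_fun [set: R] (@cos R)
  by apply: continuous_measurable_fun; exact: continuous_cos.
suff : measurable_fun [set: R * R] (coords \o sph) by apply.
rewrite (_ : coords \o sph = fun a =>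
  (sin a.1 * cos a.2, sin a.1 * sin a.2, cos a.1)); last first.
  by apply/funext => a; rewrite /coords /= !mxE.
apply: measurable_fun_pair; first apply: measurable_fun_pair.
- by apply: measurable_funM; exact: measurableT_comp.
- by apply: measurable_funM; exact: measurableT_comp.
- exact: measurableT_comp.
Qed.

Definition sph_domain : set (R * R) := `[0, pi]%classic `*` `[0, 2 * pi]%classic.

(* Surface measure: dS = sin theta dtheta dphi. *)
Definition surf (A : set sphere) : \bar R :=
  (\int[@lebesgue_measure R \x @lebesgue_measure R]_(a in
     sph_domain `&` sph @^-1` A) (sin a.1)%:E)%E.

Let surf0 : surf set0 = 0%E.
Proof. by rewrite /surf preimage_set0 setI0 integral_set0. Qed.

Let sin_domain_ge0 (a : R * R) : sph_domain a -> (0 <= (sin a.1)%:E)%E.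
Proof.
by move=> [/= a1 _]; rewrite lee_fin; apply: sin_ge0_pi; rewrite in_itv in a1.
Qed.

Let surf_ge0 A : (0 <= surf A)%E.
Proof. by apply: integral_ge0 => a [Da _]; exact: sin_domain_ge0. Qed.

Let surf_sigma_additive : semi_sigma_additive surf.
Proof.
move=> /= F mF tF mUF; rewrite /surf.
have mD : measurable sph_domain by apply: measurableX.
have mG k : measurable (sph_domain `&` sph @^-1` F k).
  by apply: measurableI => //; rewrite -[X in measurable X]setTI;
    exact: measurable_sph.
apply: cvg_toP.
  apply: ereal_nondecreasing_is_cvgn => m n mn.
  by apply: lee_sum_nneg_natr => // k _ _; exact: surf_ge0.
rewrite preimage_bigcup setI_bigcupr ge0_integral_bigcup//=.
- apply/measurable_funTS; apply/measurable_EFinP.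
  apply: measurableT_comp; last exact: measurable_fst.
  by apply: continuous_measurable_fun; exact: continuous_sin.
- by move=> a [k _ [Da _]]; exact: sin_domain_ge0.
- apply/trivIsetP => i j _ _ ij; rewrite setIACA -preimage_setI.
  by move/trivIsetP : tF => /(_ _ _ _ _ ij) ->//; rewrite preimage_set0 setI0.
Qed.

HB.instance Definition _ := isMeasure.Build _ _ _ surf
  surf0 surf_ge0 surf_sigma_additive.

End sphere.
Arguments surf {R}.

Local Open Scope complex_scope.

Section L2.
Variable R : realType.
Local Notation C := R[i].
Local Notation S2 := (sphere R).
Implicit Types (f g : S2 -> C) (V W : S2 -> 'rV[C]_3).

Definition sqmod (z : C) : R := complex.Re z ^+ 2 + complex.Im z ^+ 2.

Definition cintegral d (T : measurableType d)
    (mu : {measure set T -> \bar R}) (f : T -> C) : C :=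
  (\int[mu]_x complex.Re (f x)) +i* (\int[mu]_x complex.Im (f x)).

(* Elements of L^2(S^2; C) are represented by functions; two of them denote
   the same class when they agree [surf]-almost everywhere. *)
Definition L2 : set (S2 -> C) :=
  [set f | [/\ measurable_fun setT (fun p => complex.Re (f p)),
               measurable_fun setT (fun p => complex.Im (f p)) &
               (\int[surf]_p (sqmod (f p))%:E < +oo)%E]].

Definition inner f g : C := cintegral surf (fun p => f p * (g p)^*).

Definition L2norm f : R := Num.sqrt (\int[surf]_p sqmod (f p)).

Definition vinner V W : C :=
  cintegral surf (fun p => \sum_(j < 3) V p 0 j * (W p 0 j)^*).

Definition vL2norm V : R :=
  Num.sqrt (\int[surf]_p (\sum_(j < 3) sqmod (V p 0 j))).

Definition L2_open : set (set (S2 -> C)) :=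
  [set U | U `<=` L2 /\ forall f, U f -> exists2 e : R, 0 < e &
    forall g, L2 g -> L2norm (g - f) < e -> U g].

Definition L2_borel : set (set (S2 -> C)) := <<s L2, L2_open >>.

(* Partial derivative; [C] carries no normed [R]-module structure in the
   library. *)
Definition cpartial (F : 'rV[R]_3 -> C) (j : 'I_3) (x : 'rV[R]_3) : C :=
  ('D_(delta_mx 0 j) (fun y => complex.Re (F y)) x) +i*
  ('D_(delta_mx 0 j) (fun y => complex.Im (F y)) x).

Definition normalize (x : 'rV[R]_3) : S2 :=
  insubd (point : S2) ((enorm x)^-1 *: x).

Definition hom_ext f : 'rV[R]_3 -> C := f \o normalize.

(* The surface operators are the Euclidean ones applied to the extension
   which is constant along rays. *)
Definition sgrad f (p : S2) : 'rV[C]_3 :=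
  \row_(j < 3) cpartial (hom_ext f) j p.

Definition laplace_beltrami f (p : S2) : C :=
  \sum_(j < 3) cpartial (cpartial (hom_ext f) j) j p.

(* Indices are taken modulo 3. *)
Definition cross (a b : 'rV[C]_3) : 'rV[C]_3 :=
  \row_(j < 3) (a 0 (j + 1) * b 0 (j + 2%:R) - a 0 (j + 2%:R) * b 0 (j + 1)).

Definition normal (p : S2) : 'rV[C]_3 := \row_(j < 3) (point_of p 0 j)%:C.

Definition legendre (l : nat) : {poly R} :=
  (2 ^+ l * l`!%:R)^-1 *: (('X^2 - 1) ^+ l)^`(l).

Definition Ynorm (l m : nat) : R :=
  Num.sqrt ((if m == 0%N then 1 else 2) * (l.*2.+1)%:R / (4 * pi)
            * (l - m)`!%:R / (l + m)`!%:R).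

(* Since x + iy = sin theta e^{i phi} and z = cos theta, this is the usual
   Ynorm l |m| * P_l^{|m|}(cos theta) * cos(m phi) for m >= 0, and with
   sin(|m| phi) for m < 0, where
   P_l^m(cos theta) = (sin theta)^m P_l^(m)(cos theta): the power of
   sin theta comes from (x + iy)^|m|. *)
Definition Y (l : nat) (m : int) (p : S2) : C :=
  let xy : C := (point_of p 0 0) +i* (point_of p 0 1) in
  let z : R := point_of p 0 2%:R in
  (Ynorm l `|m|%N * ((legendre l)^`(`|m|%N)).[z] *
    (if 0 <= m then complex.Re (xy ^+ `|m|%N) else complex.Im (xy ^+ `|m|%N)))%:C.

Definition lambda (l : nat) : R := (l * l.+1)%:R.

(* Sum over -l <= m <= l. *)
Definition sum_order (A : nmodType) (l : nat) (a : int -> A) : A :=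
  \sum_(k < l.*2.+1) a (k%:Z - l%:Z).

(* H^1 = (I - Delta)^{-1/2} L^2. *)
Definition H1 : set (S2 -> C) :=
  [set f | L2 f /\ exists2 g, L2 g & forall (l : nat) (m : int),
    `|m| <= l%:Z ->
    inner f (Y l m) = ((Num.sqrt (1 + lambda l))^-1)%:C * inner g (Y l m)].

Definition PhiV (l : nat) (m : int) (p : S2) : 'rV[C]_3 :=
  ((Num.sqrt (lambda l))^-1)%:C *: sgrad (Y l m) p.

Definition PsiV (l : nat) (m : int) (p : S2) : 'rV[C]_3 :=
  ((Num.sqrt (lambda l))^-1)%:C *: cross (normal p) (sgrad (Y l m) p).

Section truncation.
Variable kappa : nat.

Definition Hk : set (S2 -> C) :=
  [set f | exists c : nat -> int -> C,
    f = \sum_(0 <= l < kappa.+1) sum_order l (fun m => c l m *: Y l m)].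

Definition projk f : S2 -> C :=
  \sum_(0 <= l < kappa.+1) sum_order l (fun m => inner f (Y l m) *: Y l m).

Definition vproj V : S2 -> 'rV[C]_3 :=
  \sum_(1 <= l < kappa.+1) sum_order l (fun m =>
    vinner V (PhiV l m) *: PhiV l m + vinner V (PsiV l m) *: PsiV l m).

Definition sgradk f : S2 -> 'rV[C]_3 := vproj (sgrad f).

(* (I + i tau Delta^kappa)^{-1}; the default value 0 of the partial inverse
   is irrelevant, the operator being a bijection of Hk. *)
Definition resolvent (tau : R) : (S2 -> C) -> (S2 -> C) :=
  'pinv_(fun=> 0) Hk (fun f => f + ((0 +i* 1) * tau%:C) *: laplace_beltrami f).

Definition truncate (Q : (S2 -> C) -> (S2 -> C)) : (S2 -> C) -> (S2 -> C) :=
  projk \o Q \o projk.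

(* Trace of an operator defined on Hk, as opposed to [trace] below. *)
Definition tracek (A : (S2 -> C) -> (S2 -> C)) : R :=
  \sum_(0 <= l < kappa.+1)
    sum_order l (fun m => complex.Re (inner (A (Y l m)) (Y l m))).

(* Backward Euler--Maruyama along one path [L] of the noise. *)
Fixpoint backward_EM (tau : R) (u0 : S2 -> C) (L : R -> S2 -> C) (n : nat)
    : S2 -> C :=
  if n is k.+1 then
    resolvent tau (backward_EM tau u0 L k
                   - (0 +i* 1) *: projk (L (k.+1%:R * tau) - L (k%:R * tau)))
  else projk u0.

End truncation.

Definition trace (A : (S2 -> C) -> (S2 -> C)) : \bar R :=
  (\sum_(0 <= l <oo)
     (sum_order l (fun m => complex.Re (inner (A (Y l m)) (Y l m))))%:E)%E.

Record covariance_operator (Q : (S2 -> C) -> (S2 -> C)) : Prop := {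
  cov_L2 : forall f, L2 f -> L2 (Q f);
  cov_linear : forall (a : C) f g, L2 f -> L2 g ->
    Q (a *: f + g) = a *: Q f + Q g %[ae surf];
  cov_bounded : exists M : R, forall f, L2 f -> L2norm (Q f) <= M * L2norm f;
  cov_selfadjoint : forall f g, L2 f -> L2 g -> inner (Q f) g = inner f (Q g);
  cov_ge0 : forall f, L2 f -> 0 <= inner (Q f) f }.

Section stochastic.
Variables (d : measure_display) (Omega : measurableType d).
Variable P : probability Omega R.

Record complete_filtration (F : R -> set (set Omega)) : Prop := {
  filt_sigma : forall t : R, 0 <= t -> sigma_algebra setT (F t);
  filt_sub : forall t : R, 0 <= t -> F t `<=` measurable;
  filt_mono : forall s t : R, 0 <= s -> s <= t -> F s `<=` F t;
  filt_complete : forall A, P.-negligible A -> F 0 A }.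

(* [X] is an L^2-valued random variable, measurable with respect to the
   sub-sigma-algebra [G]. *)
Definition L2_measurable (G : set (set Omega)) (X : Omega -> S2 -> C) : Prop :=
  (forall w, L2 (X w)) /\ forall B, L2_borel B -> G (X @^-1` B).

Definition cexpectation (Z : Omega -> C) : C := cintegral P Z.

Definition cvariance (Z : Omega -> C) : \bar R :=
  ('E_P[fun w => sqmod (Z w - cexpectation Z)%R])%E.

(* The expectation of an L^2-valued random variable is understood weakly;
   for square-integrable variables it is the Bochner integral. *)
Record Q_levy_process (F : R -> set (set Omega)) (Q : (S2 -> C) -> (S2 -> C))
    (L : R -> Omega -> S2 -> C) : Prop := {
  levy_adapted : forall t : R, 0 <= t -> L2_measurable (F t) (L t);
  levy_L0 : \forall w \ae P, L 0 w = 0 %[ae surf];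
  levy_sqint : forall t : R, 0 <= t -> ('E_P[fun w => (L2norm (L t w) ^+ 2)%R] < +oo)%E;
  levy_stoch_cont : forall t e : R, 0 <= t -> 0 < e ->
    (fun s : R => P [set w | e < L2norm (L s w - L t w)]) @
      within [set s : R | 0 <= s] (nbhs t) --> 0%E;
  levy_stationary : forall (s t h : R) B, 0 <= s -> 0 <= t -> 0 <= h ->
    L2_borel B ->
    P [set w | B (L (s + h) w - L s w)] = P [set w | B (L (t + h) w - L t w)];
  levy_indep : forall (s t : R) A B, 0 <= s -> s <= t -> F s A -> L2_borel B ->
    P (A `&` [set w | B (L t w - L s w)]) =
    (P A * P [set w | B (L t w - L s w)%R])%E;
  levy_mean0 : forall (t : R) g, 0 <= t -> L2 g ->
    cexpectation (fun w => inner (L t w) g) = 0;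
  levy_cov : forall (t : R) f g, 0 <= t -> L2 f -> L2 g ->
    cexpectation (fun w => inner (L t w) f * (inner (L t w) g)^*) =
    t%:C * inner (Q g) f }.

Definition mode (l : nat) (m : int) (L : R -> Omega -> S2 -> C) (t : R)
    (w : Omega) : C := inner (L t w) (Y l m).

Definition EM_solution (kappa : nat) (tau : R) (u0 : Omega -> S2 -> C)
    (L : R -> Omega -> S2 -> C) (n : nat) (w : Omega) : S2 -> C :=
  backward_EM kappa tau (u0 w) (fun t => L t w) n.

Definition mass (kappa : nat) (tau : R) (u0 : Omega -> S2 -> C)
    (L : R -> Omega -> S2 -> C) (n : nat) (w : Omega) : R :=
  L2norm (EM_solution kappa tau u0 L n w) ^+ 2.

Definition energy (kappa : nat) (tau : R) (u0 : Omega -> S2 -> C)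
    (L : R -> Omega -> S2 -> C) (n : nat) (w : Omega) : R :=
  vL2norm (sgradk kappa (EM_solution kappa tau u0 L n w)) ^+ 2.

End stochastic.
End L2.

Arguments mass {R d Omega}.
Arguments energy {R d Omega}.
Arguments mode {R d Omega}.

(* Main.v *)
From HB Require Import structures.
Require Import Defs.
From mathcomp Require Import all_boot all_order all_algebra.
From mathcomp Require Import all_classical all_reals all_analysis.
From mathcomp Require Import complex.
From mathcomp Require Import measurable_realfun zify ring lra.
Import Order.TTheory GRing.Theory Num.Theory.
Import numFieldNormedType.Exports.
Set Implicit Arguments.
Unset Strict Implicit.
Unset Printing Implicit Defensive.
Local Open Scope classical_set_scope.
Local Open Scope ring_scope.

(** The real spherical harmonics diagonalize the scheme.  They are
    orthonormal eigenfunctions of the Laplace--Beltrami operator, so on their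
    span the scheme decouples into one scalar recursion per mode [i = (l, m)],
    [z_(n+1) = (1 - i tau lambda)^-1 (z_n - i D_n)], where [lambda = l (l + 1)]
    and [D_n] is the [i]-th coefficient of the noise increment over
    [[t_n, t_(n+1)]] ([backward_EM_comb]).

    The increment [D_n] is centred, independent of the past and has second
    moment [tau q], where [q = <Q Y_i, Y_i>] ([incr_indep],
    [incr_second_moment]).  The cross terms in [E |z_n - i D_n|^2] therefore
    vanish, and [mom_n = E |z_n|^2] obeys
    [mom_(n+1) = (mom_n + tau q) / (1 + tau^2 lambda^2)] ([momentS]).
    - For [lambda = 0] the damping is absent and [mom_n = mom_0 + t_n q]: only
      the constant mode grows, linearly and exactly ([moment_zero]).
    - For [lambda >= 1] an induction gives [mom_n <= mom_0 + q / tau]: this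
      bound reproduces itself because [tau q <= (q / tau) (tau lambda)^2]
      ([moment_le]).

    By Parseval the mass is the sum of the [|z_n|^2] and the energy the sum of
    the [lambda |z_n|^2] ([comb_norm], [energy_comb]), while the traces are at
    least the sum of the [q] and equal to the sum of the [lambda q]
    ([trace_truncate_ge], [tracek_energy]).  Summing the modes gives both
    estimates; dividing by [t_n] leaves only the constant mode in the limit,
    with rate [q = v_(0,0)] for the mass and weight [lambda = 0] for the
    energy.

    The harmonics are given by explicit formulas, so their three properties
    have to be derived.
    - The eigenvalue equation ([laplace_solid], [surface_deriv_Y]) comes from
      differentiating the harmonic extended constantly along rays and using
      the differential equation of the Legendre polynomials, Euler's identity
      for [(x + i y)^m] and [|x| = 1].
    - Orthonormality ([yreal_orthonormal]) separates in spherical coordinates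
      into a trigonometric integral and an integral of polynomials in
      [z = cos theta].  The latter is treated through three properties of
      [p |-> \int_(-1)^1 p] only: it is additive, homogeneous, and sends [p']
      to [p(1) - p(-1)].
    - The energy needs the inner products of the gradients and of their
      rotations by the normal ([Rintegral_grad], [Rintegral_rotgrad]).  They
      too come from explicit separation, which avoids a divergence theorem on
      the sphere.

    On the probabilistic side, the law of the noise is given on the Borel sets
    of L^2.  Bessel's inequality makes a Fourier coefficient continuous, hence
    Borel ([L2_borel_fmode]), and this brings the filtration and the
    independence of the increments down to real random variables. *)

(** * Associated Legendre polynomials *)

Section legendre.
Variable R : realType.
Implicit Types (l m k : nat) (p q : {poly R}).

Let deriv_natr (n : nat) : (n%:R : {poly R})^`() = 0.
Proof. by rewrite -polyC_natr derivC. Qed.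

Let deriv_Xsq1 : ('X^2 - 1 : {poly R})^`() = 2%:R * 'X.
Proof. by rewrite derivB derivXn -polyC1 derivC subr0 expr1 mulr_natl. Qed.

(** With [u = (X^2 - 1)^l], differentiate [(X^2 - 1) u' = 2 l X u] exactly
    [k + 1] times. *)
Lemma legendre_recurrence l k :
  ('X^2 - 1) * (('X^2 - 1) ^+ l)^`(k.+2) =
  2%:R * (l%:R - k%:R - 1) * 'X * (('X^2 - 1) ^+ l)^`(k.+1)
  + k.+1%:R * (2%:R * l%:R - k%:R) * (('X^2 - 1) ^+ l)^`(k) :> {poly R}.
Proof.
elim: k => [|k IH].
  have E1 : ('X^2 - 1 : {poly R}) * (('X^2 - 1) ^+ l)^`() =
      2%:R * l%:R * 'X * ('X^2 - 1) ^+ l.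
    case: l => [|l]; first by rewrite expr0 -polyC1 derivC; ring.
    by rewrite deriv_exp deriv_Xsq1 /= [_ ^+ l.+1]exprS -[X in _ * X = _]mulr_natl; ring.
  have := congr1 deriv E1.
  rewrite !derivM deriv_Xsq1 !deriv_natr derivX !derivSn !derivn0 => E2.
  by apply: (addrI (2%:R * 'X * (('X^2 - 1) ^+ l)^`())); rewrite E2; ring.
have := congr1 deriv IH.
have deriv1 : (1 : {poly R})^`() = 0 by rewrite -polyC1 derivC.
rewrite !(deriv_Xsq1, deriv_natr, deriv1, derivX, derivM, derivD, derivN).
rewrite -!derivnS => E2.
apply: (addrI (2%:R * 'X * (('X^2 - 1) ^+ l)^`(k.+2))); rewrite E2.
by rewrite -(natr1 k.+1) -(natr1 k); ring.
Qed.

Let derivn_derivn p l k : p^`(l)^`(k) = p^`(l + k).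
Proof. by rewrite /derivn -iterD addnC. Qed.

(** The associated Legendre function without its factor
    [(1 - z^2)^(m / 2)], which the harmonics carry in [(x + i y)^m]. *)
Definition assoc l m : {poly R} := (legendre R l)^`(m).
Local Notation W := (1 - 'X^2 : {poly R}).

Lemma assocS l m : assoc l m.+1 = (assoc l m)^`().
Proof. by rewrite /assoc derivnS. Qed.

(** The recurrence above at order [l + m]. *)
Lemma assoc_ode l m :
  W * (assoc l m)^`()^`() = 2%:R * m.+1%:R * 'X * (assoc l m)^`()
    - ((l%:R - m%:R) * (l%:R + m%:R + 1))%:P * assoc l m.
Proof.
have E := legendre_recurrence l (l + m).
have D k : (assoc l k) = (2 ^+ l * l`!%:R)^-1%:P * (('X^2 - 1) ^+ l)^`(l + k).
  by rewrite /assoc /legendre derivnZ -mul_polyC derivn_derivn.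
rewrite -!assocS !D !addnS -(opprB ('X^2)) mulNr mulrCA E.
rewrite polyCM !polyCD polyCN !polyC_natr polyC1.
by rewrite -(natr1 (l + m)) -(natr1 m) natrD; ring.
Qed.

(** [(X^2 - 1)^l] is monic of degree [2 l], which is also the number of times it
    has been differentiated. *)
Lemma assoc_top l : assoc l l = ((2 * l)`!%:R / (2 ^+ l * l`!%:R))%:P.
Proof.
rewrite /assoc /legendre derivnZ derivn_derivn addnn -mul2n -mul_polyC.
rewrite mulrC polyCM; congr (_ * _); apply/polyP => i.
have mon : ('X^2 - 1 : {poly R}) \is monic.
  exact: (monicXnsubC (1 : R)).
have sz : size (('X^2 - 1 : {poly R}) ^+ l) = (2 * l).+1.
  rewrite -[LHS]prednK; first by rewrite size_exp (size_XnsubC (1 : R) (isT : (0 < 2)%N)).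
  by rewrite lt0n size_poly_eq0 monic_neq0 ?monic_exp.
rewrite coef_derivn coefC; case: i => [|i] /=.
  rewrite addn0 ffactnn; have /monicP := monic_exp l mon.
  by rewrite lead_coefE sz /= => ->.
by rewrite nth_default ?mul0rn// sz addnS ltnS leq_addr.
Qed.

(** [I] stands for [p |-> \int_(-1)^1 p]; the three hypotheses are all that
    the computation of norms and inner products uses. *)
Section functional.
Variable I : {poly R} -> R.
Hypothesis ID : forall p q, I (p + q) = I p + I q.
Hypothesis IZ : forall c p, I (c%:P * p) = c * I p.
Hypothesis Ideriv : forall p, I p^`() = p.[1] - p.[-1].

Let W1 : W.[1] = 0. Proof. by rewrite !hornerE expr1n subrr. Qed.
Let WN1 : W.[-1] = 0. Proof. by rewrite !hornerE sqrrN expr1n subrr. Qed.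
Let derivW : W^`() = - (2%:R * 'X).
Proof. by rewrite -opprB derivN deriv_Xsq1. Qed.
Let derivWX m : (W ^+ m.+1)^`() = - (2%:R * m.+1%:R * 'X * W ^+ m) :> {poly R}.
Proof. by rewrite deriv_exp derivW /= -[LHS]mulr_natl; ring. Qed.

Let Ideriv0 p : I (W * p)^`() = 0.
Proof. by rewrite Ideriv !hornerM W1 WN1 !mul0r subrr. Qed.

Definition wnorm l m := I (W ^+ m * assoc l m ^+ 2).

(** Integrate the derivative of [W^(m + 1) G G'], with [G = assoc l m], and
    substitute the differential equation. *)
Lemma wnormS l m : wnorm l m.+1 = (l%:R - m%:R) * (l%:R + m%:R + 1) * wnorm l m.
Proof.
pose G := assoc l m.
have : I (W ^+ m.+1 * (G * G^`()))^`() = 0.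
  by rewrite exprS -mulrA Ideriv0.
have -> : (W ^+ m.+1 * (G * G^`()))^`() = W ^+ m.+1 * assoc l m.+1 ^+ 2 +
    (- ((l%:R - m%:R) * (l%:R + m%:R + 1)))%:P * (W ^+ m * G ^+ 2).
  rewrite !derivM derivWX assocS -/G ![_ ^+ m.+1]exprS.
  have E := assoc_ode l m; rewrite -/G in E.
  transitivity (W ^+ m * G^`() ^+ 2 * W + W ^+ m * G *
      (W * G^`()^`() - 2%:R * m.+1%:R * 'X * G^`())); first by ring.
  by rewrite E polyCN; ring.
rewrite ID IZ => /eqP; rewrite mulNr subr_eq0 => /eqP.
by [].
Qed.

(** Wallis' integral: integrating the derivative of [X W^(l + 1)] gives the
    recursion in [l]. *)
Lemma weight_int l : I (W ^+ l) * (2 * l).+1`!%:R = 2 * 4 ^+ l * l`!%:R ^+ 2.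
Proof.
elim: l => [|l IH].
  rewrite !expr0 muln0 !fact0 factS fact0.
  rewrite -derivX Ideriv !hornerE opprK.
  exact: (esym (etrans (mulr1 _) (mulr1 _))).
have : I ('X * W ^+ l.+1)^`() = 0.
  by rewrite exprS mulrCA Ideriv0.
have -> : ('X * W ^+ l.+1)^`() =
    (2 * l.+1%:R + 1)%:P * W ^+ l.+1 + (- (2 * l.+1%:R))%:P * W ^+ l :> {poly R}.
  rewrite derivM derivX derivWX polyCD polyCN !polyCM !polyC_natr polyC1 exprS.
  by ring.
rewrite ID !IZ => /eqP; rewrite mulNr subr_eq0 => /eqP E.
rewrite mulnS 2!addSn add0n [_.+3`!]factS natrM mulrA.
have -> : (2 * l).+3%:R = 2 * l.+1%:R + 1 :> R.
  by rewrite -natrM natr1 mulnS.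
rewrite [_ * I _]mulrC in E; rewrite E [_.+2`!]factS natrM mulrACA IH factS natrM.
by rewrite -(natr1 (2 * l).+1) -(natr1 (2 * l)) natrM [4 ^+ l.+1]exprS -(natr1 l); ring.
Qed.

(** Descending induction on [m], started at [m = l] where [assoc l l] is
    constant; this replaces the usual repeated integration by parts in
    Rodrigues' formula. *)
Lemma wnormE l m : (m <= l)%N ->
  wnorm l m = 2 / (2 * l%:R + 1) * (l + m)`!%:R / (l - m)`!%:R.
Proof.
have f0 n : (n`!%:R : R) != 0 by rewrite pnatr_eq0 -lt0n fact_gt0.
have p0 : (2 ^+ l : R) != 0 by rewrite expf_neq0// pnatr_eq0.
have l0 : 2 * l%:R + 1 != 0 :> R by rewrite -natrM natr1 pnatr_eq0.
have top : wnorm l l = 2 / (2 * l%:R + 1) * (2 * l)`!%:R.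
  rewrite /wnorm assoc_top -polyC_exp mulrC IZ.
  have -> : I (W ^+ l) = 2 * 4 ^+ l * l`!%:R ^+ 2 / ((2 * l%:R + 1) * (2 * l)`!%:R).
    by rewrite -weight_int factS natrM -(natr1 (2 * l)) natrM; field; rewrite l0 f0.
  have -> : (4 ^+ l : R) = 2 ^+ l * 2 ^+ l by rewrite -exprMn -natrM.
  by field; rewrite l0 !f0 p0.
(* Counting down from the top: [j = l - m]. *)
have H j : (j <= l)%N ->
    wnorm l (l - j) = 2 / (2 * l%:R + 1) * (2 * l - j)`!%:R / j`!%:R.
  elim: j => [|j IH] jl; first by rewrite !subn0 top fact0 divr1.
  have := wnormS l (l - j.+1); rewrite subnSK// IH 1?ltnW// natrB//.
  have -> : (2 * l - j = (2 * l - j.+1).+1)%N by lia.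
  rewrite !factS !natrM -(natr1 (2 * l - _)) natrB ?natrM; last by lia.
  have a0 : (j.+1%:R : R) != 0 by rewrite pnatr_eq0.
  have b0 : 2 * l%:R - j.+1%:R + 1 != 0 :> R.
    by rewrite -natrM -natrB ?natr1 ?pnatr_eq0//; lia.
  set x := wnorm _ _ => E.
  have {E} : j.+1%:R * (2 * l%:R - j.+1%:R + 1) * x =
      2 / (2 * l%:R + 1) * ((2 * l%:R - j.+1%:R + 1) * (2 * l - j.+1)`!%:R)
      / j`!%:R by rewrite E; ring.
  move=> /(canRL (mulKf (mulf_neq0 a0 b0))) ->.
  by move: (j.+1%:R : R) a0 b0 => u a0 b0; field; rewrite l0 a0 b0 !f0.
move=> ml; have := H _ (leq_subr m l); rewrite subKn// => ->.
by congr (_ * _`!%:R / _); lia.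
Qed.

(** The scalar product of the gradients of two harmonics of order [m], written
    in [z = cos theta] once the longitude has been integrated out.  The last
    term contains the longitudinal part [m^2 / sin^2]; at
    [m = 0] the truncated exponent [m.-1] is harmless because of the factor
    [m^2]. *)
Definition grad_poly l l' m : {poly R} :=
  let G := assoc l m in let K := assoc l' m in
  W ^+ m.+1 * G^`() * K^`() - m%:R * 'X * W ^+ m * (G * K^`() + G^`() * K)
  + m%:R ^+ 2 * (1 + 'X^2) * W ^+ m.-1 * G * K.

(** Green's identity: by the differential equation the two integrands differ by
    the derivative of a polynomial that vanishes at [1] and [-1]. *)
Lemma int_grad_poly l l' m : I (grad_poly l l' m) =
  lambda R l * I (W ^+ m * assoc l m * assoc l' m).
Proof.
pose G := assoc l m; pose K := assoc l' m.
(* [H = W u' v] with [u = W^(m / 2) G] and [v = W^(m / 2) K], the boundary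
   term of the equation in Sturm--Liouville form. *)
pose H := W ^+ m.+1 * G^`() * K - m%:R * 'X * W ^+ m * (G * K).
have H0 : I H^`() = 0.
  rewrite /H; case: (m) => [|m']; last first.
    rewrite [X in I X^`()](_ : _ = W * (W ^+ m'.+1 * G^`() * K
      - m'.+1%:R * 'X * W ^+ m' * (G * K))) ?Ideriv0//.
    by rewrite [_ ^+ m'.+2]exprS [in X in _ - X]exprS; ring.
  rewrite [X in I X^`()](_ : _ = W * (G^`() * K)) ?Ideriv0//; ring.
rewrite (_ : grad_poly _ _ _ = H^`() + (lambda R l)%:P * (W ^+ m * G * K)).
  by rewrite ID H0 add0r IZ.
have E := assoc_ode l m; rewrite -/G in E.
have {}E : W * G^`()^`() = 2%:R * m.+1%:R * 'X * G^`() + (m * m.+1)%:R * G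
    - (l * l.+1)%:R * G.
  rewrite E -[RHS]addrA -mulrBl -mulNr -!polyC_natr -polyCN -polyCB.
  congr (_ + _%:P * _).
  by rewrite !natrM -(natr1 m) -(natr1 l); ring.
rewrite /grad_poly -/G -/K /H /lambda polyC_natr.
have dX2 : (1 : {poly R})^`() = 0 by rewrite -polyC1 derivC.
rewrite !(deriv_natr, derivX, derivM, derivD, derivN) derivWX.
case: m G @K @H H0 E => [|m] G K H _ E.
  rewrite expr1 !expr0; have dG := derivW.
  transitivity (W * G^`() * K^`() + (W * G^`()^`() - 2%:R * 'X * G^`()) * K
    + (l * l.+1)%:R * G * K); first by rewrite E; ring.
  by rewrite ?derivE; ring.
rewrite derivWX.
transitivity (W ^+ m.+2 * G^`() * K^`() - m.+1%:R * 'X * W ^+ m.+1 * (G * K^`() + G^`() * K)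
   + m.+1%:R * (2%:R * m.+1%:R * 'X^2 * W ^+ m - W ^+ m.+1) * (G * K)
   + W ^+ m.+1 * (W * G^`()^`() - 2%:R * m.+2%:R * 'X * G^`()) * K
   + (l * l.+1)%:R * (W ^+ m.+1 * G * K)).
  rewrite E /= ![_ ^+ m.+2]exprS ![_ ^+ m.+1]exprS natrM -(natr1 m.+1) -(natr1 m).
  by ring.
by rewrite ![_ ^+ m.+2]exprS ![_ ^+ m.+1]exprS; ring.
Qed.

(** The gradient product is symmetric in [l] and [l'], so Green's identity read
    both ways gives [lambda_l = lambda_l'] unless the integral vanishes. *)
Lemma assoc_orth l l' m : l != l' -> I (W ^+ m * assoc l m * assoc l' m) = 0.
Proof.
move=> ll'.
have /eqP := int_grad_poly l l' m.
have -> : grad_poly l l' m = grad_poly l' l m.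
  by rewrite /grad_poly; ring.
rewrite int_grad_poly -mulrA [_ * assoc l _]mulrC mulrA -subr_eq0 -mulrBl.
rewrite mulf_eq0 => /orP[|/eqP //].
rewrite /lambda subr_eq0 eqr_nat => /eqP.
by case: (ltngtP l l') ll' => // h _ E; exfalso; nia.
Qed.
End functional.
End legendre.

(** * The trigonometric system *)

Section interval_integral.
Variable R : realType.
Implicit Types (a b : R) (f g F : R -> R).

Definition itg a b f : R := \int[@lebesgue_measure R]_(x in `[a, b]) f x.

Lemma is_derive_continuous F f :
  (forall x : R, is_derive x 1 F (f x)) -> continuous F.
Proof.
move=> dF x; apply/differentiable_continuous/derivable1_diffP.
exact: (@ex_derive _ _ _ _ _ _ _ (dF x)).
Qed.

Lemma integrable_itg a b f : continuous f ->
  (@lebesgue_measure R).-integrable `[a, b] (EFin \o f).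
Proof.
move=> cf; apply: continuous_compact_integrable; first exact: segment_compact.
exact: continuous_subspaceT.
Qed.

Lemma itgD a b f g : continuous f -> continuous g ->
  itg a b (fun x => f x + g x) = itg a b f + itg a b g.
Proof.
by move=> cf cg; apply: RintegralD => //; exact: integrable_itg.
Qed.

Lemma itgZ a b c f : continuous f -> itg a b (fun x => c * f x) = c * itg a b f.
Proof. by move=> cf; apply: RintegralZl => //; exact: integrable_itg. Qed.

Lemma eq_itg a b f g : f =1 g -> itg a b f = itg a b g.
Proof. by move=> /funext ->. Qed.

Lemma itg_FTC a b f F : a < b -> continuous f ->
  (forall x : R, is_derive x 1 F (f x)) -> itg a b f = F b - F a.
Proof.
move=> ab cf dF; rewrite /itg /Rintegral.
have cF := is_derive_continuous dF.
rewrite (@continuous_FTC2 _ f F a b ab)//.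
- exact: continuous_subspaceT.
- split.
  + by move=> x _; exact: (@ex_derive _ _ _ _ _ _ _ (dF x)).
  + by apply: cvg_at_right_filter; exact: cF.
  + by apply: cvg_at_left_filter; exact: cF.
- by move=> x _; rewrite derive1E; exact: (@derive_val _ _ _ _ _ _ _ (dF x)).
Qed.

End interval_integral.

Section trigonometric_system.
Variable R : realType.
Implicit Types (m n : int) (x : R).

(** Negative indices are the sines, so that [trig_m' = - m trig_(- m)] holds for
    every integer [m] and the two families need no separate treatment. *)
Definition trig m x : R :=
  if 0 <= m then cos (`|m|%N%:R * x) else sin (`|m|%N%:R * x).

Lemma is_derive_trig m x : is_derive x 1 (trig m) (- m%:~R * trig (- m) x).
Proof.
have dl : is_derive x (1 : R) (fun y => `|m|%N%:R * y) (`|m|%N%:R : R).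
  by apply: is_derive_eq; rewrite scaler1.
rewrite /trig abszN; case: ltrgt0P => m0.
- have -> : (0 <= - m) = false by lia.
  have -> : m%:~R = `|m|%N%:R :> R by rewrite -[in LHS](gtz0_abs m0).
  by apply: is_derive_eq; rewrite /GRing.scale /=; ring.
- have -> : (0 <= - m) = true by lia.
  have -> : m%:~R = - `|m|%N%:R :> R.
    by rewrite -[in LHS](opprK m) -(ltz0_abs m0) mulrNz.
  by apply: is_derive_eq; rewrite /GRing.scale /=; ring.
- rewrite m0 oppr0 lexx absz0.
  rewrite (_ : (fun y => cos _) = cst (1 : R)); last first.
    by apply/funext => y; rewrite mul0r cos0.
  by rewrite mul0r; exact: is_derive_cst.
Qed.

Lemma continuous_trig m : continuous (trig m).
Proof. exact: is_derive_continuous (is_derive_trig m). Qed.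

Lemma trig_sqr m x : m != 0 -> trig m x ^+ 2 + trig (- m) x ^+ 2 = 1.
Proof.
move=> m0; rewrite /trig abszN; case: (ltrgt0P m) m0 => [m0|m0|->]// _.
- have -> : (0 <= - m) = false by lia.
  by rewrite cos2Dsin2.
- have -> : (0 <= - m) = true by lia.
  by rewrite addrC cos2Dsin2.
Qed.

Lemma trig0 x : trig 0 x = 1.
Proof. by rewrite /trig lexx mul0r cos0. Qed.

Lemma trig_2pi m : trig m (2 * pi) = trig m 0.
Proof.
have P k : cos (k%:R * (2 * pi) : R) = 1 /\ sin (k%:R * (2 * pi) : R) = 0.
  elim: k => [|k [IH1 IH2]]; first by rewrite mul0r cos0 sin0.
  rewrite -natr1 mulrDl mul1r {2 4}[2 * pi]mulr_natl.
  by rewrite cosD2pi sinD2pi.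
rewrite /trig; have [-> ->] := P `|m|%N; by rewrite mulr0 cos0 sin0.
Qed.

Definition trig_inner m n : R := itg 0 (2 * pi) (fun x => trig m x * trig n x).

Lemma trig_innerC m n : trig_inner m n = trig_inner n m.
Proof. by apply: eq_itg => x; rewrite mulrC. Qed.

(** The left-hand side is, up to sign, the integral over a period of the
    derivative of [trig_m trig_n]. *)
Lemma trig_inner_parts m n :
  m%:~R * trig_inner (- m) n + n%:~R * trig_inner m (- n) = 0.
Proof.
have c k l : continuous (fun x => trig k x * trig l x).
  by move=> x; apply: cvgM; exact: continuous_trig.
have cZ (r : R) k l : continuous (fun x => r * (trig k x * trig l x)).
  by move=> x; apply: cvgMr; exact: c.
have pi0 : (0 : R) < 2 * pi by rewrite mulr_gt0// pi_gt0.
rewrite /trig_inner -!itgZ// -itgD//; set f := fun x => _.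
have cf : continuous f by move=> x; apply: cvgD; exact: cZ.
have df (x : R) : is_derive x 1 (fun x => - (trig m x * trig n x)) (f x).
  have dm := is_derive_trig m x; have dn := is_derive_trig n x.
  by apply: is_derive_eq; rewrite /f /GRing.scale /=; ring.
by rewrite (itg_FTC pi0 cf df) !trig_2pi subrr.
Qed.

Lemma trig_inner_opp m n :
  m%:~R * trig_inner m n = n%:~R * trig_inner (- m) (- n).
Proof.
have /eqP := trig_inner_parts (- m) n.
by rewrite opprK mulrNz mulNr addrC subr_eq0 => /eqP.
Qed.

(** Integrating by parts twice gives [(m^2 - n^2) <m, n> = 0], which leaves
    [n = - m]; then one integration by parts makes [m <m, - m>] its own
    opposite. *)
Lemma trig_inner_orth m n : m != n -> trig_inner m n = 0.
Proof.
move=> mn; have E1 := trig_inner_opp m n.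
have := trig_inner_opp (- m) (- n); rewrite !opprK !mulrNz !mulNr => /oppr_inj E2.
have : (m%:~R ^+ 2 - n%:~R ^+ 2) * trig_inner m n = 0.
  rewrite mulrBl !expr2 -!mulrA E1 -E2; ring.
move/eqP; rewrite mulf_eq0 => /orP[|/eqP//].
(* The remaining case is [n = - m] with [m] nonzero. *)
rewrite subr_sqr mulf_eq0 subr_eq0 (inj_eq intr_inj) (negbTE mn) /=.
rewrite -rmorphD intr_eq0 addrC addr_eq0 => /eqP nm; rewrite nm in mn *.
have m0 : m%:~R != 0 :> R by rewrite intr_eq0; lia.
have := trig_inner_opp m (- m).
rewrite opprK mulrNz mulNr => /eqP.
rewrite [trig_inner (- m) _]trig_innerC -addr_eq0 -mulr2n mulrn_eq0 /=.
by rewrite mulf_eq0 (negbTE m0) => /eqP.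
Qed.

(** The squares of [trig_m] and [trig_(- m)] have the same integral and add up
    to [1]. *)
Lemma trig_inner_diag m : trig_inner m m = if m == 0 then 2 * pi else pi.
Proof.
have pi0 : (0 : R) < 2 * pi by rewrite mulr_gt0// pi_gt0.
have I1 : itg 0 (2 * pi) (fun=> 1) = 2 * pi :> R.
  have cf : continuous (fun _ : R => 1 : R) by move=> x; exact: cvg_cst.
  by rewrite (itg_FTC pi0 cf (fun x => is_derive_id x 1)) subr0.
case: eqVneq => [->|m0].
  by rewrite /trig_inner (@eq_itg _ _ _ _ (fun=> 1))// => x; rewrite trig0 mulr1.
have c k : continuous (fun x => trig k x * trig k x).
  by move=> x; apply: cvgM; exact: continuous_trig.
have m0' : m%:~R != 0 :> R by rewrite intr_eq0.
have E := mulfI m0' (trig_inner_opp m m).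
have : trig_inner m m + trig_inner (- m) (- m) = 2 * pi.
  rewrite /trig_inner -itgD// -[RHS]I1; apply: eq_itg => x.
  by rewrite -!expr2 trig_sqr.
by rewrite -E => ?; lra.
Qed.
End trigonometric_system.

(** * Surface integrals in spherical coordinates *)

Section surface_integral.
Variable R : realType.
Local Notation S2 := (sphere R).
Local Notation mu2 := (@lebesgue_measure R \x @lebesgue_measure R)%E.
Local Notation D := (@sph_domain R).

Let mD : measurable D. Proof. by apply: measurableX; exact: measurable_itv. Qed.

Let sin_ge0 a : D a -> 0 <= sin a.1.
Proof. by move=> [/= + _]; rewrite in_itv; exact: sin_ge0_pi. Qed.

Let measurable_sin1 : measurable_fun setT (fun a : R * R => sin a.1).
Proof.
apply: measurableT_comp; last exact: measurable_fst.
by apply: continuous_measurable_fun; exact: continuous_sin.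
Qed.

Let integral_surf_indic (E : set S2) : measurable E ->
  (\int[surf]_p (\1_E p)%:E =
   \int[mu2]_(a in D) ((\1_E (sph a))%:E * (sin a.1)%:E))%E.
Proof.
move=> mE; rewrite integral_indic//= setIT /surf integral_mkcondr.
apply: eq_integral => a aD; rewrite patchE /indic.
have -> : (sph a \in E) = (a \in @sph R @^-1` E).
  by apply/idP/idP; rewrite !inE.
by case: ifPn => _; rewrite ?mul1e ?mul0e.
Qed.

Import HBNNSimple.

Let integral_surf_nnsfun (f : {nnsfun S2 >-> R}) :
  (\int[surf]_p (f p)%:E =
   \int[mu2]_(a in D) ((f (sph a))%:E * (sin a.1)%:E))%E.
Proof.
under [LHS]eq_integral do rewrite fimfunE -fsumEFin//.
rewrite [LHS]ge0_integral_fsum//; last 2 first.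
  - by move=> r; exact/measurable_EFinP/measurableT_comp.
  - by move=> n x _; rewrite EFinM nnfun_muleindic_ge0.
under [RHS]eq_integral.
  move=> a /[!inE] aD; rewrite fimfunE -fsumEFin// ge0_mule_fsuml; last first.
    by move=> r; rewrite EFinM nnfun_muleindic_ge0.
  over.
have mi r : measurable_fun setT (fun a => (\1_(f @^-1` [set r]) (@sph R a) : R)).
  by apply: measurableT_comp => //; exact: measurable_sph.
rewrite [RHS]ge0_integral_fsum//; last 2 first.
  - move=> r; apply/measurable_EFinP/measurable_funTS.
    apply: measurable_funM; last exact: measurable_sin1.
    by apply: measurable_funM; [exact: measurable_cst|exact: mi].
  - move=> n a Da; rewrite EFinM mule_ge0//; first exact: nnfun_muleindic_ge0.
    by rewrite lee_fin sin_ge0.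
apply: eq_fsbigr => r; rewrite inE => -[p _ fpr].
have r0 : 0 <= r by rewrite -fpr.
rewrite integralZl_indic_nnsfun//= integral_surf_indic//.
rewrite -ge0_integralZl//=.
- by apply: eq_integral => a _; rewrite EFinM muleA.
- apply/measurable_EFinP/measurable_funTS.
  by apply: measurable_funM; [exact: mi|exact: measurable_sin1].
- move=> a Da; rewrite mule_ge0// lee_fin//; exact: sin_ge0.
Qed.

(** The surface measure is the image of the density [sin theta] under spherical
    coordinates; the formula passes from indicators to simple functions and
    then to monotone limits. *)
Lemma ge0_integral_surf (f : S2 -> \bar R) :
  measurable_fun setT f -> (forall p, 0 <= f p)%E ->
  (\int[surf]_p f p = \int[mu2]_(a in D) (f (sph a) * (sin a.1)%:E))%E.
Proof.
move=> mf f0; pose f_ := nnsfun_approx measurableT mf.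
have mfs n : measurable_fun setT (fun a => f_ n (@sph R a)).
  by apply: measurableT_comp => //; exact: measurable_sph.
transitivity (lim (\int[surf]_p (f_ n p)%:E @[n --> \oo])%E).
  rewrite -monotone_convergence//=.
  - apply: eq_integral => p _; apply/esym/cvg_lim => //=.
    exact: cvg_nnsfun_approx.
  - by move=> n; exact/measurable_EFinP/measurable_funTS.
  - by move=> n p _; rewrite lee_fin.
  - by move=> p _ m n mn; rewrite lee_fin; exact/lefP/nd_nnsfun_approx.
rewrite [RHS](_ : _ = lim
    (\int[mu2]_(a in D) ((f_ n (sph a))%:E * (sin a.1)%:E) @[n --> \oo])%E).
  by apply: congr_lim; apply/funext => n /=; exact: integral_surf_nnsfun.
rewrite -monotone_convergence//=.
- apply: eq_integral => a /[!inE] Da; apply/esym/cvg_lim => //.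
  apply: cvgeZr => //; exact: cvg_nnsfun_approx.
- move=> n; apply/measurable_EFinP/measurable_funTS.
  by apply: measurable_funM; [exact: mfs|exact: measurable_sin1].
- by move=> n a Da; rewrite mule_ge0// lee_fin// sin_ge0.
- move=> a Da m n mn; rewrite lee_wpmul2r// ?lee_fin ?sin_ge0//.
  exact/lefP/nd_nnsfun_approx.
Qed.

Let mu2D : (mu2 D < +oo)%E.
Proof.
have fin (b : R) : (@lebesgue_measure R `[0%R, b]%classic < +oo)%E.
  by apply: compact_finite_measure; exact: segment_compact.
rewrite /sph_domain product_measure1E//.
apply: lte_mul_pinfty => //; last exact: fin.
by rewrite ge0_fin_numE//; exact: fin.
Qed.

Lemma surf_fin : (surf [set: S2] < +oo)%E.
Proof.
rewrite /surf preimage_setT setIT.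
apply: (@le_lt_trans _ _ (\int[mu2]_(a in D) (cst 1%E a))%E).
  apply: ge0_le_integral => //.
  - exact/measurable_EFinP/measurable_funTS.
  - by move=> a Da /=; rewrite lee_fin sin_le1.
by rewrite integral_cst// mul1e.
Qed.

Lemma bounded_integrable_surf (f : S2 -> R) (M : R) :
  measurable_fun setT f -> (forall p, `|f p| <= M) ->
  surf.-integrable setT (EFin \o f).
Proof.
move=> mf bf; apply: measurable_bounded_integrable => //; first exact: surf_fin.
exists M; split; first exact: num_real.
by move=> x Mx p _; exact: (le_trans (bf p) (ltW Mx)).
Qed.

Let sep (a c : R -> R) (z : R * R) : R :=
  (a \_ `[0, pi]) z.1 * (c \_ `[0, (2 * pi)]) z.2.

Let integrable_patch (b : R) (a : R -> R) : continuous a ->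
  (@lebesgue_measure R).-integrable setT (EFin \o (a \_ `[0, b])).
Proof.
move=> ca; rewrite -restrict_EFin; apply/(integrable_mkcond _ _).1 => //.
exact: integrable_itg.
Qed.

Let integrable_sep (a c : R -> R) : continuous a -> continuous c ->
  mu2.-integrable setT (EFin \o sep a c).
Proof.
move=> ca cc.
have /integrableP[ma ia] := integrable_patch pi ca.
have /integrableP[mc ic] := integrable_patch (2 * pi) cc.
have ms : measurable_fun setT (sep a c).
  apply: measurable_funM; (apply: measurableT_comp; last by []).
    exact/measurable_EFinP.
  exact/measurable_EFinP.
apply/integrable12ltyP; first exact/measurable_EFinP.
under eq_integral => x _.
  under eq_integral => y _ do rewrite /sep /= normrM EFinM.
  rewrite ge0_integralZl//; last first.
    by apply/measurable_EFinP; apply: measurableT_comp => //; exact/measurable_EFinP.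
  over.
rewrite /= ge0_integralZr//; last 2 first.
- by apply/measurable_EFinP; apply: measurableT_comp => //; exact/measurable_EFinP.
- exact: integral_ge0.
rewrite lte_mul_pinfty//; first exact: integral_ge0.
by rewrite ge0_fin_numE//; exact: integral_ge0.
Qed.

Let itg_sep (a c : R -> R) : continuous a -> continuous c ->
  \int[mu2]_z sep a c z = itg 0 pi a * itg 0 (2 * pi) c.
Proof.
move=> ca cc; have ia := integrable_patch pi ca.
have ic := integrable_patch (2 * pi) cc.
have itgE b (g : R -> R) : itg 0 b g = \int[@lebesgue_measure R]_x (g \_ `[0, b]) x.
  by rewrite /itg Rintegral_mkcond.
rewrite /Rintegral -integral12_prod_meas1; last exact: integrable_sep.
rewrite /fubini_F; under eq_integral => x _.
  rewrite /sep; under eq_integral => y _ do rewrite /= EFinM.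
  rewrite integralZl// -[X in (_ * X)%E]fineK; last exact: integrable_fin_num.
  over.
rewrite /= integralZr// fineM//; last exact: integrable_fin_num.
by rewrite !itgE.
Qed.

(** Two separated terms are allowed because the scalar product of two gradients
    is a sum of a latitudinal and a longitudinal part. *)
Lemma Rintegral_surf_sep (f : S2 -> R) (M : R) (a c b e : R -> R) :
  measurable_fun setT f -> (forall p, `|f p| <= M) ->
  continuous a -> continuous c -> continuous b -> continuous e ->
  (forall z, f (sph z) * sin z.1 = a z.1 * c z.2 + b z.1 * e z.2) ->
  \int[surf]_p f p =
    itg 0 pi a * itg 0 (2 * pi) c + itg 0 pi b * itg 0 (2 * pi) e.
Proof.
move=> mf bf ca cc cb ce E; rewrite -!itg_sep//.
rewrite -RintegralD//; try exact: integrable_sep.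
congr fine; rewrite integralE.
  have mfE : measurable_fun setT (EFin \o f) by exact/measurable_EFinP.
  rewrite ge0_integral_surf//; last exact: measurable_funepos.
  rewrite ge0_integral_surf//; last exact: measurable_funeneg.
  have sepE z : z \in D -> sep a c z + sep b e z = f (sph z) * sin z.1.
    by rewrite inE => -[z1 z2]; rewrite /sep !patchE !mem_set.
  have sep0 z : z \notin D -> sep a c z + sep b e z = 0.
    rewrite /sep !patchE => zD; case: ifPn => [z1|]; last by rewrite !mul0r addr0.
    case: ifPn => [z2|]; last by rewrite !mulr0 addr0.
    by move: zD; rewrite notin_setE /sph_domain => -[]; split; apply/set_mem.
  have sD z : z \in D -> 0 <= sin z.1 by move/set_mem; exact: sin_ge0.
  rewrite [RHS]integralE [X in (X - _)%E = _]integral_mkcond.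
  rewrite [X in (_ - X)%E = _]integral_mkcond; congr (_ - _)%E.
    apply: eq_integral => z _; rewrite patchE; case: ifPn => zD.
      rewrite !funeposE /= -!EFin_max -EFinM maxr_pMl ?sD// mul0r.
      by rewrite (sepE _ zD).
    by rewrite !funeposE /= (sep0 _ zD) maxxx.
  apply: eq_integral => z _; rewrite patchE; case: ifPn => zD.
    rewrite !funenegE /= -!EFin_max -EFinM maxr_pMl ?sD// mul0r.
    by rewrite (sepE _ zD) mulNr.
  by rewrite !funenegE /= (sep0 _ zD) oppr0 maxxx.
Qed.
End surface_integral.

(** * Derivatives of harmonics extended along rays *)

Lemma sum_ord3 (A : nmodType) (F : 'I_3 -> A) : \sum_j F j = F 0 + F 1 + F 2%:R.
Proof.
rewrite !big_ord_recl big_ord0 addr0 addrA.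
by congr (F _ + F _ + F _); apply/val_inj.
Qed.

Section partial_derivatives.
Variable R : realType.
Local Notation V := 'rV[R]_3.
Local Notation C := R[i].
Local Notation e_ j := (delta_mx 0 j : V).
Implicit Types (x : V) (j : 'I_3) (k : nat) (p : {poly R}) (m : int).

(** A directional derivative is an ordinary derivative along a line, for which
    the one-variable chain rule is at hand. *)
Lemma is_derive_lineP (f : V -> R) x v df :
  is_derive (0 : R) 1 (fun h => f (h *: v + x)) df <-> is_derive x v f df.
Proof.
have E : (fun h : R => h^-1 *: (f (h *: v + x) - f x)) =
    (fun h : R => h^-1 *: (((fun h => f (h *: v + x)) \o shift (0 : R)) (h *: 1)
       - (fun h => f (h *: v + x)) 0)).
  by apply/funext => h /=; rewrite addr0 scale0r add0r /GRing.scale /= mulr1.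
by split=> -[d1 d2]; split; move: d1 d2; rewrite /derivable /derive -E.
Qed.

Lemma is_derive_comp1 (f : V -> R) (g : R -> R) x v df dg :
  is_derive x v f df -> is_derive (f x) 1 g dg ->
  is_derive x v (g \o f) (dg * df).
Proof.
move=> /is_derive_lineP d1 d2; apply/is_derive_lineP.
have d2' : is_derive (f (0 *: v + x)) 1 g dg by rewrite scale0r add0r.
have := @is_derive1_comp _ g (fun h => f (h *: v + x)) 0 dg df d2' d1.
by [].
Qed.

Lemma is_derive_coord j (i : 'I_3) x : is_derive x (e_ j) (fun y : V => y 0 i) ((i == j)%:R).
Proof.
apply/is_derive_lineP.
rewrite (_ : (fun h => _) = (fun h => h * (i == j)%:R + x 0 i)).
  by apply: is_derive_eq; rewrite /GRing.scale /= mulr1 mul0r addr0 add0r.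
by apply/funext => h; rewrite !mxE eqxx.
Qed.

(** [1 / |x|], which closes under differentiation as
    [d_j rho = - x_j rho^3]. *)
Definition rho x : R := (enorm x)^-1.

Lemma sqr_sum_gt0 x : x != 0 -> 0 < \sum_i x 0 i ^+ 2.
Proof.
move=> x0; rewrite lt0r sumr_ge0 ?andbT; last by move=> i _; exact: sqr_ge0.
apply: contraNneq x0 => /eqP; rewrite psumr_eq0; last by move=> i _; exact: sqr_ge0.
move=> /allP x0; apply/eqP/rowP => i; rewrite mxE.
by have := x0 i (mem_index_enum _); rewrite /= sqrf_eq0 => /eqP.
Qed.

Lemma is_derive_rho j x : x != 0 ->
  is_derive x (e_ j) rho (- x 0 j * rho x ^+ 3).
Proof.
move=> /sqr_sum_gt0 s0.
have ds : is_derive x (e_ j) (fun y : V => \sum_i y 0 i ^+ 2) (2 * x 0 j).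
  rewrite (_ : (fun y : V => _) =
    (fun y : V => y 0 0 ^+ 2 + (y 0 1 ^+ 2 + y 0 2%:R ^+ 2))); last first.
    apply/funext => y; rewrite !big_ord_recl big_ord0 addr0.
    by congr (_ ^+ 2 + (_ ^+ 2 + _ ^+ 2)); congr (y _ _); apply/val_inj.
  have d0 := is_derive_coord j 0 x; have d1 := is_derive_coord j 1 x.
  have d2 := is_derive_coord j 2%:R x.
  apply: is_derive_eq; rewrite /GRing.scale /=.
  by case: j {d0 d1 d2} => -[|[|[|//]]] i /=;
    rewrite !(mulr0, mulr1, addr0, add0r) -mulr2n mulr_natl;
    congr (_ *+ _); congr (x _ _); apply/val_inj.
have dq := is_derive_comp1 ds (is_derive1_sqrt s0).
have n0 : enorm x != 0 by rewrite gt_eqF// sqrtr_gt0.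
have dV : is_derive (enorm x) 1 (@GRing.inv R) (- (enorm x) ^- 2).
  by apply: is_derive_eq (is_deriveV _ (is_derive_id _ _)) _ => //; rewrite /GRing.scale /= mulr1.
have := is_derive_comp1 dq dV.
rewrite (_ : _ * _ = - x 0 j * rho x ^+ 3) //.
by rewrite /rho -/(enorm x); field.
Qed.

(** Real or imaginary part of [(x + i y)^k]: a harmonic homogeneous
    polynomial. *)
Definition hpol (b : bool) (k : nat) x : R :=
  let w : C := (Complex (x 0 0) (x 0 1)) ^+ k in
  if b then complex.Re w else complex.Im w.

Lemma hpolS b k x : hpol b k.+1 x =
  x 0 0 * hpol b k x + (-1) ^+ b * (x 0 1 * hpol (~~ b) k x).
Proof.
rewrite /hpol exprS; case: (_ ^+ k) => u v; case: b => /=; first by rewrite expr1; ring.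
by rewrite expr0; ring.
Qed.

Lemma hpol0 b x : hpol b 0 x = b%:R.
Proof. by rewrite /hpol expr0; case: b. Qed.

Definition dhpol b k j x : R :=
  k%:R * (if j == 0 then hpol b k.-1 x else
          if j == 1 then (-1) ^+ b * hpol (~~ b) k.-1 x else 0).

Definition ddhpol b k j x : R :=
  (k * k.-1)%:R * (if j == 0 then hpol b k.-2 x else
                   if j == 1 then - hpol b k.-2 x else 0).

Lemma is_derive_hpol b k j x : is_derive x (e_ j) (hpol b k) (dhpol b k j x).
Proof.
elim: k b => [|k IH] b.
  rewrite /dhpol mul0r (_ : hpol b 0 = cst b%:R); first exact: is_derive_cst.
  by apply/funext => y; rewrite hpol0.
rewrite (_ : hpol b k.+1 = fun x => x 0 0 * hpol b k x + (-1) ^+ b * (x 0 1 * hpol (~~ b) k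
  x)); last first.
  by apply/funext => y; exact: hpolS.
have d0 := is_derive_coord j 0 x; have d1 := is_derive_coord j 1 x.
have h1 := IH b; have h2 := IH (~~ b).
apply: is_derive_eq; rewrite /GRing.scale /= /dhpol negbK.
have -> : (0 == j) = (j == 0) by rewrite eq_sym.
have -> : (1 == j) = (j == 1) by rewrite eq_sym.
case: k {IH h1 h2} => [|k].
  rewrite !hpol0 /=.
  by case: (eqVneq j 0) => [E|_]; rewrite ?E /=; last case: (eqVneq j 1) => _ /=;
    case: b => /=; ring.
have E1 := hpolS b k x; have E2 := hpolS (~~ b) k x.
rewrite negbK in E2; rewrite /= E1 E2 -(natr1 k.+1).
by case: (eqVneq j 0) => [E|_]; rewrite ?E /=; last case: (eqVneq j 1) => _ /=;
  case: b {E1 E2} => /=; ring.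
Qed.

Lemma is_derive_dhpol b k j x :
  is_derive x (e_ j) (dhpol b k j) (ddhpol b k j x).
Proof.
have h1 := is_derive_hpol b k.-1 j x; have h2 := is_derive_hpol (~~ b) k.-1 j x.
rewrite /dhpol /ddhpol natrM; move: h1 h2; rewrite /dhpol negbK.
case: (eqVneq j 0) => [->|j0] /=; first by move=> *; apply: is_derive_eq; rewrite
  /GRing.scale /=; ring.
case: (eqVneq j 1) => [->|j1] h1 h2.
  by apply: is_derive_eq; rewrite /GRing.scale /=; case: (b) => /=; ring.
by rewrite !mulr0; exact: is_derive_cst.
Qed.

(** Euler's identity for a homogeneous function of degree [k]. *)
Lemma hpol_euler b k x : x 0 0 * dhpol b k 0 x + x 0 1 * dhpol b k 1 x = k%:R * hpol b k x.
Proof.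
rewrite /dhpol /=; case: k => [|k]; first by rewrite !mul0r !mulr0 addr0.
by rewrite hpolS /=; ring.
Qed.

Lemma is_derive_rhoX k j x : x != 0 ->
  is_derive x (e_ j) (fun y => rho y ^+ k) (- (k%:R * x 0 j * rho x ^+ k.+2)).
Proof.
move=> x0; elim: k => [|k IH].
  rewrite !mul0r oppr0 (_ : (fun y => _) = cst 1); first exact: is_derive_cst.
  by apply/funext => y; rewrite expr0.
rewrite (_ : (fun y => _) = fun y => rho y * rho y ^+ k); last first.
  by apply/funext => y; rewrite exprS.
have d := is_derive_rho j x0.
apply: is_derive_eq; rewrite /GRing.scale /= -(natr1 k) !exprS; ring.
Qed.

(** The [j]-th derivative of [z / |x|]. *)
Definition drhoz j x : R := (j == 2%:R)%:R * rho x - x 0 2%:R * x 0 j * rho x ^+ 3.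

Lemma is_derive_horner_rho p j x : x != 0 ->
  is_derive x (e_ j) (fun y => p.[y 0 2%:R * rho y])
   (p^`().[x 0 2%:R * rho x] * drhoz j x).
Proof.
move=> x0; have d := is_derive_rho j x0; have d2 := is_derive_coord j 2%:R x.
have dz : is_derive x (e_ j) (fun y => y 0 2%:R * rho y) (drhoz j x).
  by apply: is_derive_eq; rewrite /drhoz [2%:R == j]eq_sym /GRing.scale /=; ring.
exact: is_derive_comp1 dz (is_derive_poly _ _).
Qed.

(** A harmonic of order [k] extended constantly along rays: [(x + i y)^k] and
    [z] are evaluated at [x / |x|]. *)
Definition solid p b k x : R := hpol b k x * rho x ^+ k * p.[x 0 2%:R * rho x].

Definition dsolid p b k j x : R :=
  dhpol b k j x * rho x ^+ k * p.[x 0 2%:R * rho x]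
  - k%:R * (hpol b k x * x 0 j * rho x ^+ k.+2 * p.[x 0 2%:R * rho x])
  + hpol b k x * rho x ^+ k * p^`().[x 0 2%:R * rho x] * drhoz j x.

Lemma is_derive_solid p b k j x : x != 0 ->
  is_derive x (e_ j) (solid p b k) (dsolid p b k j x).
Proof.
move=> x0; have d1 := is_derive_hpol b k j x; have d2 := is_derive_rhoX k j x0.
have d3 := is_derive_horner_rho p j x0.
by apply: is_derive_eq; rewrite /dsolid /GRing.scale /=; ring.
Qed.

(** The second derivative in direction [j], simplified by [rho x = 1]: only its
    values on the sphere matter. *)
Definition ddsolid p b k j x : R :=
  let w := (j == 2%:R)%:R - x 0 2%:R * x 0 j in
  let h := hpol b k x in let h' := dhpol b k j x in
  let g := p.[x 0 2%:R] in let g' := p^`().[x 0 2%:R] in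
  ddhpol b k j x * g - h' * k%:R * x 0 j * g + h' * g' * w
  - k%:R * (h' * x 0 j * g + h * g - h * (k.+2)%:R * x 0 j ^+ 2 * g + h * x 0 j * g' * w)
  + h' * g' * w - h * k%:R * x 0 j * g' * w + h * p^`()^`().[x 0 2%:R] * w ^+ 2
  + h * g' * (- (2%:R * (j == 2%:R)%:R * x 0 j) - x 0 2%:R + 3%:R * x 0 2%:R * x 0 j ^+ 2).

Lemma is_derive_dsolid p b k j x : rho x = 1 -> x != 0 ->
  is_derive x (e_ j) (dsolid p b k j) (ddsolid p b k j x).
Proof.
move=> r1 x0; have d1 := is_derive_hpol b k j x; have d2 := is_derive_rhoX k j x0.
have d3 := is_derive_horner_rho p j x0.
have d4 := is_derive_horner_rho p^`() j x0.
have d5 := is_derive_coord j j x; have d6 := is_derive_rhoX k.+2 j x0.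
have d7 := is_derive_rho j x0; have d8 := is_derive_rhoX 3 j x0.
have d9 := is_derive_coord j 2%:R x; have d10 := is_derive_dhpol b k j x.
have dr : is_derive x (e_ j) (drhoz j) (- ((j == 2%:R)%:R * x 0 j)
    - ((j == 2%:R)%:R * x 0 j + x 0 2%:R) + 3%:R * x 0 2%:R * x 0 j ^+ 2).
  rewrite /drhoz; apply: is_derive_eq; rewrite /GRing.scale /= r1 !expr1n eqxx.
  by rewrite [2%:R == j]eq_sym (_ : true%:R = 1)//; ring.
rewrite /dsolid; apply: is_derive_eq; rewrite /GRing.scale /= /ddsolid.
by rewrite /drhoz r1 !expr1n eqxx (_ : true%:R = 1)// !mulr1; ring.
Qed.

(** The sum of second derivatives, collected in powers of [|x|^2 = 1] and of
    Euler's expression, becomes the left-hand side of the differential equation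
    of [assoc l k]. *)
Lemma laplace_solid l b k x : (\sum_i x 0 i ^+ 2) = 1 ->
  \sum_j ddsolid (assoc R l k) b k j x =
  - lambda R l * (hpol b k x * (assoc R l k).[x 0 2%:R]).
Proof.
move=> s1; set p := assoc R l k.
have {}s1 : x 0 0 ^+ 2 + x 0 1 ^+ 2 + x 0 2%:R ^+ 2 = 1.
  by rewrite -s1 sum_ord3.
have ode := congr1 (fun q => q.[x 0 2%:R]) (assoc_ode R l k).
rewrite -/p !hornerE /= in ode.
rewrite sum_ord3.
have eul := hpol_euler b k x.
have dh2 : dhpol b k 2%:R x = 0 by rewrite /dhpol /= mulr0.
rewrite /ddsolid /ddhpol /= dh2.
rewrite -polyC_natr hornerC in ode.
move: (dhpol b k 0 x) (dhpol b k 1 x) eul => a0 a1 eul.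
move: (hpol b k x) (hpol b k.-2 x) (x 0 0) (x 0 1) (x 0 2%:R) p.[_] p^`().[_]
  p^`()^`().[_] (k * k.-1)%:R eul ode s1 => h q u v z g g1 g2 n eul ode s1.
(* Expose Euler's expression and [|x|^2], to be replaced by [k h] and [1]. *)
transitivity (- k%:R * g * (u * a0 + v * a1) - 2%:R * z * g1 * (u * a0 + v * a1)
  - k%:R * ((u * a0 + v * a1) * g + 3%:R * h * g
            - h * (k%:R + 2%:R) * (u ^+ 2 + v ^+ 2 + z ^+ 2) * g
            + h * g1 * (z - z * (u ^+ 2 + v ^+ 2 + z ^+ 2)))
  - h * k%:R * g1 * (z - z * (u ^+ 2 + v ^+ 2 + z ^+ 2))
  + h * g2 * (1 - 2%:R * z ^+ 2 + z ^+ 2 * (u ^+ 2 + v ^+ 2 + z ^+ 2))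
  + h * g1 * (- (5%:R * z) + 3%:R * z * (u ^+ 2 + v ^+ 2 + z ^+ 2))).
  by rewrite -(natr1 k.+1) -(natr1 k); ring.
rewrite eul s1; transitivity (h * ((1 - z ^+ 2) * g2 -
    2%:R * (k%:R + 1) * z * g1 - k%:R * (k%:R + 1) * g)); first by ring.
by rewrite ode /lambda natrM -(natr1 k) -(natr1 l); ring.
Qed.

Lemma cos_sinS k (t : R) :
  cos (k.+1%:R * t) = cos (k%:R * t) * cos t - sin (k%:R * t) * sin t /\
  sin (k.+1%:R * t) = sin (k%:R * t) * cos t + cos (k%:R * t) * sin t.
Proof. by rewrite -natr1 mulrDl mul1r cosD sinD. Qed.

Lemma hpol_sph b k a : hpol b k (sph a) =
  sin a.1 ^+ k * (if b then cos (k%:R * a.2) else sin (k%:R * a.2)).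
Proof.
elim: k b => [|k IH] b.
  by rewrite hpol0 expr0 mul0r cos0 sin0 mul1r; case: b.
rewrite hpolS !IH !mxE /= -(natr1 k) mulrDl mul1r cosD sinD exprS.
by case: b => /=; rewrite ?expr1 ?expr0; ring.
Qed.

(** [e_theta] and [e_phi] are the unit vectors of colatitude and longitude. *)
Definition e_theta (a : R * R) (j : 'I_3) : R :=
  [:: cos a.1 * cos a.2; cos a.1 * sin a.2; - sin a.1]`_j.
Definition e_phi (a : R * R) (j : 'I_3) : R := [:: - sin a.2; cos a.2; 0]`_j.

(** The colatitude factor of a harmonic of order [k]. *)
Definition profile p k (t : R) : R := p.[cos t] * sin t ^+ k.
Definition dprofile p k (t : R) : R :=
  k%:R * sin t ^+ k.-1 * cos t * p.[cos t] - p^`().[cos t] * sin t ^+ k.+1.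

Lemma is_derive_profile p k (t : R) :
  is_derive t 1 (profile p k) (dprofile p k t).
Proof.
have d : is_derive t 1 (fun t => p.[cos t]) (p^`().[cos t] * (- sin t)).
  exact: is_derive1_comp.
have ds : is_derive t 1 (fun t => sin t ^+ k) (k%:R * sin t ^+ k.-1 * cos t).
  have := is_deriveX k (is_derive_sin t).
  by rewrite (_ : sin ^+ k = fun t : R => sin t ^+ k)//; apply/funext => y; rewrite fctE.
rewrite /profile.
by apply: is_derive_eq; rewrite /dprofile /GRing.scale /= exprS; ring.
Qed.

Lemma rho_sphere (q : sphere R) : rho q = 1.
Proof. by case: q => q /= /eqP q1; rewrite /rho /enorm q1 sqrtr1 invr1. Qed.

Lemma sphere_neq0 (q : sphere R) : (q : V) != 0.
Proof.
apply/eqP => q0; have := rho_sphere q.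
rewrite q0 /rho /enorm sum_ord3 !mxE expr0n !addr0 sqrtr0 invr0 => /eqP.
by rewrite eq_sym oner_eq0.
Qed.

(** The gradient in the moving frame.  Its longitudinal component is
    [(1 / sin theta) d_phi]; the division lowers the power of [sin theta], and
    for [m = 0] the term is killed by its factor [m]. *)
Lemma dsolid_sph p m a j : dsolid p (0 <= m) `|m|%N j (sph a) =
  dprofile p `|m|%N a.1 * trig m a.2 * e_theta a j
  - m%:~R * sin a.1 ^+ `|m|%N.-1 * p.[cos a.1] * trig (- m) a.2 * e_phi a j.
Proof.
rewrite /dsolid rho_sphere !expr1n !mulr1 hpol_sph -/(trig m a.2).
have z : sph a 0 2%:R = cos a.1 by rewrite mxE.
rewrite /drhoz rho_sphere expr1n !mulr1 z.
have -> : dhpol (0 <= m) `|m|%N j (sph a) = sin a.1 ^+ `|m|%N.-1 *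
    (`|m|%N%:R * trig m a.2 * [:: cos a.2; sin a.2; 0]`_j
     - m%:~R * trig (- m) a.2 * e_phi a j).
  rewrite /dhpol !hpol_sph /trig /e_phi abszN.
  have [m0|m0|->] := ltrgt0P m; last first.
  - by rewrite absz0 !mul0r subr0 mulr0.
  - have -> : (0 <= - m) = true by lia.
    have -> : m%:~R = - `|m|%N%:R :> R.
      by rewrite -[in LHS](opprK m) -(ltz0_abs m0) mulrNz.
    have : (0 < `|m|)%N by lia.
    case: `|m|%N => //= k _; have [-> ->] := cos_sinS k a.2.
    have := cos2Dsin2 a.2.
    move: (cos a.2) (sin a.2) (cos (_ * _)) (sin (_ * _)) => c s ck sk cs.
    case: j => -[|[|[|//]]] i /=; last by ring.
      transitivity (k.+1%:R * (sin a.1 ^+ k * (sk * (c ^+ 2 + s ^+ 2)))).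
        by rewrite cs mulr1.
      by ring.
    transitivity (k.+1%:R * (sin a.1 ^+ k * (ck * (c ^+ 2 + s ^+ 2)))).
      by rewrite cs expr0; ring.
    by ring.
  - have -> : (0 <= - m) = false by lia.
    have -> : m%:~R = `|m|%N%:R :> R by rewrite -[in LHS](gtz0_abs m0).
    have : (0 < `|m|)%N by lia.
    case: `|m|%N => //= k _; have [-> ->] := cos_sinS k a.2.
    have := cos2Dsin2 a.2.
    move: (cos a.2) (sin a.2) (cos (_ * _)) (sin (_ * _)) => c s ck sk cs.
    case: j => -[|[|[|//]]] i /=; last by ring.
      transitivity (k.+1%:R * (sin a.1 ^+ k * (ck * (c ^+ 2 + s ^+ 2)))).
        by rewrite cs mulr1.
      by ring.
    transitivity (- k.+1%:R * (sin a.1 ^+ k * (sk * (c ^+ 2 + s ^+ 2)))).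
      by rewrite cs expr1; ring.
    by ring.
have := cos2Dsin2 a.1.
rewrite /dprofile /e_theta /e_phi.
have Ej : sph a 0 j = [:: sin a.1 * cos a.2; sin a.1 * sin a.2; cos a.1]`_j by rewrite mxE.
rewrite Ej.
move: (sin a.1) (cos a.1) (cos a.2) (sin a.2) (trig m _) (trig (- m) _) (m%:~R : R)
   => sn cs cp sp t t' mu h.
have {}h : cs ^+ 2 = 1 - sn ^+ 2 by rewrite -h addrK.
case: `|m|%N => [|k] /=.
  rewrite !expr0 expr1; case: j {Ej} => -[|[|[|//]]] i /=; try by ring.
  transitivity (t * p^`().[cs] * (1 - cs ^+ 2) - mu * p.[cs] * t' * 0); first by ring.
  by rewrite h; ring.
rewrite !exprS; case: j {Ej} => -[|[|[|//]]] i /=.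
- transitivity (k.+1%:R * sn ^+ k * p.[cs] * t * cp * cs ^+ 2
    - p^`().[cs] * (sn * (sn * sn ^+ k)) * t * cs * cp
    + mu * sn ^+ k * p.[cs] * t' * sp); first by rewrite h; ring.
  by ring.
- transitivity (k.+1%:R * sn ^+ k * p.[cs] * t * sp * cs ^+ 2
    - p^`().[cs] * (sn * (sn * sn ^+ k)) * t * cs * sp
    - mu * sn ^+ k * p.[cs] * t' * cp); first by rewrite h; ring.
  by ring.
- transitivity (- k.+1%:R * (sn * sn ^+ k) * t * cs * p.[cs]
    + sn * sn ^+ k * t * p^`().[cs] * (1 - cs ^+ 2)); first by ring.
  by rewrite h; ring.
Qed.
End partial_derivatives.

(** * Surface gradient and Laplace--Beltrami operator of the harmonics *)

Section surface_operators.
Local Open Scope complex_scope.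
Variable R : realType.
Local Notation V := 'rV[R]_3.
Local Notation C := R[i].
Local Notation S2 := (sphere R).
Local Notation e_ j := (delta_mx 0 j : V).
Implicit Types (x : V) (j : 'I_3) (l : nat) (m : int) (F : V -> C).
Definition is_cpartial F j x (v : C) :=
  is_derive x (e_ j) (fun y => complex.Re (F y)) (complex.Re v) /\
  is_derive x (e_ j) (fun y => complex.Im (F y)) (complex.Im v).

Lemma is_cpartialE F j x v : is_cpartial F j x v -> cpartial F j x = v.
Proof.
move=> [d1 d2]; rewrite /cpartial (@derive_val _ _ _ _ _ _ _ d1).
by rewrite (@derive_val _ _ _ _ _ _ _ d2); case: v {d1 d2}.
Qed.

Lemma near_is_cpartial F1 F2 j x v : (\near x, F1 x = F2 x) ->
  is_cpartial F1 j x v -> is_cpartial F2 j x v.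
Proof.
move=> F12 [d1 d2]; split.
  by apply: (near_eq_is_derive _ d1); near=> y; congr complex.Re; near: y.
by apply: (near_eq_is_derive _ d2); near=> y; congr complex.Im; near: y.
Unshelve. all: by end_near. Qed.

Lemma is_cpartialP F1 F2 j x (c v1 v2 : C) :
  is_cpartial F1 j x v1 -> is_cpartial F2 j x v2 ->
  is_cpartial (fun y => c * F1 y + F2 y) j x (c * v1 + v2).
Proof.
case: c v1 v2 => [c c'] [v1 v1'] [v2 v2'] [/= d1 d1'] [/= d2 d2']; split.
  rewrite (_ : (fun y => _) = fun y => c * complex.Re (F1 y) - c' * complex.Im (F1 y)
     + complex.Re (F2 y)); first by apply: is_derive_eq; rewrite /GRing.scale /=; ring.
  by apply/funext => y; case: (F1 y) (F2 y) => [? ?] [].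
rewrite (_ : (fun y => _) = fun y => c * complex.Im (F1 y) + c' * complex.Re (F1 y)
     + complex.Im (F2 y)); first by apply: is_derive_eq; rewrite /GRing.scale /=; ring.
by apply/funext => y; case: (F1 y) (F2 y) => [? ?] [].
Qed.

Lemma near_neq0 x : x != 0 -> \forall y \near x, y != 0.
Proof.
move=> x0; have : nbhs x (~` [set (0 : V)]).
  apply: open_nbhs_nbhs; split; last by move=> /= /eqP; rewrite (negbTE x0).
  apply: closed_openC; apply: accessible_closed_set1.
  by apply: hausdorff_accessible; exact: norm_hausdorff.
by apply: filterS => y /= /eqP.
Qed.

(** A certificate that [f] has surface gradient [G] and Laplacian [Lf], together
    with the differentiability behind it.  The operators themselves are total
    functions, additive only on differentiable arguments, whereas certificates
    can be combined linearly. *)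
Definition surface_deriv (f : S2 -> C) (G : S2 -> 'rV[C]_3) (Lf : S2 -> C) :=
  exists g, exists h : 'I_3 -> S2 -> C,
  [/\ forall x j, x != 0 -> is_cpartial (hom_ext f) j x (g j x),
      forall (q : S2) j, is_cpartial (g j) j q (h j q),
      forall q, G q = \row_j g j q & forall q, Lf q = \sum_j h j q].

Lemma surface_derivE f G Lf : surface_deriv f G Lf ->
  sgrad f = G /\ laplace_beltrami f = Lf.
Proof.
move=> [g [h [Hg Hh EG EL]]]; split; apply/funext => q.
  by rewrite EG; apply/rowP => j; rewrite !mxE; exact/is_cpartialE/Hg/sphere_neq0.
rewrite EL; apply: eq_bigr => j _; apply/is_cpartialE.
apply: (near_is_cpartial _ (Hh q j)).
have := near_neq0 (sphere_neq0 q).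
by apply: filterS => x x0; apply/esym/is_cpartialE/Hg.
Qed.

Lemma surface_deriv_lin c f1 G1 L1 f2 G2 L2 :
  surface_deriv f1 G1 L1 -> surface_deriv f2 G2 L2 ->
  surface_deriv (c *: f1 + f2) (c *: G1 + G2) (c *: L1 + L2).
Proof.
move=> [g1 [h1 [Hg1 Hh1 EG1 EL1]]] [g2 [h2 [Hg2 Hh2 EG2 EL2]]].
exists (fun j x => c * g1 j x + g2 j x), (fun j q => c * h1 j q + h2 j q).
split.
- by move=> x j x0; apply: is_cpartialP; [exact: Hg1|exact: Hg2].
- by move=> q j; apply: is_cpartialP; [exact: Hh1|exact: Hh2].
- by move=> q; rewrite !fctE EG1 EG2; apply/rowP => j; rewrite !mxE.
- by move=> q; rewrite !fctE EL1 EL2 big_split /= -mulr_sumr.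
Qed.

Lemma surface_deriv0 : surface_deriv 0 0 0.
Proof.
exists (fun=> fun=> 0), (fun=> fun=> 0).
split.
- by move=> x j _; split; exact: is_derive_cst.
- by move=> q j; split; exact: is_derive_cst.
- by move=> q; apply/rowP => j; rewrite !mxE.
- by move=> q; rewrite big1.
Qed.

(** The harmonics are real; [yreal] and [grady] are their real values and
    gradients, on which integration takes place. *)
Definition yreal l m (q : S2) : R :=
  Ynorm R l `|m|%N * solid (assoc R l `|m|%N) (0 <= m) `|m|%N q.

Definition grady l m j (q : S2) : R :=
  Ynorm R l `|m|%N * dsolid (assoc R l `|m|%N) (0 <= m) `|m|%N j q.

Lemma hpolZ b k (r : R) x : hpol b k (r *: x) = r ^+ k * hpol b k x.
Proof.
elim: k b => [|k IH] b; first by rewrite !hpol0 mul1r.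
by rewrite !hpolS !IH !mxE exprS; ring.
Qed.

(** With [r = 1] this evaluates the harmonic on the sphere, and with
    [r = 1 / |x|] its extension along rays. *)
Lemma Y_solid l m (q : S2) (x : V) (r : R) : (q : V) = r *: x ->
  Y l m q = (Ynorm R l `|m|%N * (r ^+ `|m|%N * hpol (0 <= m) `|m|%N x
               * (assoc R l `|m|%N).[x 0 2%:R * r]))%:C.
Proof.
move=> E; rewrite /Y -hpolZ -E /hpol.
have -> : x 0 2%:R * r = point_of q 0 2%:R by rewrite E mxE mulrC.
by congr (_%:C); rewrite -[LHS]mulrA; congr (_ * _); exact: mulrC.
Qed.

Lemma YE l m : Y l m = fun q => (yreal l m q)%:C.
Proof.
apply/funext => q; rewrite (@Y_solid _ _ _ q 1) ?scale1r// /yreal /solid.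
by rewrite rho_sphere expr1n mul1r !mulr1.
Qed.

Lemma hom_ext_Y l m x : x != 0 ->
  hom_ext (Y l m) x = (Ynorm R l `|m|%N * solid (assoc R l `|m|%N) (0 <= m) `|m|%N x)%:C.
Proof.
move=> x0; rewrite /hom_ext /= (@Y_solid _ _ _ x (rho x)); last first.
  rewrite /normalize insubdK// unfold_in /=; apply/eqP.
  under eq_bigr => i _ do rewrite mxE exprMn.
  have s0 := sqr_sum_gt0 x0.
  by rewrite -mulr_sumr exprVn sqr_sqrtr ?mulVf ?gt_eqF// ltW.
by congr (_%:C); rewrite /solid; congr (_ * _); rewrite [_ ^+ _ * _]mulrC.
Qed.

Lemma surface_deriv_Y l m :
  surface_deriv (Y l m) (fun q => \row_j (grady l m j q)%:C)
    (fun q => - (lambda R l)%:C * Y l m q).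
Proof.
set k := `|m|%N; set N := Ynorm R l k; set p := assoc R l k; set b := 0 <= m.
exists (fun j (x : V) => (N * dsolid p b k j x)%:C), (fun j q => (N * ddsolid p b k j q)%:C).
split.
- move=> x j x0; apply: (@near_is_cpartial (fun x => (N * solid p b k x)%:C)).
    by have := near_neq0 x0; apply: filterS => y y0; rewrite hom_ext_Y.
  split; last exact: is_derive_cst.
  have d := is_derive_solid p b k j x0.
  by apply: is_derive_eq => /=; rewrite /GRing.scale /=; ring.
- move=> q j; split; last exact: is_derive_cst.
  have d := is_derive_dsolid p b k j (rho_sphere q) (sphere_neq0 q).
  by apply: is_derive_eq => /=; rewrite /GRing.scale /=; ring.
- by [].
move=> q; rewrite YE -rmorphN -rmorphM -rmorph_sum /= -mulr_sumr.
rewrite laplace_solid; last by case: q => q /= /eqP.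
congr (_%:C); rewrite /yreal /solid rho_sphere expr1n !mulr1 -/N -/b -/k -/p.
by ring.
Qed.
End surface_operators.

(** * Orthogonality of the harmonics and of their gradients *)

Section harmonic_integrals.
Variable R : realType.
Local Notation S2 := (sphere R).
Implicit Types (f g : S2 -> R) (p : {poly R}) (l k : nat) (m : int) (j : 'I_3).

(** Bounded measurable functions are integrable for the finite surface measure
    and are stable under the polynomial operations that build the harmonics. *)
Definition bmeas f := measurable_fun setT f /\ exists M : R, forall q, `|f q| <= M.

Lemma bmeas_cst (c : R) : bmeas (fun=> c).
Proof. by split; [exact: measurable_cst|exists `|c|]. Qed.

Lemma bmeasD f g : bmeas f -> bmeas g -> bmeas (fun q => f q + g q).
Proof.
move=> [mf [M bf]] [mg [N bg]]; split; first exact: measurable_funD.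
by exists (M + N) => q; rewrite (le_trans (ler_normD _ _))// lerD.
Qed.

Lemma bmeasM f g : bmeas f -> bmeas g -> bmeas (fun q => f q * g q).
Proof.
move=> [mf [M bf]] [mg [N bg]]; split; first exact: measurable_funM.
by exists (M * N) => q; rewrite normrM ler_pM.
Qed.

Lemma bmeasB f g : bmeas f -> bmeas g -> bmeas (fun q => f q - g q).
Proof.
move=> nf ng; have := bmeasD nf (bmeasM (bmeas_cst (-1)) ng).
by congr bmeas; apply/funext => q; rewrite mulN1r.
Qed.

Lemma bmeasX f k : bmeas f -> bmeas (fun q => f q ^+ k).
Proof.
move=> nf; elim: k => [|k IH].
  have := bmeas_cst 1; congr bmeas; apply/funext => q; by rewrite expr0.
by have := bmeasM nf IH; congr bmeas; apply/funext => q; rewrite exprS.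
Qed.

Lemma bmeas_horner f p : bmeas f -> bmeas (fun q => p.[f q]).
Proof.
move=> nf; elim/poly_ind: p => [|p c IH].
  by have := bmeas_cst 0; congr bmeas; apply/funext => q; rewrite horner0.
have := bmeasD (bmeasM IH nf) (bmeas_cst c); congr bmeas; apply/funext => q.
by rewrite !hornerE.
Qed.

Lemma bmeas_coord j : bmeas (fun q : S2 => point_of q 0 j).
Proof.
split; last first.
  exists 1 => -[q /= /eqP q1]; rewrite -(@ler_pXn2r _ 2)// ?nnegrE// expr1n.
  rewrite real_normK ?num_real// -q1 (bigD1 j)//= lerDl.
  by apply: sumr_ge0 => i _; exact: sqr_ge0.
have mc : measurable_fun setT (@coords R).
  by move=> _ B mB; rewrite setTI; exists B => //; rewrite setTI.
case: j => -[|[|[|//]]] i.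
- rewrite (_ : (fun q => _) = (fst \o fst) \o @coords R).
    by apply: measurableT_comp => //; exact: measurableT_comp.
  by apply/funext => q /=; congr (point_of q _ _); apply/val_inj.
- rewrite (_ : (fun q => _) = (snd \o fst) \o @coords R).
    by apply: measurableT_comp => //; exact: measurableT_comp.
  by apply/funext => q /=; congr (point_of q _ _); apply/val_inj.
- rewrite (_ : (fun q => _) = snd \o @coords R).
    by apply: measurableT_comp.
  by apply/funext => q /=; congr (point_of q _ _); apply/val_inj.
Qed.

Lemma bmeas_hpol b k : bmeas (fun q : S2 => hpol b k q).
Proof.
elim: k b => [|k IH] b.
  by have := bmeas_cst b%:R; congr bmeas; apply/funext => q; rewrite hpol0.
have := bmeasD (bmeasM (bmeas_coord 0) (IH b))
  (bmeasM (bmeas_cst ((-1) ^+ b)) (bmeasM (bmeas_coord 1) (IH (~~ b)))).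
by congr bmeas; apply/funext => q; rewrite hpolS.
Qed.

Lemma bmeas_yreal l m : bmeas (yreal l m).
Proof.
have := bmeasM (bmeas_cst (Ynorm R l `|m|%N)) (bmeasM (bmeas_hpol (0 <= m) `|m|%N)
  (bmeas_horner (assoc R l `|m|%N) (bmeas_coord 2%:R))).
congr bmeas; apply/funext => q.
by rewrite /yreal /solid rho_sphere expr1n !mulr1.
Qed.

Lemma bmeas_grady l m j : bmeas (grady l m j).
Proof.
set k := `|m|%N; set b := 0 <= m; set p := assoc R l k.
have nz := bmeas_coord 2%:R; have nj := bmeas_coord j.
have nd : bmeas (fun q : S2 => dhpol b k j q).
  rewrite /dhpol; case: (j == 0); last case: (j == 1).
  - exact: (bmeasM (bmeas_cst _) (bmeas_hpol _ _)).
  - exact: (bmeasM (bmeas_cst _) (bmeasM (bmeas_cst _) (bmeas_hpol _ _))).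
  - exact: (bmeasM (bmeas_cst _) (bmeas_cst _)).
have := bmeasM (bmeas_cst (Ynorm R l k)) (bmeasD (bmeasB
   (bmeasM nd (bmeas_horner p nz))
   (bmeasM (bmeas_cst k%:R) (bmeasM (bmeasM (bmeas_hpol b k) nj) (bmeas_horner p nz))))
   (bmeasM (bmeasM (bmeas_hpol b k) (bmeas_horner p^`() nz))
      (bmeasB (bmeas_cst ((j == 2%:R)%:R)) (bmeasM nz nj)))).
congr bmeas; apply/funext => q.
by rewrite /grady /dsolid /drhoz rho_sphere !expr1n !mulr1.
Qed.

Lemma bmeas_integrable f : bmeas f -> surf.-integrable setT (EFin \o f).
Proof. by move=> [mf [M bf]]; exact: bounded_integrable_surf mf bf. Qed.

(** [\int_(-1)^1 q(z) dz] in the variable [z = cos theta]. *)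
Definition pint (q : {poly R}) : R := itg 0 pi (fun t => q.[cos t] * sin t).

Lemma continuous_horner_cos (q : {poly R}) : continuous (fun t : R => q.[cos t]).
Proof.
apply: (@is_derive_continuous _ _ (fun t => q^`().[cos t] * (- sin t))).
Qed.

Let cont_pint q : continuous (fun t : R => q.[cos t] * sin t).
Proof.
by move=> t; apply: cvgM; [exact: continuous_horner_cos|exact: continuous_sin].
Qed.

Lemma pintD p q : pint (p + q) = pint p + pint q.
Proof.
by rewrite /pint -itgD//; apply: eq_itg => t; rewrite hornerD mulrDl.
Qed.

Lemma pintZ c p : pint (c%:P * p) = c * pint p.
Proof.
by rewrite /pint -itgZ//; apply: eq_itg => t; rewrite hornerM hornerC mulrA.
Qed.

Lemma pint_deriv p : pint p^`() = p.[1] - p.[-1].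
Proof.
have d (t : R) : is_derive t 1 (fun t => - p.[cos t]) (p^`().[cos t] * sin t).
  have d1 : is_derive t 1 (fun t => p.[cos t]) (p^`().[cos t] * (- sin t)).
    exact: is_derive1_comp.
  by apply: is_derive_eq; rewrite mulrN opprK.
rewrite /pint (itg_FTC (pi_gt0 R) (@cont_pint _) d).
by rewrite cospi cos0 opprK addrC.
Qed.

Lemma continuous_profile p k : continuous (@profile R p k).
Proof. exact: is_derive_continuous (is_derive_profile p k). Qed.

Lemma continuous_sinX k : continuous (fun t : R => sin t ^+ k).
Proof.
rewrite (_ : (fun t => _) = @profile R 1 k); first exact: continuous_profile.
by apply/funext => s; rewrite /profile hornerC mul1r.
Qed.

Lemma continuous_dprofile p k : continuous (@dprofile R p k).
Proof.
move=> t; rewrite /dprofile; apply: cvgB.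
  apply: cvgM; last exact: continuous_horner_cos.
  apply: cvgM; last exact: continuous_cos.
  apply: cvgM; [exact: cvg_cst|exact: continuous_sinX].
by apply: cvgM; [exact: continuous_horner_cos|exact: continuous_sinX].
Qed.

Local Notation nm l m := (Ynorm R l `|m|%N).
Local Notation pf l m := (profile (assoc R l `|m|%N) `|m|%N).
Local Notation dpf l m := (dprofile (assoc R l `|m|%N) `|m|%N).

Lemma yreal_sph l m (a : R * R) :
  yreal l m (sph a) = nm l m * (pf l m a.1 * trig m a.2).
Proof.
rewrite /yreal /solid rho_sphere expr1n !mulr1 hpol_sph -/(trig m a.2) /profile.
by rewrite [sph a 0 _]mxE /=; ring.
Qed.

Let cM (f g : R -> R) : continuous f -> continuous g -> continuous (fun t => f t * g t).
Proof. by move=> cf cg t; apply: cvgM; [exact: cf|exact: cg]. Qed.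
Let cc (c : R) : continuous (fun _ : R => c).
Proof. by move=> t; exact: cvg_cst. Qed.

Lemma Rintegral_yreal l m l' m' :
  \int[surf]_q (yreal l m q * yreal l' m' q) =
  nm l m * nm l' m' * (itg 0 pi (fun t => pf l m t * pf l' m' t * sin t)
    * trig_inner R m m').
Proof.
have [mf [M bM]] := bmeasM (bmeas_yreal l m) (bmeas_yreal l' m').
have cs := @continuous_sin R; have ct := @continuous_trig R.
have cp := continuous_profile.
rewrite (@Rintegral_surf_sep _ _ M (fun t => nm l m * nm l' m' * (pf l m t * pf l' m' t * sin t))
   (fun t => trig m t * trig m' t) (fun=> 0) (fun=> 0))//.
- rewrite itgZ; last by do 2 apply: cM => //.
  by rewrite (_ : itg 0 pi (fun=> 0) = 0) ?mul0r ?addr0 ?mulrA// /itg /Rintegral integral0_eq.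
- by apply: cM; [exact: cc|do 2 apply: cM => //].
- exact: cM.
- by move=> z; rewrite !yreal_sph; ring.
Qed.

Lemma itg_profile l l' m : itg 0 pi (fun t => pf l m t * pf l' m t * sin t) =
  pint ((1 - 'X^2) ^+ `|m|%N * assoc R l `|m|%N * assoc R l' `|m|%N).
Proof.
apply: eq_itg => t; rewrite !hornerE /=.
rewrite (_ : 1 - cos t ^+ 2 = sin t ^+ 2); last by rewrite -(cos2Dsin2 t) addrC addKr.
by rewrite /profile -exprM mulnC exprM expr2; ring.
Qed.

(** The colatitude factor divided by [sin theta], as it occurs in the
    longitudinal component of the gradient. *)
Definition bprofile p k (t : R) : R := sin t ^+ k.-1 * p.[cos t].
Local Notation bpf l m := (bprofile (assoc R l `|m|%N) `|m|%N).

Lemma grady_sph l m j (a : R * R) : grady l m j (sph a) =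
  nm l m * (dpf l m a.1 * trig m a.2 * e_theta a j
            + - (m%:~R * bpf l m a.1 * trig (- m) a.2) * e_phi a j).
Proof. by rewrite /grady dsolid_sph /bprofile; ring. Qed.

(** The moving frame is orthonormal. *)
Lemma frame_dot (a : R * R) (u v u' v' : R) :
  \sum_j (u * e_theta a j + v * e_phi a j) * (u' * e_theta a j + v' * e_phi a j)
  = u * u' + v * v'.
Proof.
rewrite sum_ord3 /e_theta /e_phi /=; have := cos2Dsin2 a.1; have := cos2Dsin2 a.2.
move: (cos a.1) (sin a.1) (cos a.2) (sin a.2) => c s cp sp h1 h2.
transitivity (u * u' * (c ^+ 2 * (cp ^+ 2 + sp ^+ 2) + s ^+ 2)
  + v * v' * (cp ^+ 2 + sp ^+ 2)); first by ring.
by rewrite h1 mulr1 h2 !mulr1.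
Qed.

Let cbp p k : continuous (bprofile p k).
Proof. by apply: cM; [exact: continuous_sinX|exact: continuous_horner_cos]. Qed.

(** The weak form of the eigenvalue equation.  Orders [m] and [m'] separate by
    orthogonality of the trigonometric system, and for equal orders Green's
    identity for polynomials applies. *)
Lemma Rintegral_grad l m l' m' :
  \int[surf]_q (\sum_j grady l m j q * grady l' m' j q) =
  lambda R l * \int[surf]_q (yreal l m q * yreal l' m' q).
Proof.
have nsum : bmeas (fun q => \sum_j grady l m j q * grady l' m' j q).
  have n j := bmeasM (bmeas_grady l m j) (bmeas_grady l' m' j).
  have := bmeasD (bmeasD (n 0) (n 1)) (n 2%:R).
  by congr bmeas; apply/funext => q; rewrite sum_ord3.
have [mf [M bM]] := nsum.
have cs := @continuous_sin R; have ct := @continuous_trig R.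
have cp := continuous_dprofile; have cb := cbp.
pose NN := nm l m * nm l' m'.
rewrite (@Rintegral_surf_sep _ _ M
   (fun t => NN * (dpf l m t * dpf l' m' t * sin t))
   (fun t => trig m t * trig m' t)
   (fun t => NN * (m%:~R * m'%:~R) * (bpf l m t * bpf l' m' t * sin t))
   (fun t => trig (- m) t * trig (- m') t))//; last 5 first.
- by apply: cM; [exact: cc|do 2 apply: cM => //].
- exact: cM.
- by apply: cM; [exact: cc|do 2 apply: cM => //].
- exact: cM.
- move=> z; under eq_bigr => j _ do rewrite !grady_sph mulrACA.
  by rewrite -mulr_sumr frame_dot /NN; ring.
rewrite -!/(trig_inner R _ _) !itgZ; try by do 2 apply: cM => //.
rewrite Rintegral_yreal -/NN.
have [<-|mm] := eqVneq m m'; last first.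
  by rewrite !trig_inner_orth ?eqr_opp// !mulr0 addr0.
have -> : trig_inner R (- m) (- m) = trig_inner R m m.
  by rewrite !trig_inner_diag oppr_eq0.
have mm : (m%:~R * m%:~R : R) = `|m|%N%:R ^+ 2.
  by case: (m) => k; rewrite ?expr2// NegzE mulrNz mulrNN abszN.
suff H : itg 0 pi (fun t => dpf l m t * dpf l' m t * sin t) + m%:~R * m%:~R *
    itg 0 pi (fun t => bpf l m t * bpf l' m t * sin t) =
    lambda R l * itg 0 pi (fun t => pf l m t * pf l' m t * sin t).
  transitivity (NN * trig_inner R m m *
     (itg 0 pi (fun t => dpf l m t * dpf l' m t * sin t) + m%:~R * m%:~R *
      itg 0 pi (fun t => bpf l m t * bpf l' m t * sin t))); first by ring.
  by rewrite H; ring.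
rewrite itg_profile -(int_grad_poly pintD pintZ pint_deriv l l' `|m|%N) mm.
rewrite -itgZ; last by do 2 apply: cM => //.
rewrite -itgD; [|by do 2 apply: cM => //|by apply: cM; [exact: cc|do 2 apply: cM => //]].
apply: eq_itg => t; rewrite /grad_poly !hornerE /= !hornerMn !hornerE /=.
have -> : 1 - cos t ^+ 2 = sin t ^+ 2 by rewrite -(cos2Dsin2 t) addrC addKr.
rewrite /dprofile /bprofile -!exprM !(mulnC 2) !exprM.
case: `|m|%N => [|k]; first by rewrite /= !expr0; ring.
by rewrite /= !exprS; ring.
Qed.

Lemma yreal_orthonormal l m l' m' : (`|m| <= l)%N -> (`|m'| <= l')%N ->
  \int[surf]_q (@yreal R l m q * yreal l' m' q) = ((l == l') && (m == m'))%:R.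
Proof.
move=> ml ml'; rewrite Rintegral_yreal.
have [<-|mm] := eqVneq m m'; last by rewrite trig_inner_orth// !mulr0 andbF.
rewrite itg_profile andbT.
have [<-|ll] := eqVneq l l'; last first.
  by rewrite (assoc_orth pintD pintZ pint_deriv)// mul0r mulr0.
have := wnormE pintD pintZ pint_deriv ml; rewrite /wnorm [X in pint X](_ : _ =
  (1 - 'X^2) ^+ `|m|%N * assoc R l `|m|%N * assoc R l `|m|%N); last by rewrite -mulrA -expr2.
move=> ->; rewrite -expr2 sqr_sqrtr; last first.
  by rewrite !mulr_ge0// ?invr_ge0 ?ler0n ?mulr_ge0 ?ler0n ?pi_ge0//; case: ifP.
rewrite trig_inner_diag absz_eq0.
have f0 n : (n`!%:R : R) != 0 by rewrite pnatr_eq0 -lt0n fact_gt0.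
have pi0 : (pi : R) != 0 by rewrite gt_eqF ?pi_gt0.
have l0 : 2 * l%:R + 1 != 0 :> R by rewrite -natrM natr1 pnatr_eq0.
rewrite -(natr1 l.*2) -mul2n natrM.
move: (pi : R) pi0 => P P0; rewrite (_ : true%:R = 1)//.
by case: ifP => _; field; rewrite !(f0, l0, P0).
Qed.

(** The gradient rotated by the outward normal, [n x grad Y]. *)
Definition rotgrad l m j (q : S2) : R :=
  point_of q 0 (j + 1) * grady l m (j + 2%:R) q
  - point_of q 0 (j + 2%:R) * grady l m (j + 1) q.

Lemma bmeas_rotgrad l m j : bmeas (rotgrad l m j).
Proof.
exact: (bmeasB (bmeasM (bmeas_coord _) (bmeas_grady _ _ _)) (bmeasM (bmeas_coord _)
  (bmeas_grady _ _ _))).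
Qed.

Lemma rotgrad_sph l m j (a : R * R) : rotgrad l m j (sph a) =
  nm l m * (m%:~R * bpf l m a.1 * trig (- m) a.2 * e_theta a j
    + dpf l m a.1 * trig m a.2 * e_phi a j).
Proof.
rewrite /rotgrad !grady_sph.
have E (i : 'I_3) : point_of (sph a) 0 i = [:: sin a.1 * cos a.2; sin a.1 * sin a.2; cos a.1]`_i.
  by rewrite mxE.
rewrite !E {E} /e_theta /e_phi.
move: (cos a.1) (sin a.1) (cos a.2) (sin a.2) (cos2Dsin2 a.1) (cos2Dsin2 a.2).
move: (dpf l m a.1 * trig m a.2) (m%:~R * bpf l m a.1 * trig (- m) a.2).
move=> u v c s cp sp h1 h2.
case: j => -[|[|[|//]]] i /=.
- transitivity (nm l m * (v * c * cp - u * sp * (c ^+ 2 + s ^+ 2))); first by ring.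
  by rewrite h1; ring.
- transitivity (nm l m * (v * c * sp + u * cp * (c ^+ 2 + s ^+ 2))); first by ring.
  by rewrite h1; ring.
- transitivity (nm l m * (- v * s * (cp ^+ 2 + sp ^+ 2))); first by ring.
  by rewrite h2; ring.
Qed.

(** A gradient is orthogonal to every rotated gradient: after integration by
    parts in the longitude, the colatitude integrand is the derivative of the
    product of the two profiles, which vanishes at both poles. *)
Lemma Rintegral_rotgrad l m l' m' :
  \int[@surf R]_q (\sum_j grady l m j q * rotgrad l' m' j q) = 0.
Proof.
have nsum : bmeas (fun q => \sum_j grady l m j q * rotgrad l' m' j q).
  have n j := bmeasM (bmeas_grady l m j) (bmeas_rotgrad l' m' j).
  have := bmeasD (bmeasD (n 0) (n 1)) (n 2%:R).
  by congr bmeas; apply/funext => q; rewrite sum_ord3.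
have [mf [M bM]] := nsum.
have cs := @continuous_sin R; have ct := @continuous_trig R.
have cd := continuous_dprofile; have cp := continuous_profile.
pose NN := nm l m * nm l' m'.
rewrite (@Rintegral_surf_sep _ _ M
   (fun t => NN * m'%:~R * (dpf l m t * pf l' m' t))
   (fun t => trig m t * trig (- m') t)
   (fun t => - (NN * m%:~R) * (pf l m t * dpf l' m' t))
   (fun t => trig (- m) t * trig m' t))//; last 5 first.
- by apply: cM; [exact: cc|exact: cM].
- exact: cM.
- by apply: cM; [exact: cc|exact: cM].
- exact: cM.
- move=> z; under eq_bigr => j _ do rewrite grady_sph rotgrad_sph mulrACA.
  rewrite -mulr_sumr frame_dot /NN.
  (* [bpf] is [pf] over [sin], except at [m1 = 0] where the factor vanishes. *)
  have B l1 m1 : m1%:~R * (bpf l1 m1 z.1 * sin z.1) = m1%:~R * pf l1 m1 z.1.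
    rewrite /bprofile /profile; have [->|m0] := eqVneq m1 0; first by rewrite !mul0r.
    have : (0 < `|m1|)%N by lia.
    by case: `|m1|%N => // k _; rewrite exprS /=; ring.
  transitivity (nm l m * nm l' m' * (m'%:~R * (bpf l' m' z.1 * sin z.1)) * dpf l m z.1 *
    trig m z.2 * trig (- m') z.2
   - nm l m * nm l' m' * (m%:~R * (bpf l m z.1 * sin z.1)) * dpf l' m' z.1 * trig (- m) z.2
     * trig m' z.2); first by ring.
  by rewrite !B; ring.
rewrite -!/(trig_inner R _ _) !itgZ; try exact: cM.
have E := trig_inner_parts R m m'.
have {}E : m%:~R * trig_inner R (- m) m' = - (m'%:~R * trig_inner R m (- m')).
  by apply/eqP; rewrite -addr_eq0 E.
transitivity (NN * (m'%:~R * trig_inner R m (- m')) *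
   (itg 0 pi (fun t => dpf l m t * pf l' m' t)) - NN * (m%:~R * trig_inner R (- m) m') *
    itg 0 pi (fun t => pf l m t * dpf l' m' t)); first by ring.
rewrite E mulrN mulNr opprK -mulrDr -itgD; [|exact: cM|exact: cM].
have [->|m0] := eqVneq m' 0; first by rewrite !mul0r mulr0 mul0r.
have c : continuous (fun t => dpf l m t * pf l' m' t + pf l m t * dpf l' m' t).
  by move=> t; apply: cvgD; exact: cM.
have d (t : R) : is_derive t 1 (fun t => pf l m t * pf l' m' t)
    (dpf l m t * pf l' m' t + pf l m t * dpf l' m' t).
  have d1 := is_derive_profile (assoc R l `|m|%N) `|m|%N t.
  have d2 := is_derive_profile (assoc R l' `|m'|%N) `|m'|%N t.
  by apply: is_derive_eq; rewrite /GRing.scale /=; ring.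
rewrite (itg_FTC (pi_gt0 R) c d) /profile sinpi sin0 !expr0n !absz_eq0 (negbTE m0).
by rewrite !mulr0 subrr mulr0.
Qed.
End harmonic_integrals.

(** * Square-integrable functions *)

Section square_integrable.
Local Open Scope complex_scope.
Context d (T : measurableType d) (R : realType) (mu : {measure set T -> \bar R}).
Implicit Types (u v : T -> R) (phi psi : T -> R[i]).

Definition rint u := mu.-integrable setT (EFin \o u).

Lemma rintD u v : rint u -> rint v -> rint (fun x => u x + v x).
Proof. by move=> iu iv; apply: eq_integrable (integrableD _ iu iv). Qed.

Lemma rintZ (c : R) u : rint u -> rint (fun x => c * u x).
Proof. by move=> iu; apply: eq_integrable (integrableZl _ c iu). Qed.

Lemma rintB u v : rint u -> rint v -> rint (fun x => u x - v x).
Proof. by move=> iu iv; apply: eq_integrable (integrableB _ iu iv). Qed.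

Lemma le_rint u v : measurable_fun setT u -> (forall x, `|u x| <= `|v x|) ->
  rint v -> rint u.
Proof.
move=> mu' uv; apply: le_integrable => //; first exact/measurable_EFinP.
by move=> x _ /=; rewrite lee_fin.
Qed.

Definition sqint u := measurable_fun setT u /\ (\int[mu]_x (u x ^+ 2)%:E < +oo)%E.

Lemma sqint_rint u : sqint u -> rint (fun x => u x ^+ 2).
Proof.
move=> [mU iU]; apply/integrableP; split.
  by apply/measurable_EFinP; exact: measurable_funX.
apply: le_lt_trans iU; rewrite le_eqVlt; apply/orP; left; apply/eqP.
by apply: eq_integral => x _ /=; rewrite ger0_norm// sqr_ge0.
Qed.

Lemma sqintM u v : sqint u -> sqint v -> rint (fun x => u x * v x).
Proof.
move=> su sv; apply: (@le_rint _ (fun x => u x ^+ 2 + v x ^+ 2)).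
- by apply: measurable_funM; [case: su|case: sv].
- move=> x; rewrite [leRHS]ger0_norm ?addr_ge0 ?sqr_ge0// normrM.
  rewrite -(real_normK (num_real (u x))) -(real_normK (num_real (v x))).
  have := sqr_ge0 (`|u x| - `|v x|).
  have : 0 <= `|u x| * `|v x| by rewrite mulr_ge0.
  rewrite sqrrB mulr2n; lra.
- by apply: rintD; exact: sqint_rint.
Qed.

Lemma rint_sqint u : measurable_fun setT u -> rint (fun x => u x ^+ 2) -> sqint u.
Proof.
move=> mU /integrableP[_ iU]; split=> //; apply: le_lt_trans iU.
rewrite le_eqVlt; apply/orP; left; apply/eqP.
by apply: eq_integral => x _ /=; rewrite ger0_norm// sqr_ge0.
Qed.

Lemma sqintD u v : sqint u -> sqint v -> sqint (fun x => u x + v x).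
Proof.
move=> su sv; apply: rint_sqint; first by apply: measurable_funD; [case: su|case: sv].
rewrite (_ : (fun x => _) = fun x => u x ^+ 2 + (2 * (u x * v x) + v x ^+ 2)).
  by apply: rintD; [exact: sqint_rint|apply: rintD; [exact/rintZ/sqintM|exact: sqint_rint]].
by apply/funext => x; ring.
Qed.

Lemma sqintZ (c : R) u : sqint u -> sqint (fun x => c * u x).
Proof.
move=> su; apply: rint_sqint; first by apply: measurable_funM; [exact: measurable_cst|case: su].
rewrite (_ : (fun x => _) = fun x => c ^+ 2 * u x ^+ 2); first exact/rintZ/sqint_rint.
by apply/funext => x; rewrite exprMn.
Qed.

Definition cint phi := rint (fun x => complex.Re (phi x)) /\ rint (fun x => complex.Im (phi x)).

Lemma cintP (c : R[i]) phi psi : cint phi -> cint psi -> cint (fun x => c * phi x + psi x).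
Proof.
move: c => [c c'] [r1 i1] [r2 i2]; split.
  rewrite (_ : (fun x => _) = fun x => c * complex.Re (phi x) - c' * complex.Im (phi x) +
    complex.Re (psi x)).
    by apply: rintD => //; apply: rintB; exact: rintZ.
  by apply/funext => x; case: (phi x) (psi x) => [? ?] [].
rewrite (_ : (fun x => _) = fun x => c * complex.Im (phi x) + c' * complex.Re (phi x) +
  complex.Im (psi x)).
  by apply: rintD => //; apply: rintD; exact: rintZ.
by apply/funext => x; case: (phi x) (psi x) => [? ?] [].
Qed.

Lemma cintegralP (c : R[i]) phi psi : cint phi -> cint psi ->
  cintegral mu (fun x => c * phi x + psi x) = c * cintegral mu phi + cintegral mu psi.
Proof.
move: c => [c c'] [r1 i1] [r2 i2]; rewrite /cintegral.
rewrite [X in X +i* _](_ : _ = \int[mu]_x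
    (c * complex.Re (phi x) - c' * complex.Im (phi x) + complex.Re (psi x))); last first.
  by congr fine; apply: eq_integral => x _; case: (phi x) (psi x) => [? ?] [].
rewrite [X in _ +i* X](_ : _ = \int[mu]_x
    (c * complex.Im (phi x) + c' * complex.Re (phi x) + complex.Im (psi x))); last first.
  by congr fine; apply: eq_integral => x _; case: (phi x) (psi x) => [? ?] [].
have r3 := rintZ c r1; have i3 := rintZ c' i1; have r4 := rintZ c' r1; have i4 := rintZ c i1.
rewrite RintegralD//; last exact: rintB.
rewrite RintegralB// RintegralD//; last exact: rintD.
by rewrite RintegralD// !RintegralZl.
Qed.

End square_integrable.

(** * Inner products of functions and of vector fields *)

Section inner_product.
Local Open Scope complex_scope.
Variable R : realType.
Local Notation C := R[i].
Local Notation S2 := (sphere R).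
Implicit Types (f g h : S2 -> C) (V W : S2 -> 'rV[C]_3) (u : S2 -> R).
Local Notation sq := (sqint (@surf R)).

Lemma L2P f : L2 f <-> sq (fun p => complex.Re (f p)) /\ sq (fun p => complex.Im (f p)).
Proof.
split=> [[mr mi fin]|[[mr fr] [mi fi]]].
  split; split=> //; apply: le_lt_trans fin; apply: ge0_le_integral => //=.
  - by move=> p _; rewrite lee_fin sqr_ge0.
  - by apply/measurable_EFinP; exact: measurable_funX.
  - by apply/measurable_EFinP; apply: measurable_funD; exact: measurable_funX.
  - by move=> p _; rewrite lee_fin /sqmod lerDl sqr_ge0.
  - by move=> p _; rewrite lee_fin sqr_ge0.
  - by apply/measurable_EFinP; exact: measurable_funX.
  - by apply/measurable_EFinP; apply: measurable_funD; exact: measurable_funX.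
  - by move=> p _; rewrite lee_fin /sqmod lerDr sqr_ge0.
split=> //; rewrite /sqmod; under eq_integral do rewrite EFinD.
rewrite ge0_integralD//=; first exact: lte_add_pinfty.
- by move=> p _; rewrite lee_fin sqr_ge0.
- by apply/measurable_EFinP; exact: measurable_funX.
- by move=> p _; rewrite lee_fin sqr_ge0.
- by apply/measurable_EFinP; exact: measurable_funX.
Qed.

Lemma L2_lin (c : C) f g : L2 f -> L2 g -> L2 (c *: f + g).
Proof.
case: c => a b /L2P[fr fi] /L2P[gr gi]; apply/L2P; split.
  rewrite (_ : (fun p => _) = fun p => (a * complex.Re (f p) + (- b) * complex.Im (f p)) +
    complex.Re (g p)).
    by apply: sqintD => //; apply: sqintD; exact: sqintZ.
  by apply/funext => p; rewrite !fctE; case: (f p) (g p) => [? ?] [? ?] /=; ring.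
rewrite (_ : (fun p => _) = fun p => (a * complex.Im (f p) + b * complex.Re (f p)) +
  complex.Im (g p)).
  by apply: sqintD => //; apply: sqintD; exact: sqintZ.
by apply/funext => p; rewrite !fctE; case: (f p) (g p) => [? ?] [? ?] /=; ring.
Qed.

Lemma L2_0 : @L2 R 0.
Proof.
suff z : sq (fun=> 0) by apply/L2P.
split; first exact: measurable_cst.
by rewrite integral0_eq ?ltry// => x _; rewrite expr0n.
Qed.

Lemma L2Z (c : C) f : L2 f -> L2 (c *: f).
Proof. by move=> Lf; rewrite -[X in L2 X]addr0; exact: L2_lin L2_0. Qed.

Lemma L2D f g : L2 f -> L2 g -> L2 (f + g).
Proof. by move=> Lf Lg; rewrite -[f]scale1r; exact: L2_lin. Qed.

Lemma L2B f g : L2 f -> L2 g -> L2 (f - g).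
Proof. by move=> Lf Lg; rewrite addrC -scaleN1r; exact: L2_lin. Qed.

Lemma L2_sum (I : Type) (s : seq I) (a : I -> C) (F : I -> S2 -> C) :
  (forall i, L2 (F i)) -> L2 (\sum_(i <- s) a i *: F i).
Proof.
move=> LF; elim: s => [|i s IH]; first by rewrite big_nil; exact: L2_0.
by rewrite big_cons; exact: L2_lin.
Qed.

Lemma bmeas_L2 u : bmeas u -> L2 (fun p => (u p)%:C).
Proof.
move=> nu; apply/L2P; split.
  by apply: rint_sqint; [case: nu|exact: bmeas_integrable (bmeasX 2 nu)].
by apply: rint_sqint; [exact: measurable_cst|exact: bmeas_integrable (bmeasX 2 (bmeas_cst 0))].
Qed.

Lemma cint_inner f g : L2 f -> L2 g -> cint surf (fun p => f p * (g p)^*).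
Proof.
move=> /L2P[fr fi] /L2P[gr gi]; split.
  rewrite (_ : (fun x => _) = fun p => complex.Re (f p) * complex.Re (g p)
      + complex.Im (f p) * complex.Im (g p)).
    by apply: rintD; exact: sqintM.
  by apply/funext => p; case: (f p) (g p) => [? ?] [? ?] /=; ring.
rewrite (_ : (fun x => _) = fun p => complex.Im (f p) * complex.Re (g p)
    - complex.Re (f p) * complex.Im (g p)).
  by apply: rintB; exact: sqintM.
by apply/funext => p; case: (f p) (g p) => [? ?] [? ?] /=; ring.
Qed.

Lemma inner_linl (c : C) f g h : L2 f -> L2 g -> L2 h ->
  inner (c *: f + g) h = c * inner f h + inner g h.
Proof.
move=> Lf Lg Lh; rewrite /inner -cintegralP; try exact: cint_inner.
by congr cintegral; apply/funext => p; rewrite !fctE mulrDl mulrA.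
Qed.

Lemma inner_conj f g : L2 f -> L2 g -> inner g f = (inner f g)^*%R.
Proof.
move=> Lf Lg; have [_ ic] := cint_inner Lf Lg.
rewrite /inner /cintegral -[RHS]/(_ -i* _); congr (_ +i* _).
  by congr fine; apply: eq_integral => p _; case: (f p) (g p) => [? ?] [? ?] /=; congr EFin; ring.
rewrite -mulN1r -RintegralZl//; congr fine; apply: eq_integral => p _.
by case: (f p) (g p) => [? ?] [? ?] /=; congr EFin; ring.
Qed.

Lemma inner_linr (c : C) f g h : L2 f -> L2 g -> L2 h ->
  inner h (c *: f + g) = c^* * inner h f + inner h g.
Proof.
move=> Lf Lg Lh; rewrite inner_conj//; last exact: L2_lin.
by rewrite inner_linl// rmorphD rmorphM /= -!inner_conj.
Qed.

Lemma inner0l f : L2 f -> inner 0 f = 0.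
Proof.
move=> Lf; have := inner_linl 1 L2_0 L2_0 Lf.
by rewrite scale1r addr0 mul1r => /eqP; rewrite -subr_eq0 opprD addNKr oppr_eq0 => /eqP.
Qed.

Lemma innerZl (c : C) f g : L2 f -> L2 g -> inner (c *: f) g = c * inner f g.
Proof.
by move=> Lf Lg; rewrite -[_ *: _]addr0 inner_linl ?inner0l ?addr0//; exact: L2_0.
Qed.

Lemma innerBl f g h : L2 f -> L2 g -> L2 h -> inner (f - g) h = inner f h - inner g h.
Proof.
by move=> Lf Lg Lh; rewrite addrC -scaleN1r inner_linl// mulN1r addrC.
Qed.

Lemma inner_suml (I : Type) (s : seq I) (a : I -> C) (F : I -> S2 -> C) g :
  (forall i, L2 (F i)) -> L2 g ->
  inner (\sum_(i <- s) a i *: F i) g = \sum_(i <- s) a i * inner (F i) g.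
Proof.
move=> LF Lg; elim: s => [|i s IH]; first by rewrite !big_nil inner0l.
by rewrite !big_cons inner_linl ?IH//; exact: L2_sum.
Qed.

Lemma L2norm_sqr f : L2norm f ^+ 2 = complex.Re (inner f f).
Proof.
rewrite /L2norm sqr_sqrtr; last by apply: Rintegral_ge0 => p _; rewrite addr_ge0 ?sqr_ge0.
congr fine; apply: eq_integral => p _; congr EFin.
by rewrite /sqmod; case: (f p) => a b /=; ring.
Qed.

Lemma inner_real (u v : S2 -> R) :
  inner (fun p => (u p)%:C) (fun p => (v p)%:C) = (\int[surf]_p (u p * v p))%:C.
Proof.
rewrite /inner /cintegral; congr (_ +i* _).
  by congr fine; apply: eq_integral => p _ /=; congr EFin; ring.
by rewrite /Rintegral integral0_eq// => p _ /=; congr EFin; ring.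
Qed.

(** The covariance operator is linear only up to null sets, and this lets inner
    products ignore them. *)
Lemma ae_inner f f' g : L2 f -> L2 f' -> L2 g -> f = f' %[ae surf] ->
  inner f g = inner f' g.
Proof.
move=> Lf Lf' Lg ff'; have [r i] := cint_inner Lf Lg; have [r' i'] := cint_inner Lf' Lg.
rewrite /inner /cintegral; congr (_ +i* _); congr fine; apply: ae_eq_integral => //.
- exact: measurable_int r.
- exact: measurable_int r'.
- by apply: filterS ff' => p E _; rewrite E.
- exact: measurable_int i.
- exact: measurable_int i'.
- by apply: filterS ff' => p E _; rewrite E.
Qed.

Definition VL2 V := forall j, L2 (fun p => V p 0 j).

Lemma vinnerE V W : VL2 V -> VL2 W ->
  vinner V W = \sum_j inner (fun p => V p 0 j) (fun p => W p 0 j).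
Proof.
move=> LV LW; have c j := cint_inner (LV j) (LW j).
have c1 := @cintP _ _ _ _ 1 _ _ (c 0) (c 1).
rewrite sum_ord3 -[inner _ _]mul1r -[X in X + _]mul1r -!cintegralP//.
by congr cintegral; apply/funext => p; rewrite sum_ord3 !mul1r.
Qed.

Lemma vL2norm_sqr V : vL2norm V ^+ 2 = complex.Re (vinner V V).
Proof.
rewrite /vL2norm sqr_sqrtr; last first.
  by apply: Rintegral_ge0 => p _; apply: sumr_ge0 => j _; rewrite addr_ge0 ?sqr_ge0.
congr fine; apply: eq_integral => p _; congr EFin.
rewrite !sum_ord3 /sqmod; case: (V p 0 0) (V p 0 1) (V p 0 2%:R) => [a b] [a' b'] [a2 b2] /=; ring.
Qed.

Lemma vsum_coord (I : Type) (s : seq I) (a : I -> C) (F : I -> S2 -> 'rV[C]_3) j :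
  (fun p => (\sum_(i <- s) a i *: F i) p 0 j) =
  \sum_(i <- s) a i *: (fun p => F i p 0 j).
Proof.
apply/funext => p; elim: s => [|i s IH]; first by rewrite !big_nil /= mxE.
by rewrite !big_cons !fctE !mxE IH.
Qed.

Lemma VL2_sum (I : Type) (s : seq I) (a : I -> C) (F : I -> S2 -> 'rV[C]_3) :
  (forall i, VL2 (F i)) -> VL2 (\sum_(i <- s) a i *: F i).
Proof.
by move=> LF j; rewrite vsum_coord; apply: L2_sum => i; exact: LF.
Qed.

Lemma vinner_suml (I : Type) (s : seq I) (a : I -> C) (F : I -> S2 -> 'rV[C]_3) W :
  (forall i, VL2 (F i)) -> VL2 W ->
  vinner (\sum_(i <- s) a i *: F i) W = \sum_(i <- s) a i * vinner (F i) W.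
Proof.
move=> LF LW; rewrite vinnerE//; last exact: VL2_sum.
under [RHS]eq_bigr => i _ do rewrite vinnerE// mulr_sumr.
rewrite exchange_big; apply: eq_bigr => j _ /=.
by rewrite vsum_coord inner_suml// => i; exact: LF.
Qed.

Lemma vinner_conj V W : VL2 V -> VL2 W -> vinner W V = (vinner V W)^*%R.
Proof.
move=> LV LW; rewrite !vinnerE// rmorph_sum.
by apply: eq_bigr => j _; rewrite inner_conj.
Qed.
End inner_product.

(** * The scheme in coordinates *)

Section truncated_operators.
Local Open Scope complex_scope.
Variable R : realType.
Local Notation C := R[i].
Local Notation S2 := (sphere R).
Local Notation mode_index := (nat * int)%type.
Implicit Types (f g : S2 -> C) (i j : mode_index) (c : mode_index -> C).

(** One list of indices [(l, m)] turns the double sums over degree and order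
    into single sums. *)
Definition modes (a b : nat) : seq mode_index :=
  [seq (l, (k%:Z - l%:Z)) | l <- index_iota a b, k <- iota 0 l.*2.+1].

Lemma sum_modes (A : nmodType) a b (F : nat -> int -> A) :
  \sum_(a <= l < b) sum_order l (F l) = \sum_(i <- modes a b) F i.1 i.2.
Proof.
rewrite big_allpairs_dep; apply: eq_bigr => l _.
rewrite /sum_order -(big_mkord xpredT (fun k => F l (k%:Z - l%:Z))).
by rewrite /index_iota subn0.
Qed.

Lemma modesP a b i : (i \in modes a b) = (a <= i.1 < b)%N && (`|i.2| <= i.1)%N.
Proof.
apply/allpairsPdep/andP => [[l [k [lab kl ->]]]|[ab il]] /=.
  by rewrite mem_index_iota in lab; rewrite mem_iota in kl; split=> //; lia.
exists i.1, (absz (i.2 + i.1%:Z)); split; first by rewrite mem_index_iota.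
  by rewrite inE mem_iota; lia.
by case: i il {ab} => l m /= il; congr pair; lia.
Qed.

Lemma modes_uniq a b : uniq (modes a b).
Proof.
apply: allpairs_uniq_dep; first exact: iota_uniq.
  by move=> l _; exact: iota_uniq.
move=> [l k] [l' k'] _ _ /= [-> /eqP]; rewrite (inj_eq (addIr _)) => /eqP [->] //.
Qed.

Definition Ymode i : S2 -> C := Y i.1 i.2.
Definition grad_mode i (q : S2) : 'rV[C]_3 := \row_k (grady i.1 i.2 k q)%:C.

Lemma Ymode_L2 i : L2 (Ymode i).
Proof. by rewrite /Ymode YE; apply: bmeas_L2; exact: bmeas_yreal. Qed.

Lemma inner_Ymode a b i j : i \in modes a b -> j \in modes a b ->
  inner (Ymode i) (Ymode j) = (i == j)%:R.
Proof.
rewrite !modesP => /andP[_ im] /andP[_ jm].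
rewrite /Ymode !YE inner_real yreal_orthonormal// -xpair_eqE -!surjective_pairing.
by rewrite rmorph_nat.
Qed.

Variable kappa : nat.
Local Notation s := (modes 0 kappa.+1).

Definition comb c : S2 -> C := \sum_(i <- s) c i *: Ymode i.

Lemma eq_comb c c' : {in s, c =1 c'} -> comb c = comb c'.
Proof.
by move=> cc; rewrite /comb !big_seq; apply: eq_bigr => i si; rewrite cc.
Qed.

Lemma comb_L2 c : L2 (comb c).
Proof. by apply: L2_sum => i; exact: Ymode_L2. Qed.

Lemma sum_delta (F : mode_index -> C) j : j \in s ->
  \sum_(i <- s) F i * (i == j)%:R = F j.
Proof.
move=> js; rewrite (bigD1_seq j js (modes_uniq _ _)) eqxx mulr1 big1 => [|i /negbTE ->].
  exact: addr0.
by rewrite mulr0.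
Qed.

Lemma inner_comb c j : j \in s -> inner (comb c) (Ymode j) = c j.
Proof.
move=> js; rewrite inner_suml; [|exact: Ymode_L2|exact: Ymode_L2].
rewrite -[RHS](sum_delta c js) big_seq [RHS]big_seq.
by apply: eq_bigr => i si; rewrite (inner_Ymode si js).
Qed.

Lemma comb_inj c c' : comb c = comb c' -> {in s, c =1 c'}.
Proof. by move=> cc i si; rewrite -inner_comb// cc inner_comb. Qed.

Lemma sum_sqmod (F : mode_index -> C) (r : seq mode_index) :
  complex.Re (\sum_(i <- r) F i * (F i)^*%R) = \sum_(i <- r) sqmod (F i).
Proof.
elim: r => [|i r IH]; first by rewrite !big_nil.
rewrite !big_cons -IH /sqmod; case: (F i) (\sum_(_ <- _) _) => [u v] [x y] /=; ring.
Qed.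

Lemma comb_norm c : L2norm (comb c) ^+ 2 = \sum_(i <- s) sqmod (c i).
Proof.
rewrite L2norm_sqr inner_suml; [|exact: Ymode_L2|exact: comb_L2].
rewrite -sum_sqmod; congr complex.Re; rewrite !big_seq; apply: eq_bigr => i si.
by rewrite inner_conj ?inner_comb//; [exact: comb_L2|exact: Ymode_L2].
Qed.

Lemma combP (a : C) c c' : a *: comb c + comb c' = comb (fun i => a * c i + c' i).
Proof.
rewrite /comb scaler_sumr -big_split /=; apply: eq_bigr => i _.
by rewrite scalerDl scalerA.
Qed.

Lemma projkE f : projk kappa f = comb (fun i => inner f (Ymode i)).
Proof. by rewrite /projk (sum_modes _ _ (fun l m => inner f (Y l m) *: Y l m)). Qed.

Lemma HkE f : Hk kappa f <-> exists c, f = comb c.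
Proof.
split=> [[c ->]|[c ->]].
  by exists (fun i => c i.1 i.2); rewrite (sum_modes _ _ (fun l m => c l m *: Y l m)).
exists (fun l m => c (l, m)); rewrite (sum_modes _ _ (fun l m => c (l, m) *: Y l m)).
by apply: eq_bigr => -[].
Qed.

Lemma surface_deriv_comb c : surface_deriv (comb c)
  (\sum_(i <- s) c i *: grad_mode i) (comb (fun i => - (lambda R i.1)%:C * c i)).
Proof.
rewrite /comb; elim: (s) => [|i r IH]; first by rewrite !big_nil; exact: surface_deriv0.
rewrite !big_cons.
have := surface_deriv_lin (c i) (surface_deriv_Y R i.1 i.2) IH.
congr surface_deriv; congr (_ + _); apply/funext => q.
rewrite -[LHS]/(c i * (- (lambda R i.1)%:C * Y i.1 i.2 q)) mulrA.
by rewrite [c i * _]mulrC.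
Qed.

Lemma laplace_comb c : laplace_beltrami (comb c) = comb (fun i => - (lambda R i.1)%:C * c i).
Proof. by have [_ ->] := surface_derivE (surface_deriv_comb c). Qed.

Variable tau : R.

(** The eigenvalue of [I + i tau Delta] on mode [i]. *)
Definition symbol i : C := 1 - ((0 +i* 1) * tau%:C) * (lambda R i.1)%:C.

(** Its real part is [1]. *)
Lemma symbol_neq0 i : symbol i != 0.
Proof.
apply/eqP => /(congr1 (@complex.Re R)) /= /eqP.
by rewrite !(mul0r, mul1r, mulr0, subr0, oppr0, addr0) oner_eq0.
Qed.

(** The symbols do not vanish, so the operator is injective on [Hk] and the
    partial inverse is a true inverse there. *)
Lemma resolvent_comb c : resolvent kappa tau (comb c) = comb (fun i => (symbol i)^-1 * c i).
Proof.
set T := fun f : S2 -> C => f + ((0 +i* 1) * tau%:C) *: laplace_beltrami f.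
have TE c' : T (comb c') = comb (fun i => symbol i * c' i).
  rewrite /T laplace_comb addrC combP; apply: eq_comb => i _ /=.
  by rewrite /symbol mulrBl mul1r addrC mulNr mulrN mulrA.
have Tinj : {in Hk kappa &, injective T}.
  move=> f g /set_mem/HkE[c1 ->] /set_mem/HkE[c2 ->]; rewrite !TE => E.
  apply: eq_comb => i si; have := comb_inj E si.
  by move/(mulfI (symbol_neq0 i)).
rewrite (_ : comb c = T (comb (fun i => (symbol i)^-1 * c i))); last first.
  by rewrite TE; apply: eq_comb => i _; rewrite mulrA mulfV ?mul1r// symbol_neq0.
by rewrite /resolvent -/T pinvKV//; apply/mem_set/HkE; exists (fun i => (symbol i)^-1 * c i).
Qed.

(** The scheme as seen by the [i]-th Fourier coefficient. *)
Fixpoint mode_coef (u0 : S2 -> C) (L : R -> S2 -> C) (n : nat) i : C :=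
  if n is k.+1 then
    (symbol i)^-1 * (mode_coef u0 L k i
      - (0 +i* 1) * inner (L (k.+1%:R * tau) - L (k%:R * tau)) (Ymode i))
  else inner u0 (Ymode i).

Lemma backward_EM_comb u0 L n : backward_EM kappa tau u0 L n = comb (mode_coef u0 L n).
Proof.
elim: n => [|n IH] /=; first exact: projkE.
rewrite IH projkE addrC -scaleNr combP resolvent_comb.
by apply: eq_comb => i _; congr (_ * _); rewrite addrC mulNr.
Qed.

Definition rot_mode i (q : S2) : 'rV[C]_3 := \row_k (rotgrad i.1 i.2 k q)%:C.

Lemma grad_mode_VL2 i : VL2 (grad_mode i).
Proof.
move=> j; rewrite (_ : (fun p => _) = fun p => (grady i.1 i.2 j p)%:C).
  by apply: bmeas_L2; exact: bmeas_grady.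
by apply/funext => p; rewrite mxE.
Qed.

Lemma rot_mode_VL2 i : VL2 (rot_mode i).
Proof.
move=> j; rewrite (_ : (fun p => _) = fun p => (rotgrad i.1 i.2 j p)%:C).
  by apply: bmeas_L2; exact: bmeas_rotgrad.
by apply/funext => p; rewrite mxE.
Qed.

Lemma vinner_real (u v : 'I_3 -> S2 -> R) : (forall k, bmeas (u k)) -> (forall k, bmeas (v k)) ->
  vinner (fun q => \row_k (u k q)%:C) (fun q => \row_k (v k q)%:C) =
  (\int[surf]_q (\sum_k u k q * v k q))%:C.
Proof.
move=> nu nv; rewrite vinnerE; last 2 first.
- move=> j; rewrite (_ : (fun p => _) = fun p => (u j p)%:C); first exact: bmeas_L2.
  by apply/funext => p; rewrite mxE.
- move=> j; rewrite (_ : (fun p => _) = fun p => (v j p)%:C); first exact: bmeas_L2.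
  by apply/funext => p; rewrite mxE.
have nuv k := bmeas_integrable (bmeasM (nu k) (nv k)).
rewrite (_ : \int[surf]_q _ = \sum_k \int[surf]_q (u k q * v k q)); last first.
  rewrite sum_ord3 -RintegralD// -RintegralD//; last first.
    exact: (rintD (nuv 0) (nuv 1)).
  by congr fine; apply: eq_integral => q _; rewrite sum_ord3.
rewrite rmorph_sum /=; apply: eq_bigr => j _; rewrite -inner_real.
by congr inner; apply/funext => p; rewrite mxE.
Qed.

Lemma vinner_grad_mode a b i j : i \in modes a b -> j \in modes a b ->
  vinner (grad_mode i) (grad_mode j) = (lambda R i.1)%:C * (i == j)%:R.
Proof.
rewrite !modesP => /andP[_ im] /andP[_ jm].
rewrite vinner_real; [|by move=> k; exact: bmeas_grady|by move=> k; exact: bmeas_grady].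
rewrite Rintegral_grad yreal_orthonormal// -xpair_eqE -!surjective_pairing.
by rewrite rmorphM; congr (_ * _); exact: rmorph_nat.
Qed.

Lemma vinner_grad_rot i j : vinner (grad_mode i) (rot_mode j) = 0.
Proof.
rewrite vinner_real; [|by move=> k; exact: bmeas_grady|by move=> k; exact: bmeas_rotgrad].
by rewrite Rintegral_rotgrad.
Qed.

Lemma vinnerZr (a : C) (V W : S2 -> 'rV[C]_3) : VL2 V -> VL2 W ->
  vinner V (a *: W) = (a)^*%R * vinner V W.
Proof.
move=> LV LW; have LaW : VL2 (a *: W).
  move=> j; rewrite (_ : (fun p => _) = a *: (fun p => W p 0 j)); first exact: L2Z.
  by apply/funext => p; rewrite !fctE mxE.
rewrite vinner_conj// [vinner V W]vinner_conj// -rmorphM /=; congr (_^*%R).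
rewrite !vinnerE// mulr_sumr; apply: eq_bigr => j _.
rewrite -innerZl//; congr inner; apply/funext => p; by rewrite !fctE mxE.
Qed.

Lemma sgrad_Y l m : sgrad (Y l m) = grad_mode (l, m).
Proof. by have [->] := surface_derivE (surface_deriv_Y R l m). Qed.

Lemma PhiVE l m : PhiV l m = ((Num.sqrt (lambda R l))^-1)%:C *: grad_mode (l, m).
Proof. by apply/funext => q; rewrite /PhiV sgrad_Y. Qed.

Lemma PsiVE l m : PsiV l m = ((Num.sqrt (lambda R l))^-1)%:C *: rot_mode (l, m).
Proof.
apply/funext => q; rewrite /PsiV sgrad_Y; congr (_ *: _).
apply/rowP => j; rewrite !mxE /rotgrad.
by rewrite -!rmorphM -rmorphB.
Qed.

(** Gradients have no component on the rotated gradients, and their component on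
    [PhiV l m] is [sqrt lambda] times the coefficient, so the projection keeps
    every mode up to [kappa].  Degree [0] drops out since constants have zero
    gradient. *)
Lemma sgradk_comb c : sgradk kappa (comb c) = \sum_(i <- modes 1 kappa.+1) c i *: grad_mode i.
Proof.
rewrite /sgradk; have [-> _] := surface_derivE (surface_deriv_comb c).
rewrite /vproj; set V := \sum_(i <- s) _.
rewrite (sum_modes _ _ (fun l m => vinner V (PhiV l m) *: PhiV l m + vinner V (PsiV l m) *:
  PsiV l m)).
rewrite big_seq [RHS]big_seq; apply: eq_bigr => j js.
have js0 : j \in s by move: js; rewrite !modesP => /andP[/andP[_ ->] ->].
have gV := fun i => grad_mode_VL2 i.
have LV : VL2 V by exact: VL2_sum.
rewrite PhiVE PsiVE -surjective_pairing !vinnerZr//; last exact: rot_mode_VL2.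
have -> : vinner V (rot_mode j) = 0.
  rewrite vinner_suml//; last exact: rot_mode_VL2.
  by rewrite big1// => i _; rewrite vinner_grad_rot mulr0.
have -> : vinner V (grad_mode j) = (lambda R j.1)%:C * c j.
  rewrite vinner_suml// -[RHS](sum_delta (fun i => (lambda R i.1)%:C * c i) js0).
  rewrite big_seq [RHS]big_seq; apply: eq_bigr => i si.
  by rewrite (vinner_grad_mode si js0) mulrCA mulrA.
rewrite mulr0 scale0r addr0 scalerA; congr (_ *: _).
have l0 : 0 < lambda R j.1.
  by move: js; rewrite modesP => /andP[/andP[+ _] _]; rewrite /lambda ltr0n muln_gt0 andbT.
set a := (Num.sqrt _)^-1; have -> : (a%:C)^*%R = a%:C by exact: conjc_real.
have aE : a * a * lambda R j.1 = 1.
  by rewrite -expr2 exprVn sqr_sqrtr ?ltW// mulVf// gt_eqF.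
transitivity ((a * a * lambda R j.1)%:C * c j); last by rewrite aE mul1r.
by rewrite !rmorphM /=; ring.
Qed.

Lemma sub_modes i : i \in modes 1 kappa.+1 -> i \in s.
Proof. by rewrite !modesP => /andP[/andP[_ ->] ->]. Qed.

Lemma sum_lambda (F : mode_index -> R) :
  \sum_(i <- s) lambda R i.1 * F i = \sum_(i <- modes 1 kappa.+1) lambda R i.1 * F i.
Proof.
have E a b : \sum_(i <- modes a b) lambda R i.1 * F i =
    \sum_(a <= l < b) sum_order l (fun m => lambda R l * F (l, m)).
  by rewrite (sum_modes a b (fun l m => lambda R l * F (l, m))); apply: eq_bigr => -[].
rewrite !E.
rewrite big_ltn// [X in X + _](_ : _ = 0) ?add0r//.
by rewrite /sum_order big1// => k _; rewrite /lambda mul0r.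
Qed.

Lemma energy_comb c : vL2norm (sgradk kappa (comb c)) ^+ 2 =
  \sum_(i <- s) lambda R i.1 * sqmod (c i).
Proof.
rewrite vL2norm_sqr sgradk_comb; set r := modes 1 _.
have gV := fun i => grad_mode_VL2 i.
have LV : VL2 (\sum_(i <- r) c i *: grad_mode i) by exact: VL2_sum.
rewrite vinner_suml// sum_lambda -/r.
have E j : j \in r -> vinner (grad_mode j) (\sum_(i <- r) c i *: grad_mode i) =
    (lambda R j.1)%:C * (c j)^*%R.
  move=> jr; have js := sub_modes jr.
  rewrite vinner_conj// vinner_suml//.
  have -> : \sum_(i <- r) c i * vinner (grad_mode i) (grad_mode j) = (lambda R j.1)%:C * c j.
    rewrite (bigD1_seq j jr (modes_uniq _ _)) (vinner_grad_mode js js) eqxx mulr1.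
    rewrite big_seq_cond big1 => [|i /andP[ir /negbTE ij]].
      by rewrite [LHS]addr0 mulrC.
    by rewrite (vinner_grad_mode (sub_modes ir) js) ij !mulr0.
  by rewrite rmorphM /=; congr (_ * _); exact: conjc_real.
rewrite (eq_big_seq (fun i => (lambda R i.1)%:C * (c i * (c i)^*%R))); last first.
  by move=> i ir; rewrite E// mulrCA.
elim: (r) => [|i r' IH]; first by rewrite !big_nil.
rewrite !big_cons -IH /sqmod; case: (c i) (\sum_(_ <- _) _) => [u v] [x y] /=; ring.
Qed.
End truncated_operators.

(** * Traces of the covariance *)

Section traces.
Local Open Scope complex_scope.
Variables (R : realType) (Q : (sphere R -> R[i]) -> (sphere R -> R[i])).
Hypothesis covQ : covariance_operator Q.
Variable kappa : nat.
Local Notation C := R[i].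
Local Notation S2 := (sphere R).
Local Notation s := (modes 0 kappa.+1).
Implicit Types (f g : S2 -> C) (i j : nat * int).

Definition cov_mode i : R := complex.Re (inner (Q (@Ymode R i)) (@Ymode R i)).

Let LQ f : L2 f -> L2 (Q f). Proof. exact: cov_L2 covQ f. Qed.

Lemma cov_mode_ge0 i : 0 <= cov_mode i.
Proof.
have := cov_ge0 covQ (Ymode_L2 R i); rewrite /cov_mode.
by case: (inner _ _) => a b /andP[].
Qed.

(** Linearity almost everywhere makes [Q 0] a null function, though possibly not
    the zero function. *)
Lemma inner_Q0 g : L2 g -> inner (Q 0) g = 0.
Proof.
move=> Lg; have := cov_linear covQ 1 (L2_0 R) (L2_0 R).
rewrite !scale1r addr0 => Q00.
have LQ0 := LQ (L2_0 R).
have := ae_inner LQ0 (L2D LQ0 LQ0) Lg Q00.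
rewrite -{2}[Q 0]scale1r inner_linl// mul1r => /eqP.
by rewrite eq_sym -subr_eq0 addrK => /eqP.
Qed.

Lemma inner_QZ (a : C) f g : L2 f -> L2 g -> inner (Q (a *: f)) g = a * inner (Q f) g.
Proof.
move=> Lf Lg; have := cov_linear covQ a Lf (L2_0 R); rewrite addr0 => E.
rewrite (ae_inner _ _ Lg E) ?inner_linl ?inner_Q0 ?addr0//; try exact: LQ.
- exact: LQ (L2_0 R).
- by apply: LQ; exact: L2Z.
- by apply: L2_lin; apply: LQ => //; exact: L2_0.
Qed.

Lemma projk_Ymode i : i \in s -> projk kappa (@Ymode R i) = @Ymode R i.
Proof.
move=> si; rewrite projkE /comb (bigD1_seq i si (modes_uniq _ _)) (inner_Ymode R si si)
  eqxx scale1r.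
rewrite big_seq_cond big1 => [|j /andP[js ij]]; first exact: addr0.
by rewrite (inner_Ymode R si js) eq_sym (negbTE ij) scale0r.
Qed.

Lemma projkZ (a : C) f : L2 f -> projk kappa (a *: f) = a *: projk kappa f.
Proof.
move=> Lf; rewrite !projkE /comb scaler_sumr; apply: eq_bigr => j _.
by rewrite innerZl ?scalerA//; exact: Ymode_L2.
Qed.

Lemma inner_projk f i : i \in s -> inner (projk kappa f) (@Ymode R i) = inner f (@Ymode R i).
Proof. by move=> si; rewrite projkE inner_comb. Qed.

Lemma inner_truncate i : i \in s ->
  inner (truncate kappa Q (@Ymode R i)) (@Ymode R i) = inner (Q (@Ymode R i)) (@Ymode R i).
Proof. by move=> si; rewrite /truncate /= projk_Ymode// inner_projk. Qed.

(** The diagonal blocks of degree above [kappa] vanish, because [Q] is applied to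
    a projection equal to [0]; the inequality is what the estimate of the mass
    consumes. *)
Lemma trace_truncate_ge :
  ((\sum_(i <- s) cov_mode i)%:E <= trace (truncate kappa Q))%E.
Proof.
pose u (l : nat) : R := sum_order l (fun m => complex.Re (inner (truncate kappa Q (Y l m))
  (Y l m))).
have uE l : (l < kappa.+1)%N -> u l = sum_order l (fun m => cov_mode (l, m)).
  move=> lk; apply: eq_bigr => k _; rewrite -[Y _ _]/(@Ymode R (l, k%:Z - l%:Z)).
  by rewrite inner_truncate// modesP /=; case: k => k /= kl; lia.
have u0 l : (kappa.+1 <= l)%N -> u l = 0.
  move=> kl; rewrite /u /sum_order big1// => k _.
  rewrite -[Y _ _]/(@Ymode R (l, k%:Z - l%:Z)).
  rewrite -[truncate _ _ _]/(projk kappa (Q (projk kappa (Ymode (l, k%:Z - l%:Z))))).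
  have p0 : projk kappa (@Ymode R (l, k%:Z - l%:Z)) = 0.
    rewrite projkE /comb big_seq big1// => j js.
    have m1 : j \in modes 0 l.+1.
      by move: js; rewrite !modesP => /andP[/andP[_ h] ->]; rewrite andbT /=; lia.
    have m2 : (l, k%:Z - l%:Z) \in modes 0 l.+1.
      by rewrite modesP /=; case: k => k /= h; lia.
    rewrite (inner_Ymode R m2 m1) [_ == j](_ : _ = false) ?scale0r//.
    apply/eqP => E; move: js; rewrite -E modesP /= => /andP[h _]; lia.
  have c0 : projk kappa (Q 0) = 0.
    rewrite projkE /comb big1// => j _; rewrite inner_Q0 ?scale0r//; exact: Ymode_L2.
  by rewrite p0 c0 inner0l//; exact: Ymode_L2.
have u_ge0 l : (0 <= (u l)%:E)%E.
  rewrite lee_fin; have [lk|kl] := ltnP l kappa.+1; last by rewrite u0.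
  by rewrite uE//; apply: sumr_ge0 => k _; exact: cov_mode_ge0.
apply: (@le_trans _ _ (\sum_(0 <= l < kappa.+1) (u l)%:E)%E).
  rewrite sumEFin lee_fin (eq_big_nat _ _ (fun l h => uE l (proj2 (andP h)))).
  rewrite (sum_modes 0 kappa.+1 (fun l m => cov_mode (l, m))).
  by apply: ler_sum => -[l m].
by apply: nneseries_lim_ge => l _ _; exact: u_ge0.
Qed.

Lemma tracek_energy :
  tracek kappa (truncate kappa Q \o (fun f => - laplace_beltrami f)%R) =
  \sum_(i <- s) lambda R i.1 * cov_mode i.
Proof.
rewrite /tracek (sum_modes 0 kappa.+1 (fun l m => complex.Re (inner
  ((truncate kappa Q \o (fun f => - laplace_beltrami f)%R) (Y l m)) (Y l m)))).
rewrite !big_seq; apply: eq_bigr => i si; rewrite -[Y _ _]/(@Ymode R i).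
rewrite -[(_ \o _) _]/(projk kappa (Q (projk kappa (- laplace_beltrami (Ymode i))))).
have [_ ->] := surface_derivE (surface_deriv_Y R i.1 i.2).
rewrite (_ : - _ = (lambda R i.1)%:C *: @Ymode R i); last first.
  by apply/funext => q; rewrite -[LHS]/(- (- _ * _)) mulNr opprK.
rewrite projkZ ?projk_Ymode//; last exact: Ymode_L2.
rewrite inner_projk// inner_QZ; [|exact: Ymode_L2|exact: Ymode_L2].
rewrite /cov_mode; case: (inner _ _) => a b /=; ring.
Qed.
End traces.

(** * Products of independent variables *)

Section independence.
Local Open Scope complex_scope.
Context d (Omega : measurableType d) (R : realType) (P : probability Omega R).
Implicit Types (X Z : Omega -> R).

Lemma sqint_integrable X : sqint P X -> rint P X.
Proof.
move=> sX; apply: (@le_rint _ _ _ _ _ (fun x => 1 + X x ^+ 2)); first by case: sX.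
  move=> x; rewrite [leRHS]ger0_norm ?addr_ge0 ?sqr_ge0//.
  rewrite -(real_normK (num_real (X x))).
  have := sqr_ge0 (`|X x| - 1); have := normr_ge0 (X x).
  rewrite sqrrB expr1n mulr1; lra.
apply: rintD; last exact: sqint_rint.
by apply: finite_measure_integrable_cst.
Qed.

(** Independence makes the joint law a product measure, to which Fubini's theorem
    applies. *)
Lemma indep_RintegralM X Z : sqint P X -> sqint P Z ->
  (forall A B : set R, measurable A -> measurable B ->
    (P (X @^-1` A `&` Z @^-1` B) = P (X @^-1` A) * P (Z @^-1` B))%E) ->
  \int[P]_w (X w * Z w) = \int[P]_w X w * \int[P]_w Z w.
Proof.
move=> sX sZ ind.
have [mX _] := sX; have [mZ _] := sZ.
have iX := sqint_integrable sX; have iZ := sqint_integrable sZ.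
have iXZ := sqintM sX sZ.
have mXZ : measurable_fun setT (fun w => (X w, Z w)) by exact: measurable_fun_pair.
pose X' : {mfun Omega >-> R} := HB.pack X (isMeasurableFun.Build _ _ _ _ _ mX).
pose Z' : {mfun Omega >-> R} := HB.pack Z (isMeasurableFun.Build _ _ _ _ _ mZ).
pose W : {mfun Omega >-> (R * R)%type} := HB.pack (fun w => (X w, Z w))
  (isMeasurableFun.Build _ _ _ _ _ mXZ).
pose pX := distribution P X'; pose pZ := distribution P Z'.
pose pW := distribution P W.
have E U : measurable U -> (pX \x pZ)%E U = pW U.
  apply: product_measure_unique => A B mA mB.
  by rewrite /pX /pZ /pW /distribution /pushforward -ind.
have mmul : measurable_fun setT (fun z : R * R => (z.1 * z.2)%:E).
  by apply/measurable_EFinP; apply: measurable_funM.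
have imul : pW.-integrable setT (fun z : R * R => (z.1 * z.2)%:E).
  by apply: integrable_pushforward => //; rewrite preimage_setT.
have imul2 : (pX \x pZ)%E.-integrable setT (fun z : R * R => (z.1 * z.2)%:E).
  move/integrableP : imul => [_ i]; apply/integrableP; split=> //.
  by rewrite (eq_measure_integral pW)// => A mA _; exact: E.
rewrite /Rintegral.
have EX : (\int[pX]_x x%:E = \int[P]_w (X w)%:E)%E.
  exact: (@integral_distribution _ _ _ _ _ P X' EFin).
have EZ : (\int[pZ]_x x%:E = \int[P]_w (Z w)%:E)%E.
  exact: (@integral_distribution _ _ _ _ _ P Z' EFin).
have jX : pX.-integrable setT (@EFin R).
  by apply: integrable_pushforward => //; rewrite preimage_setT.
have jZ : pZ.-integrable setT (@EFin R).
  by apply: integrable_pushforward => //; rewrite preimage_setT.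
rewrite -EX -EZ.
have -> : (\int[P]_w (X w * Z w)%:E = \int[pW]_z (z.1 * z.2)%:E)%E.
  by rewrite (@integral_distribution _ _ _ _ _ P W (fun z => (z.1 * z.2)%:E)).
have -> : (\int[pW]_z (z.1 * z.2)%:E = \int[(pX \x pZ)%E]_z (z.1 * z.2)%:E)%E.
  by apply: eq_measure_integral => A mA _; exact: esym (E _ mA).
rewrite -integral12_prod_meas1// /fubini_F.
under eq_integral => x _.
  under eq_integral => y _ do rewrite /= EFinM.
  rewrite integralZl// -[X in (_ * X)%E]fineK; last exact: integrable_fin_num.
  over.
by rewrite /= integralZr// fineM//; exact: integrable_fin_num.
Qed.
End independence.

(** * Measurability of the Fourier coefficients *)

Section functionals.
Local Open Scope complex_scope.
Variable R : realType.
Local Notation C := R[i].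
Local Notation S2 := (sphere R).
Implicit Types (f g : S2 -> C) (i : nat * int) (b : bool).

(** Real and imaginary parts, selected by a boolean so that one argument serves
    both. *)
Definition part b (z : C) : R := if b then complex.Re z else complex.Im z.

Lemma partB b (z w : C) : part b (z - w) = part b z - part b w.
Proof. by case: b z w => [] [? ?] []. Qed.

Lemma part_le_sqmod b (z : C) : part b z ^+ 2 <= sqmod z.
Proof. by rewrite /sqmod; case: b => /=; rewrite ?lerDl ?lerDr sqr_ge0. Qed.

Definition fmode b i f : R := part b (inner f (Ymode i)).

Lemma fmodeB b i f g : L2 f -> L2 g -> fmode b i (f - g) = fmode b i f - fmode b i g.
Proof.
by move=> Lf Lg; rewrite /fmode innerBl ?partB//; exact: Ymode_L2.
Qed.

(** Split [f] into its component along the mode and an orthogonal remainder. *)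
Lemma bessel i f : (`|i.2| <= i.1)%N -> L2 f -> sqmod (inner f (Ymode i)) <= L2norm f ^+ 2.
Proof.
move=> il Lf; have Le := Ymode_L2 R i.
have im : i \in modes i.1 i.1.+1 by rewrite modesP leqnn ltnSn.
have ee : inner (Ymode i) (@Ymode R i) = 1 by rewrite (inner_Ymode R im im) eqxx.
set a := inner f (Ymode i); pose g := f - a *: Ymode i.
have La := L2Z a Le; have Lg : L2 g by exact: L2B.
have ge : inner g (Ymode i) = 0 by rewrite innerBl// innerZl// ee mulr1 subrr.
have fE : f = a *: Ymode i + g by rewrite /g addrC subrK.
have fg : inner g f = inner g g.
  by rewrite {1}fE inner_linr// ge mulr0 add0r.
have fe : inner (Ymode i) f = a^*%R by rewrite inner_conj.
have := sqr_ge0 (L2norm g); rewrite !L2norm_sqr => g0.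
have -> : inner f f = a * a^*%R + inner g g.
  by rewrite {1}fE inner_linl// fe fg.
move: g0; rewrite /sqmod; case: (inner g g) => x y /=.
by case: (a) => u v /=; lra.
Qed.

(** The sets [B] with this property form a sigma-algebra, and it contains the
    open half-lines because the coefficient is 1-Lipschitz for the L^2 norm. *)
Lemma L2_borel_fmode b i (B : set R) : (`|i.2| <= i.1)%N -> measurable B ->
  L2_borel (@L2 R `&` fmode b i @^-1` B).
Proof.
move=> il; have [s0 sC sU] := smallest_sigma_algebra (@L2 R) (@L2_open R).
suff : measurable `<=` [set B : set R | L2_borel (@L2 R `&` fmode b i @^-1` B)].
  by move=> h /h.
have -> : (measurable : set (set R)) = (@RGenOInfty.G R).-sigma.-measurable.
  exact: (@RGenOInfty.measurableE R).
apply: smallest_sub; first split.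
- by rewrite /= preimage_set0 setI0.
- move=> A /= hA; rewrite setTD preimage_setC.
  rewrite (_ : _ `&` _ = @L2 R `\` (@L2 R `&` fmode b i @^-1` A)); first exact: sC.
  by apply/seteqP; split=> f /= [Lf]; [move=> nA; split=> // -[]|move=> h; split=> // hA';
    exact: h].
- by move=> A hA /=; rewrite preimage_bigcup setI_bigcupr; exact: sU.
move=> _ [x ->] /=; apply: sub_sigma_algebra; split; first by move=> f [].
move=> f [Lf] /=; rewrite in_itv /= andbT => xf.
exists (fmode b i f - x); first by rewrite subr_gt0.
move=> g Lg gf; split=> //=; rewrite in_itv /= andbT.
have : `|fmode b i (g - f)| <= L2norm (g - f).
  rewrite -(@ler_pXn2r _ 2)// ?nnegrE ?sqrtr_ge0// real_normK ?num_real//.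
  by apply: le_trans (part_le_sqmod _ _) _; apply: bessel => //; exact: L2B.
by rewrite fmodeB// ler_norml => /andP[h _]; lra.
Qed.

End functionals.

Section adapted.
Local Open Scope complex_scope.
Context (T : pointedType) (R : realType) (G : set (set T)).
Hypothesis sG : sigma_algebra setT G.
Implicit Types X Z : T -> R.

Definition adapted X := forall B : set R, measurable B -> G (X @^-1` B).

(** Adaptedness is measurability for the sigma-algebra generated by [G], which
    gives access to the arithmetic of measurable functions. *)
Let adaptedP X : adapted X <-> measurable_fun [set: g_sigma_algebraType G] X.
Proof.
have E : <<s G >> = G by exact: sigma_algebra_id.
split=> h; first by move=> _ B mB; rewrite setTI /measurable /= E; exact: h.
by move=> B mB; have := h measurableT _ mB; rewrite setTI /measurable /= E.
Qed.

Lemma adaptedP2 (a b : R) X Z : adapted X -> adapted Z ->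
  adapted (fun w => a * X w + b * Z w).
Proof.
move=> /adaptedP mX /adaptedP mZ; apply/adaptedP.
by apply: measurable_funD; apply: measurable_funM => //; exact: measurable_cst.
Qed.
End adapted.

(** * Coefficients of the noise increments *)

(** Serves to compare the norm of an L^2-valued variable, which is not known to
    be measurable, with its coefficients. *)
Lemma ge0_le_integral_monotone d (T : measurableType d) (R : realType)
    (mu : {measure set T -> \bar R}) (f g : T -> \bar R) :
  (forall x, 0 <= f x)%E -> (forall x, f x <= g x)%E ->
  (\int[mu]_x f x <= \int[mu]_x g x)%E.
Proof.
move=> f0 fg; have g0 x : (0 <= g x)%E by exact: le_trans (fg x).
rewrite !ge0_integralTE//; apply: ge_ereal_sup => _ [h /= hf <-].
by apply: ereal_sup_ubound; exists h => // x; exact: le_trans (fg x).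
Qed.

Section noise.
Local Open Scope complex_scope.
Context (R : realType) d (Omega : measurableType d) (P : probability Omega R).
Variables (F : R -> set (set Omega)) (Q : (sphere R -> R[i]) -> (sphere R -> R[i])).
Variables (L : R -> Omega -> sphere R -> R[i]).
Hypothesis filtF : complete_filtration P F.
Hypothesis levyL : Q_levy_process P F Q L.
Implicit Types (b : bool) (i : nat * int) (r t : R) (X : Omega -> R).

Lemma adapted_measurable r X : 0 <= r -> adapted (F r) X -> measurable_fun setT X.
Proof.
move=> r0 aX _ B mB; rewrite setTI; apply: (filt_sub filtF r0); exact: aX.
Qed.

Lemma adapted_mono r t X : 0 <= r -> r <= t -> adapted (F r) X -> adapted (F t) X.
Proof. by move=> r0 rt aX B mB; apply: (filt_mono filtF r0 rt); exact: aX. Qed.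

Lemma adapted_fmode b i r (V : Omega -> sphere R -> R[i]) : (`|i.2| <= i.1)%N ->
  L2_measurable (F r) V -> adapted (F r) (fun w => fmode b i (V w)).
Proof.
move=> il [VL mV] B mB.
rewrite (_ : _ @^-1` B = V @^-1` (@L2 R `&` fmode b i @^-1` B)).
  by apply: mV; exact: L2_borel_fmode.
by apply/seteqP; split=> w //=; case.
Qed.

Lemma levy_L2 t w : 0 <= t -> L2 (L t w).
Proof. by move=> t0; have [h _] := levy_adapted levyL t0; exact: h. Qed.

Lemma sqint_levy b i t : (`|i.2| <= i.1)%N -> 0 <= t ->
  sqint P (fun w => fmode b i (L t w)).
Proof.
move=> il t0; split.
  apply: (adapted_measurable t0); apply: adapted_fmode => //; exact: levy_adapted levyL _ t0.
have := levy_sqint levyL t0; rewrite unlock; apply: le_lt_trans.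
apply: ge0_le_integral_monotone => w; first by rewrite lee_fin sqr_ge0.
rewrite lee_fin; apply: le_trans (part_le_sqmod _ _) _.
by apply: bessel => //; exact: levy_L2.
Qed.

Lemma levy_second_moment i t : (`|i.2| <= i.1)%N -> 0 <= t ->
  \int[P]_w (fmode true i (L t w) ^+ 2 + fmode false i (L t w) ^+ 2) = t * cov_mode Q i.
Proof.
move=> il t0; have E := levy_cov levyL t0 (Ymode_L2 R i) (Ymode_L2 R i).
have -> : t * cov_mode Q i = complex.Re (t%:C * inner (Q (Ymode i)) (Ymode i)).
  by rewrite /cov_mode; case: (inner _ _) => a c /=; rewrite mul0r subr0.
rewrite -E; congr fine; apply: eq_integral => w _; congr EFin.
by rewrite /fmode /part; case: (inner _ _) => a c /=; ring.
Qed.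

Lemma levy_mean b i t : 0 <= t -> \int[P]_w fmode b i (L t w) = 0.
Proof.
move=> t0; have := levy_mean0 levyL t0 (Ymode_L2 R i); rewrite /cexpectation /cintegral.
by move=> [h1 h2]; case: b; [exact: h1|exact: h2].
Qed.

Definition incr b i r t (w : Omega) : R := fmode b i (L t w - L r w).

Lemma incrE b i r t : 0 <= r -> r <= t ->
  incr b i r t = fun w => fmode b i (L t w) + - 1 * fmode b i (L r w).
Proof.
move=> r0 rt; apply/funext => w; rewrite /incr fmodeB ?mulN1r//; apply: levy_L2 => //.
exact: le_trans rt.
Qed.

Lemma sqint_incr b i r t : (`|i.2| <= i.1)%N -> 0 <= r -> r <= t -> sqint P (incr b i r t).
Proof.
move=> il r0 rt; rewrite incrE//; apply: sqintD; first exact/sqint_levy/(le_trans r0).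
by apply: sqintZ; exact: sqint_levy.
Qed.

Lemma incr_mean b i r t : (`|i.2| <= i.1)%N -> 0 <= r -> r <= t ->
  \int[P]_w incr b i r t w = 0.
Proof.
move=> il r0 rt; rewrite incrE//.
have s1 := sqint_integrable (sqint_levy b il (le_trans r0 rt)).
have s2 := sqint_integrable (sqint_levy b il r0).
rewrite RintegralD//; last exact: (rintZ (-1) s2).
by rewrite RintegralZl// !levy_mean// ?mulr0 ?addr0//; exact: le_trans rt.
Qed.

(** Independence of the past factors the mean, and the increment is centred. *)
Lemma incr_indep b i r t X : (`|i.2| <= i.1)%N -> 0 <= r -> r <= t ->
  adapted (F r) X -> sqint P X -> \int[P]_w (X w * incr b i r t w) = 0.
Proof.
move=> il r0 rt aX sX; rewrite indep_RintegralM ?incr_mean ?mulr0//; first exact: sqint_incr.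
move=> A B mA mB.
have := levy_indep levyL r0 rt (aX A mA) (L2_borel_fmode b il mB).
rewrite (_ : [set w | _] = incr b i r t @^-1` B)//.
apply/seteqP; split=> w /=; first by case.
by move=> h; split=> //; apply: L2B; apply: levy_L2 => //; exact: le_trans rt.
Qed.

(** The increment is orthogonal to the value at time [r], so second moments
    subtract: [E |L_t - L_r|^2 = E |L_t|^2 - E |L_r|^2]. *)
Lemma incr_second_moment i r t : (`|i.2| <= i.1)%N -> 0 <= r -> r <= t ->
  \int[P]_w (incr true i r t w ^+ 2 + incr false i r t w ^+ 2) = (t - r) * cov_mode Q i.
Proof.
move=> il r0 rt; have t0 := le_trans r0 rt.
have aL b : adapted (F r) (fun w => fmode b i (L r w)).
  by apply: adapted_fmode => //; exact: levy_adapted levyL _ r0.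
have sr b := sqint_levy b il r0; have st b := sqint_levy b il t0.
have si b := sqint_incr b il r0 rt.
have E b : \int[P]_w (incr b i r t w ^+ 2) =
    \int[P]_w (fmode b i (L t w) ^+ 2) - \int[P]_w (fmode b i (L r w) ^+ 2).
  have z := incr_indep b il r0 rt (aL b) (sr b).
  have -> : \int[P]_w (fmode b i (L t w) ^+ 2) = \int[P]_w
    ((fmode b i (L r w) ^+ 2 + 2 * (fmode b i (L r w) * incr b i r t w)) + incr b i r t w ^+ 2).
    congr fine; apply: eq_integral => w _; congr EFin; rewrite incrE//; ring.
  have i1 := sqint_rint (sr b); have i2 := rintZ 2 (sqintM (sr b) (si b)).
  rewrite RintegralD//; [|exact: (rintD i1 i2)|exact: sqint_rint].
  rewrite RintegralD// RintegralZl//; last exact: (sqintM (sr b) (si b)).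
  by rewrite z mulr0 addr0 addrC addKr.
rewrite RintegralD//; [|exact: sqint_rint|exact: sqint_rint].
rewrite !E mulrBl -!levy_second_moment// RintegralD//; [|exact: sqint_rint|exact: sqint_rint].
rewrite RintegralD//; [|exact: sqint_rint|exact: sqint_rint].
by rewrite opprD addrACA.
Qed.
End noise.

(** * Second moments of the coefficients *)

Section moments.
Local Open Scope complex_scope.
Context (R : realType) d (Omega : measurableType d) (P : probability Omega R).
Variables (F : R -> set (set Omega)) (Q : (sphere R -> R[i]) -> (sphere R -> R[i])).
Variables (L : R -> Omega -> sphere R -> R[i]) (u0 : Omega -> sphere R -> R[i]).
Hypothesis filtF : complete_filtration P F.
Hypothesis levyL : Q_levy_process P F Q L.
Hypothesis u0F : L2_measurable (F 0) u0.
Variable tau : R.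
Hypothesis tau0 : 0 < tau.
Variable i : nat * int.
Hypothesis il : (`|i.2| <= i.1)%N.
Implicit Types (b : bool) (n : nat).

Definition scheme_mode b n (w : Omega) : R :=
  part b (mode_coef tau (u0 w) (fun t => L t w) n i).

Local Notation X := scheme_mode.
Local Notation t n := (n%:R * tau).
Local Notation D b n := (incr L b i (t n) (t n.+1)).
Local Notation mu := (tau * lambda R i.1).
Local Notation a := (1 + mu ^+ 2)^-1.

Let t_ge0 n : 0 <= t n.
Proof. by rewrite mulr_ge0 ?ler0n// ltW. Qed.

Let t_le n : t n <= t n.+1.
Proof. by rewrite ler_wpM2r ?ler_nat// ltW. Qed.

(** [(1 - i mu)^-1 = (1 + i mu) / (1 + mu^2)]. *)
Lemma symbolV : (symbol tau i)^-1 = (a +i* (a * mu)).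
Proof.
apply: (mulfI (symbol_neq0 tau i)); rewrite mulfV ?symbol_neq0//.
have h : (1 + mu ^+ 2) * a = 1 by rewrite mulfV// gt_eqF// ltr_pwDl// sqr_ge0.
apply/eqP; rewrite eq_complex /=; apply/andP; split; apply/eqP.
  by rewrite -[LHS]h; ring.
by ring.
Qed.

Lemma scheme_mode_Re n w : X true n.+1 w =
  a * ((X true n w + D false n w) - mu * (X false n w - D true n w)).
Proof.
rewrite /scheme_mode -[mode_coef _ _ _ n.+1 _]/((symbol tau i)^-1 *
  (mode_coef tau (u0 w) (fun t => L t w) n i
   - (0 +i* 1) * inner (L (t n.+1) w - L (t n) w) (Ymode i))) symbolV /incr /fmode.
by case: (mode_coef _ _ _ _ _) (inner _ _) => [x y] [x' y'] /=; ring.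
Qed.

Lemma scheme_mode_Im n w : X false n.+1 w =
  a * ((X false n w - D true n w) + mu * (X true n w + D false n w)).
Proof.
rewrite /scheme_mode -[mode_coef _ _ _ n.+1 _]/((symbol tau i)^-1 *
  (mode_coef tau (u0 w) (fun t => L t w) n i
   - (0 +i* 1) * inner (L (t n.+1) w - L (t n) w) (Ymode i))) symbolV /incr /fmode.
by case: (mode_coef _ _ _ _ _) (inner _ _) => [x y] [x' y'] /=; ring.
Qed.

Let sF n : sigma_algebra setT (F (t n)).
Proof. exact: filt_sigma filtF _ (t_ge0 n). Qed.

Lemma adapted_incr b n : adapted (F (t n.+1)) (D b n).
Proof.
rewrite (incrE levyL b i (t_ge0 n) (t_le n)).
have := @adaptedP2 _ _ _ (sF n.+1) 1 (-1) _ _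
  (adapted_fmode b il (levy_adapted levyL (t_ge0 n.+1)))
  (adapted_mono filtF (t_ge0 n) (t_le n) (adapted_fmode b il (levy_adapted levyL (t_ge0 n)))).
by congr adapted; apply/funext => w; rewrite mul1r.
Qed.

Lemma adapted_scheme_mode b n : adapted (F (t n)) (X b n).
Proof.
elim: n b => [|n IH] b.
  by rewrite mul0r; exact: (adapted_fmode b il u0F).
have aX b' := adapted_mono filtF (t_ge0 n) (t_le n) (IH b').
have aD b' := adapted_incr b' n.
have lin := @adaptedP2 _ R _ (sF n.+1).
have a1 := lin 1 1 _ _ (aX true) (aD false).
have a2 := lin 1 (-1) _ _ (aX false) (aD true).
case: b.
  have := lin a (- (a * mu)) _ _ a1 a2.
  by congr adapted; apply/funext => w; rewrite scheme_mode_Re; ring.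
have := lin a (a * mu) _ _ a2 a1.
by congr adapted; apply/funext => w; rewrite scheme_mode_Im; ring.
Qed.

Lemma measurable_scheme_mode b n : measurable_fun setT (X b n).
Proof. exact: adapted_measurable filtF _ _ (t_ge0 n) (adapted_scheme_mode b n). Qed.

Hypothesis sq0 : forall b, sqint P (X b 0%N).

Lemma sqint_scheme_mode b n : sqint P (X b n).
Proof.
elim: n b => [|n IH] b; first exact: sq0.
have sD b' := sqint_incr filtF levyL b' il (t_ge0 n) (t_le n).
have s1 := sqintD (IH true) (sD false).
have s2 := sqintD (IH false) (sqintZ (-1) (sD true)).
case: b.
  have := sqintZ a (sqintD s1 (sqintZ (- mu) s2)).
  by congr sqint; apply/funext => w; rewrite scheme_mode_Re; ring.
have := sqintZ a (sqintD s2 (sqintZ mu s1)).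
by congr sqint; apply/funext => w; rewrite scheme_mode_Im; ring.
Qed.

Definition moment n : R := \int[P]_w (X true n w ^+ 2 + X false n w ^+ 2).

(** Dividing by the symbol divides the square modulus by [1 + mu^2], and in the
    expansion of [|z - i D|^2] the cross terms have zero mean by
    independence. *)
Lemma momentS n : moment n.+1 = (moment n + tau * cov_mode Q i) / (1 + mu ^+ 2).
Proof.
have sX b := sqint_scheme_mode b n.
have sD b := sqint_incr filtF levyL b il (t_ge0 n) (t_le n).
have z b b' := incr_indep filtF levyL b il (t_ge0 n) (t_le n) (adapted_scheme_mode b' n) (sX b').
have i1 : rint P (fun w => X true n w ^+ 2 + X false n w ^+ 2).
  by apply: rintD; exact: sqint_rint.
have i2 : rint P (fun w => D true n w ^+ 2 + D false n w ^+ 2).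
  by apply: rintD; exact: sqint_rint.
have i3 := rintZ 2 (sqintM (sX true) (sD false)).
have i4 := rintZ (-2) (sqintM (sX false) (sD true)).
rewrite /moment.
(* Square modulus of [z - i D] with [z = X true + i X false], expanded and damped. *)
have -> : \int[P]_w (X true n.+1 w ^+ 2 + X false n.+1 w ^+ 2) = \int[P]_w (a *
    (((X true n w ^+ 2 + X false n w ^+ 2) + (D true n w ^+ 2 + D false n w ^+ 2)) +
     (2 * (X true n w * D false n w) + (- 2) * (X false n w * D true n w)))).
  congr fine; apply: eq_integral => w _; congr EFin.
  rewrite scheme_mode_Re scheme_mode_Im.
  have h : (1 + mu ^+ 2) * a = 1 by rewrite mulfV// gt_eqF// ltr_pwDl// sqr_ge0.
  transitivity ((1 + mu ^+ 2) * a * (a * ((X true n w + D false n w) ^+ 2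
     + (X false n w - D true n w) ^+ 2))); first by ring.
  by rewrite h; ring.
rewrite RintegralZl//; last exact: (rintD (rintD i1 i2) (rintD i3 i4)).
rewrite RintegralD//; [|exact: (rintD i1 i2)|exact: (rintD i3 i4)].
have -> : \int[P]_w ((X true n w ^+ 2 + X false n w ^+ 2) + (D true n w ^+ 2 + D false n w ^+ 2)) =
    moment n + \int[P]_w (D true n w ^+ 2 + D false n w ^+ 2) by exact: RintegralD.
have -> : \int[P]_w (2 * (X true n w * D false n w) + (- 2) * (X false n w * D true n w)) = 0.
  rewrite RintegralD// !RintegralZl//; last exact: (sqintM (sX true) (sD false)).
    by rewrite !z !mulr0 addr0.
  exact: (sqintM (sX false) (sD true)).
rewrite addr0 (incr_second_moment filtF levyL)// mulrC -/(moment n); congr (_ / _).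
by rewrite -(natr1 n); congr (_ + _ * _); ring.
Qed.

Lemma moment_ge0 n : 0 <= moment n.
Proof. by apply: Rintegral_ge0 => w _; rewrite addr_ge0 ?sqr_ge0. Qed.

Lemma moment_zero n : lambda R i.1 = 0 -> moment n = moment 0 + t n * cov_mode Q i.
Proof.
move=> l0; elim: n => [|n IH]; first by rewrite !mul0r addr0.
by rewrite momentS IH l0 mulr0 expr0n addr0 divr1 -(natr1 n); ring.
Qed.

Hypothesis q0 : 0 <= cov_mode Q i.

(** The bound [B = q / tau] on the increase is stable: [tau q <= B mu^2] since
    [mu >= tau], while the damping divides by [1 + mu^2]. *)
Lemma moment_le n : 1 <= lambda R i.1 -> moment n <= moment 0 + cov_mode Q i / tau.
Proof.
move=> l1; elim: n => [|n IH]; first by rewrite lerDl divr_ge0// ltW.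
rewrite momentS ler_pdivrMr; last by rewrite ltr_pwDl// sqr_ge0.
have mu2 : tau ^+ 2 <= mu ^+ 2.
  by rewrite exprMn ler_peMr ?sqr_ge0// expr_ge1// (le_trans ler01).
have B0 : 0 <= cov_mode Q i / tau by rewrite divr_ge0// ltW.
rewrite mulrDr mulr1 lerD//.
apply: le_trans (_ : cov_mode Q i / tau * tau ^+ 2 <= _).
  by rewrite expr2 mulrA divfK ?gt_eqF// mulrC.
by rewrite ler_pM// ?sqr_ge0// lerDr moment_ge0.
Qed.

Lemma expectation_sqmod n :
  (\int[P]_w (sqmod (mode_coef tau (u0 w) (fun t => L t w) n i))%:E = (moment n)%:E)%E.
Proof.
rewrite /moment /Rintegral fineK//.
apply: integrable_fin_num => //; apply: rintD; exact/sqint_rint/sqint_scheme_mode.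
Qed.
End moments.

(** * Mean mass and mean energy *)

Lemma ge0_integral_sum_seq d (T : measurableType d) (R : realType)
    (mu : {measure set T -> \bar R}) (I : eqType) (s : seq I) (f : I -> T -> R) :
  (forall i, i \in s -> measurable_fun setT (f i)) -> (forall i w, 0 <= f i w) ->
  (\int[mu]_w (\sum_(i <- s) f i w)%:E = \sum_(i <- s) \int[mu]_w (f i w)%:E)%E.
Proof.
move=> mf f0; pose g i := if i \in s then f i else cst 0.
have E w : \sum_(i <- s) f i w = \sum_(i <- s) g i w.
  by rewrite big_seq [RHS]big_seq; apply: eq_bigr => i si; rewrite /g si.
under eq_integral do rewrite E -sumEFin.
rewrite ge0_integral_sum//.
- by rewrite big_seq [RHS]big_seq; apply: eq_bigr => i si; rewrite /g si.
- move=> i; apply/measurable_EFinP; rewrite /g.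
  by case: ifPn => [si|_]; [exact: mf|exact: measurable_cst].
- by move=> i w _; rewrite lee_fin /g; case: ifP.
Qed.

(** Bounded deviation from a linear function is invisible in the limit of the
    ratio. *)
Lemma cvg_affine_ratio (R : realType) (x : nat -> R) (q C tau : R) : 0 < tau ->
  (forall n, q * (n%:R * tau) <= x n <= C + q * (n%:R * tau)) ->
  x n * (n%:R * tau)^-1 @[n --> \oo] --> q.
Proof.
move=> tau0 H; rewrite -(cvg_shiftS (fun n => x n * (n%:R * tau)^-1)).
have T0 n : 0 < n.+1%:R * tau by rewrite mulr_gt0// ltr0n.
apply: (@squeeze_cvgr _ _ _ _ (fun=> q) (fun n => C / tau * harmonic n + q)).
- near=> n; have /andP[h1 h2] := H n.+1.
  apply/andP; split; first by rewrite ler_pdivlMr// T0.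
  rewrite ler_pdivrMr ?T0//; apply: le_trans h2 _.
  rewrite mulrDl lerD2r /harmonic /= le_eqVlt; apply/orP; left; apply/eqP.
  have n0 : n.+1%:R != 0 :> R by rewrite pnatr_eq0.
  by move: (n.+1%:R : R) n0 => N N0; field; rewrite N0 gt_eqF.
- exact: cvg_cst.
- rewrite -[X in _ --> X]add0r -(mulr0 (C / tau)).
  apply: cvgD; last exact: cvg_cst.
  by apply: cvgMr; exact: cvg_harmonic.
Unshelve. all: by end_near. Qed.

Section fully_discrete_scheme.
Local Open Scope complex_scope.
Context (R : realType) d (Omega : measurableType d) (P : probability Omega R).
Variables (F : R -> set (set Omega)) (Q : (sphere R -> R[i]) -> (sphere R -> R[i])).
Variables (L : R -> Omega -> sphere R -> R[i]) (u0 : Omega -> sphere R -> R[i]).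
Hypothesis filtF : complete_filtration P F.
Hypothesis u0F : L2_measurable (F 0) u0.
Hypothesis covQ : covariance_operator Q.
Hypothesis levyL : Q_levy_process P F Q L.
Variables (kappa : nat) (tau : R).
Hypothesis tau0 : 0 < tau.
Local Notation s := (modes 0 kappa.+1).
Local Notation co w n i := (mode_coef tau (u0 w) (fun t => L t w) n i).
Local Notation mom i := (moment P L u0 tau i).
Implicit Types (c : nat * int -> R) (i : nat * int).

Let sil i : i \in s -> (`|i.2| <= i.1)%N.
Proof. by rewrite modesP => /andP[]. Qed.

Let mco b n i : i \in s -> measurable_fun setT (fun w => part b (co w n i)).
Proof. by move=> si; exact: (measurable_scheme_mode filtF levyL u0F tau0 (sil si) b n). Qed.

Let msq n i : i \in s -> measurable_fun setT (fun w => sqmod (co w n i)).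
Proof.
move=> si; apply: measurable_funD; apply: measurable_funX.
  exact: (mco true n si).
exact: (mco false n si).
Qed.

(** A finite weighted sum bounds every mode of positive weight; modes of weight
    zero may fail to be square integrable, as the constant mode of [u0] may when
    only its energy is integrable. *)
Lemma sqint_initial c i : (forall j, 0 <= c j) -> i \in s -> 0 < c i ->
  (\int[P]_w (\sum_(j <- s) c j * sqmod (co w 0%N j))%:E < +oo)%E ->
  forall b, sqint P (scheme_mode L u0 tau i b 0).
Proof.
move=> c0 si ci fin b; split; first exact: mco.
have h : (\int[P]_w (c i * sqmod (co w 0 i))%:E < +oo)%E.
  apply: le_lt_trans fin; apply: ge0_le_integral_monotone => w; rewrite lee_fin.
    by rewrite mulr_ge0// addr_ge0 ?sqr_ge0.
  rewrite (bigD1_seq i si (modes_uniq _ _)) /= lerDl sumr_ge0// => j _.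
  by rewrite mulr_ge0// addr_ge0 ?sqr_ge0.
have sq_ge0 w : (0 <= (sqmod (co w 0 i))%:E)%E by rewrite lee_fin addr_ge0 ?sqr_ge0.
have E : (\int[P]_w (c i * sqmod (co w 0 i))%:E =
    (c i)%:E * \int[P]_w (sqmod (co w 0 i))%:E)%E.
  under eq_integral do rewrite EFinM.
  by rewrite ge0_integralZl//; [apply/measurable_EFinP; exact: msq|rewrite lee_fin ltW].
move: h; rewrite E.
move=> h; apply: (@le_lt_trans _ _ (\int[P]_w (sqmod (co w 0 i))%:E)%E).
  by apply: ge0_le_integral_monotone => w; rewrite lee_fin ?sqr_ge0// part_le_sqmod.
have i0 : (0 <= \int[P]_w (sqmod (co w 0 i))%:E)%E by exact: integral_ge0.
by move: h i0; case: (\int[P]_w _)%E => [x| |]; rewrite ?ltry// gt0_muley.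
Qed.

(** Modes of weight zero contribute nothing, whether or not their second moment
    is finite. *)
Lemma expectation_weighted c n : (forall j, 0 <= c j) ->
  (\int[P]_w (\sum_(j <- s) c j * sqmod (co w 0%N j))%:E < +oo)%E ->
  (\int[P]_w (\sum_(j <- s) c j * sqmod (co w n j))%:E =
   (\sum_(j <- s) c j * mom j n)%:E)%E.
Proof.
move=> c0 fin.
rewrite ge0_integral_sum_seq; last 2 first.
- by move=> i si; apply: measurable_funM; [exact: measurable_cst|exact: msq].
- by move=> i w; rewrite mulr_ge0// addr_ge0 ?sqr_ge0.
rewrite -sumEFin big_seq [RHS]big_seq; apply: eq_bigr => i si.
have [ci|ci] := eqVneq (c i) 0.
  by rewrite ci mul0r integral0_eq// => w _; rewrite mul0r.
have {}ci : 0 < c i by rewrite lt0r ci c0.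
under eq_integral do rewrite EFinM.
rewrite ge0_integralZl//; last 3 first.
- by apply/measurable_EFinP; exact: msq.
- by move=> w _; rewrite lee_fin addr_ge0 ?sqr_ge0.
- by rewrite lee_fin ltW.
rewrite (expectation_sqmod filtF levyL tau0 (sil si)) ?EFinM//.
exact: sqint_initial ci fin.
Qed.

Lemma lambda_cases i : i \in s -> (i = (0%N, 0)) \/ 1 <= lambda R i.1.
Proof.
move=> /sil; case: i => -[|l] m /= il; first by left; congr pair; lia.
by right; rewrite /lambda ler1n muln_gt0.
Qed.

Lemma lambda_ge0 l : 0 <= lambda R l.
Proof. exact: ler0n. Qed.

Definition zero_mode : nat * int := (0%N, 0).

Lemma zero_mode_in : zero_mode \in s.
Proof. by rewrite modesP. Qed.

Lemma cvarianceE : cvariance P (mode 0%N 0 L 1) = (cov_mode Q zero_mode)%:E.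
Proof.
have il : (`|zero_mode.2| <= zero_mode.1)%N by [].
rewrite /cvariance /mode (levy_mean0 levyL ler01 (Ymode_L2 R zero_mode)) unlock.
have st b := sqint_levy filtF levyL b il ler01.
rewrite -[cov_mode _ _]mul1r -(levy_second_moment levyL il ler01) /Rintegral fineK.
  apply: eq_integral => w _; rewrite subr0.
  by congr EFin; rewrite /sqmod /fmode.
by apply: integrable_fin_num => //; apply: rintD; exact/sqint_rint/st.
Qed.

Lemma massE n : mass kappa tau u0 L n =
  (fun w => \sum_(i <- s) 1 * sqmod (co w n i)).
Proof.
apply/funext => w; rewrite /mass /EM_solution backward_EM_comb comb_norm.
by apply: eq_bigr => i _; rewrite mul1r.
Qed.

Lemma energyE n : energy kappa tau u0 L n =
  (fun w => \sum_(i <- s) lambda R i.1 * sqmod (co w n i)).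
Proof.
by apply/funext => w; rewrite /energy /EM_solution backward_EM_comb energy_comb.
Qed.

(** The growing mode and the bounded ones in one formula, ready to be summed. *)
Lemma mom_le i n : i \in s -> (forall b, sqint P (scheme_mode L u0 tau i b 0)) ->
  mom i n <= mom i 0 + cov_mode Q i / tau
             + (i == zero_mode)%:R * (n%:R * tau * cov_mode Q zero_mode).
Proof.
move=> si sq0; have q0 := cov_mode_ge0 covQ i.
have T0 : 0 <= n%:R * tau by rewrite mulr_ge0 ?ler0n// ltW.
have [E|l1] := lambda_cases si.
  rewrite E in q0 si sq0 *.
  have l0 : lambda R zero_mode.1 = 0 by rewrite /lambda mul0n.
  rewrite (moment_zero filtF levyL u0F tau0 (sil si) sq0 n l0).
  by rewrite eqxx mul1r lerD2r lerDl divr_ge0// ltW.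
apply: le_trans (moment_le filtF levyL u0F tau0 (sil si) sq0 q0 n l1) _.
by rewrite lerDl mulr_ge0 ?ler0n// mulr_ge0// cov_mode_ge0.
Qed.

Lemma mass_estimate n :
  (forall i, i \in s -> forall b, sqint P (scheme_mode L u0 tau i b 0)) ->
  \sum_(i <- s) 1 * mom i n <= \sum_(i <- s) 1 * mom i 0
    + (\sum_(i <- s) cov_mode Q i) / tau + n%:R * tau * cov_mode Q zero_mode.
Proof.
move=> sq0.
have -> : n%:R * tau * cov_mode Q zero_mode =
    \sum_(i <- s) (i == zero_mode)%:R * (n%:R * tau * cov_mode Q zero_mode).
  rewrite (bigD1_seq _ zero_mode_in (modes_uniq _ _)) eqxx mul1r.
  by rewrite big1 => [|i /negbTE ->]; [exact/esym/addr0|rewrite mul0r].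
rewrite mulr_suml -!big_split /= big_seq [leRHS]big_seq; apply: ler_sum => i si.
by rewrite !mul1r; apply: mom_le => //; exact: sq0.
Qed.

Lemma mass_lower n :
  (forall i, i \in s -> forall b, sqint P (scheme_mode L u0 tau i b 0)) ->
  cov_mode Q zero_mode * (n%:R * tau) <= \sum_(i <- s) 1 * mom i n.
Proof.
move=> sq0; rewrite (bigD1_seq _ zero_mode_in (modes_uniq _ _)) /= mul1r.
have l0 : lambda R zero_mode.1 = 0 by rewrite /lambda mul0n.
rewrite (moment_zero filtF levyL u0F tau0 (sil zero_mode_in) (sq0 _ zero_mode_in) n l0).
rewrite mulrC -[leLHS]add0r -addrA lerD ?moment_ge0// lerDl.
by apply: sumr_ge0 => i _; rewrite mul1r moment_ge0.
Qed.

Lemma energy_estimate n :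
  (forall i, i \in s -> 1 <= lambda R i.1 -> forall b, sqint P (scheme_mode L u0 tau i b 0)) ->
  \sum_(i <- s) lambda R i.1 * mom i n <= \sum_(i <- s) lambda R i.1 * mom i 0
    + (\sum_(i <- s) lambda R i.1 * cov_mode Q i) / tau.
Proof.
move=> sq0; rewrite mulr_suml -big_split /= big_seq [leRHS]big_seq; apply: ler_sum => i si.
have [->|l1] := lambda_cases si; first by rewrite /lambda !mul0r addr0.
rewrite -mulrA -mulrDr ler_wpM2l ?lambda_ge0//.
exact: (moment_le filtF levyL u0F tau0 (sil si) (sq0 i si l1) (cov_mode_ge0 covQ i) n l1).
Qed.

End fully_discrete_scheme.

Theorem proposition12 (R : realType) (d : measure_display)
    (Omega : measurableType d) (P : probability Omega R)
    (F : R -> set (set Omega)) (u0 : Omega -> sphere R -> R[i])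
    (L : R -> Omega -> sphere R -> R[i])
    (Q : (sphere R -> R[i]) -> (sphere R -> R[i]))
    (kappa : nat) (tau : R) :
  complete_filtration P F ->
  L2_measurable (F 0) u0 ->
  covariance_operator Q ->
  (trace Q < +oo)%E ->
  Q_levy_process P F Q L ->
  (0 < kappa)%N ->
  0 < tau ->
  let M := mass kappa tau u0 L in
  let E := energy kappa tau u0 L in
  let t := fun n : nat => n%:R * tau in
  let v00 := cvariance P (mode 0%N 0 L 1) in
  (('E_P[M 0%N] < +oo)%E ->
    (forall n : nat, ('E_P[M n] <=
      'E_P[M 0%N] + trace (truncate kappa Q) * (tau^-1)%:E + (t n)%:E * v00)%E)
    /\ (('E_P[M n] * ((t n)^-1)%:E)%E @[n --> \oo] --> v00))
  /\
  ((\forall w \ae P, @H1 R (u0 w)) ->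
   ('E_P[E 0%N] < +oo)%E ->
    (forall n : nat, ('E_P[E n] <=
      'E_P[E 0%N] +
      (tracek kappa (truncate kappa Q \o (fun f => - laplace_beltrami f)%R)
        / tau)%:E)%E)
    /\ (('E_P[E n] * ((t n)^-1)%:E)%E @[n --> \oo] --> 0%E)).
Proof.
move=> filtF u0F covQ _ levyL _ tau0 M E t v00.
pose s := modes 0 kappa.+1.
split=> [finM|_ finE].
  have c0 (j : nat * int) : 0 <= (1 : R) by exact: ler01.
  have fin := finM; rewrite unlock /M massE in fin.
  have sq0 i (si : i \in s) : forall b, sqint P (scheme_mode L u0 tau i b 0).
    exact: (sqint_initial filtF u0F levyL tau0 c0 si ltr01 fin).
  have EM n : 'E_P[M n]%E = (\sum_(i <- s) 1 * moment P L u0 tau i n)%:E.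
    by rewrite unlock /M massE (expectation_weighted filtF u0F levyL tau0 n c0 fin).
  have vE : v00 = (cov_mode Q zero_mode)%:E by exact: cvarianceE levyL.
  split=> [n|].
    rewrite !EM vE; apply: le_trans (_ : (_ <= (\sum_(i <- s) 1 * moment P L u0 tau i 0)%R%:E
      + (\sum_(i <- s) cov_mode Q i)%R%:E * (tau^-1)%:E + (t n)%:E * (cov_mode Q
        zero_mode)%:E)%E) _.
      by rewrite -!EFinM -!EFinD lee_fin; exact: (mass_estimate filtF u0F covQ levyL tau0 n sq0).
    rewrite leeD2r// leeD2l// lee_wpmul2r//; last exact: (trace_truncate_ge covQ kappa).
    by rewrite lee_fin invr_ge0 ltW.
  rewrite vE; under eq_fun do rewrite EM -EFinM.
  apply: cvg_EFin; first by near=> n.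
  apply: (@cvg_affine_ratio _ _ _ (\sum_(i <- s) 1 * moment P L u0 tau i 0
     + (\sum_(i <- s) cov_mode Q i) / tau)) => // n.
  rewrite (mass_lower filtF u0F levyL tau0 n sq0) /=.
  by rewrite [_ * (n%:R * tau)]mulrC; exact: (mass_estimate filtF u0F covQ levyL tau0 n sq0).
have c0 (j : nat * int) : 0 <= lambda R j.1 by exact: lambda_ge0.
have fin := finE; rewrite unlock /E energyE in fin.
have sq0 i (si : i \in s) : 1 <= lambda R i.1 ->
    forall b, sqint P (scheme_mode L u0 tau i b 0).
  move=> l1; have l0 : 0 < lambda R i.1 by exact: lt_le_trans l1.
  exact: (sqint_initial filtF u0F levyL tau0 c0 si l0 fin).
have EE n : 'E_P[E n]%E = (\sum_(i <- s) lambda R i.1 * moment P L u0 tau i n)%:E.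
  by rewrite unlock /E energyE (expectation_weighted filtF u0F levyL tau0 n c0 fin).
have est n := energy_estimate filtF u0F covQ levyL tau0 n sq0.
clearbody E.
split=> [n|].
  by rewrite (EE n) (EE 0%N) (tracek_energy covQ kappa) -EFinD lee_fin est.
under eq_fun do rewrite EE -EFinM.
apply: cvg_EFin; first by near=> n.
apply: (@cvg_affine_ratio _ _ _ (\sum_(i <- s) lambda R i.1 * moment P L u0 tau i 0
  + (\sum_(i <- s) lambda R i.1 * cov_mode Q i) / tau)) => // n.
rewrite !mul0r addr0 est andbT; apply: sumr_ge0 => i _.
by rewrite mulr_ge0// moment_ge0.
Unshelve. all: by end_near. Qed.
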